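(* Let $1\le m\le n$, $\beta\in\mathbb R$, and set $z=(x_1,\dots,x_m)$. (1) Let $1<p<\infty$ and $\Omega\subset\mathbb R^N$ open; if $m+\beta<0$ assume also $\Omega\subset(\mathbb R^m\setminus\{0\})\times\mathbb R^{N-m}$. Then for every $u\in C^1_0(\Omega)$, $$\Big(\frac{|m+\beta|}{p}\Big)^p\int_\Omega|u|^p|z|^\beta d\xi\le\int_\Omega|\nabla_\gamma u|^p|z|^{p+\beta}d\xi,$$ and in particular $\big(\frac{|m-p|}{p}\big)^p\int_\Omega\frac{|u|^p}{\|\xi\|_\gamma^p}d\xi\le\big(\frac{|m-p|}{p}\big)^p\int_\Omega\frac{|u|^p}{|z|^p}d\xi\le\int_\Omega|\nabla_\gamma u|^pd\xi$. If $(B^m_r\setminus\{0\})\times B^{N-m}_r\subset\Omega$ for some $r>0$, the constant $(|m+\beta|/p)^p$ is sharp. (2) Let $p=m>1$, $R>0$, $\Omega=\{\xi=(z,x_{m+1},\dots,x_n,y):|z|<R\}$ and $\beta<-1$. Then for every $u\in C^1_0(\Omega)$, $$\Big(\frac{|\beta+1|}{p}\Big)^p\int_\Omega\frac{|u|^p}{|z|^p}\Big(\ln\frac R{|z|}\Big)^\beta d\xi\le\int_\Omega|\nabla_\gamma u|^p\Big(\ln\frac R{|z|}\Big)^{p+\beta}d\xi,$$ in particular $\big(\frac{p-1}{p}\big)^p\int_\Omega\frac{|u|^p}{(|z|\ln(R/|z|))^p}d\xi\le\int_\Omega|\nabla_\gamma u|^pd\xi$; the constant $(|\beta+1|/p)^p$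 is sharp.
   Context: $\mathbb R^N$ is split as $\xi=(x,y)\in\mathbb R^n\times\mathbb R^k$, $\gamma\ge0$, $\nabla_\gamma=(\nabla_x,|x|^\gamma\nabla_y)$, and $\|\xi\|_\gamma:=\big(|x|^{2(1+\gamma)}+(1+\gamma)^2|y|^2\big)^{1/(2+2\gamma)}$. $B^s_r$ denotes the Euclidean ball in $\mathbb R^s$ of radius $r$ centred at the origin. ''Sharp'' means the constant cannot be replaced by any larger one. *)

(* Defs.v *)
From HB Require Import structures.
From mathcomp Require Import all_boot all_order all_algebra.
From mathcomp Require Import all_classical all_reals all_analysis.
Set Implicit Arguments. Unset Strict Implicit. Unset Printing Implicit Defensive.
Import Order.TTheory GRing.Theory Num.Theory.
Import numFieldNormedType.Exports.
Local Open Scope classical_set_scope.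
Local Open Scope ring_scope.

(* Lebesgue integral on R^N of a nonnegative extended-real function, computed as
   the iterated one-dimensional Lebesgue integral over the coordinates
   (equal to the N-dimensional Lebesgue integral for nonnegative measurable
   functions, by Tonelli). *)
Fixpoint lebN (R : realType) (N : nat) : ('rV[R]_N -> \bar R) -> \bar R :=
  match N return ('rV[R]_N -> \bar R) -> \bar R with
  | 0 => fun f => f 0
  | N'.+1 => fun f =>
      (\int[@lebesgue_measure R]_(t in [set: R])
         lebN (fun v : 'rV[R]_N' =>
           f (\row_(i < N'.+1) if unlift ord0 i is Some j then v ord0 j else t)))%E
  end.

Definition intOn (R : realType) (N : nat) (Omega : set 'rV[R]_N)
  (g : 'rV[R]_N -> R) : \bar R :=
  lebN (fun xi => if `[< Omega xi >] then (g xi)%:E else 0%E).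

Definition enorm (R : realType) (N : nat) (v : 'rV[R]_N) : R :=
  Num.sqrt (\sum_(i < N) v ord0 i ^+ 2).

Definition xco (R : realType) (n k : nat) (xi : 'rV[R]_(n + k)) (i : 'I_n) : R :=
  xi ord0 (lshift k i).
Definition yco (R : realType) (n k : nat) (xi : 'rV[R]_(n + k)) (j : 'I_k) : R :=
  xi ord0 (rshift n j).

Definition normx (R : realType) (n k : nat) (xi : 'rV[R]_(n + k)) : R :=
  Num.sqrt (\sum_(i < n) xco xi i ^+ 2).
Definition normy (R : realType) (n k : nat) (xi : 'rV[R]_(n + k)) : R :=
  Num.sqrt (\sum_(j < k) yco xi j ^+ 2).

Definition normz (R : realType) (n k m : nat) (xi : 'rV[R]_(n + k)) : R :=
  Num.sqrt (\sum_(i < n | (i < m)%N) xco xi i ^+ 2).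

Definition normrest (R : realType) (n k m : nat) (xi : 'rV[R]_(n + k)) : R :=
  Num.sqrt (\sum_(i < n | (m <= i)%N) xco xi i ^+ 2 + \sum_(j < k) yco xi j ^+ 2).

Definition gaugeG (R : realType) (n k : nat) (gamma : R) (xi : 'rV[R]_(n + k)) : R :=
  (normx xi `^ (2 * (1 + gamma)) + (1 + gamma) ^+ 2 * normy xi ^+ 2)
    `^ (1 / (2 + 2 * gamma)).

Definition pderiv (R : realType) (N : nat) (u : 'rV[R]_N -> R) (i : 'I_N)
  (xi : 'rV[R]_N) : R := 'D_(delta_mx ord0 i) u xi.

(* |nabla_gamma u (xi)|, nabla_gamma = (nabla_x, |x|^gamma nabla_y) *)
Definition gradG_norm (R : realType) (n k : nat) (gamma : R)
  (u : 'rV[R]_(n + k) -> R) (xi : 'rV[R]_(n + k)) : R :=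
  Num.sqrt (\sum_(i < n) pderiv u (lshift k i) xi ^+ 2
            + (normx xi `^ gamma) ^+ 2 * \sum_(j < k) pderiv u (rshift n j) xi ^+ 2).

Definition C10 (R : realType) (N : nat) (Omega : set 'rV[R]_N)
  (u : 'rV[R]_N -> R) : Prop :=
  (forall xi, differentiable u xi) /\
  (forall i : 'I_N, continuous (pderiv u i)) /\
  compact (closure [set xi | u xi != 0]) /\
  closure [set xi | u xi != 0] `<=` Omega.

(* Main.v *)
Require Import Defs.
From HB Require Import structures.
From mathcomp Require Import all_boot all_order all_algebra.
From mathcomp Require Import all_classical all_reals all_analysis.
From mathcomp Require Import measurable_realfun ring lra.
Import Order.TTheory GRing.Theory Num.Theory.
Import numFieldNormedType.Exports.
Local Open Scope classical_set_scope.
Local Open Scope ring_scope.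
Set Implicit Arguments. Unset Strict Implicit. Unset Printing Implicit Defensive.

(** * Weighted Hardy inequalities along the dilations of z

Both inequalities are one-dimensional along the orbits s |-> (e^s z, rest). On an
orbit, d/ds u is z . grad_z u, hence at most |z| |nabla_gamma u|, because z consists
of x-coordinates only; the Jacobian of the dilation is e^(m s). With g(s) = u(e^s z,
rest) the claims become Hardy inequalities on the line for the weights e^((m+beta) s)
and (ln R - ln |z| - s)^beta, which follow by integrating (|g|^p W)' for a primitive W
of the weight and Young's inequality. Averaging over s in R of the translated
integrals, cut off to the shell 1 <= |z| < e, takes the place of polar coordinates.

For sharpness, take u(xi) = f(ln |z|) G(|rest|) with f a slowly varying truncation of
the extremal e^(a t) (respectively (ln R - t)^a) whose support is far towards
t = -oo, and G a fixed cut-off. The part of the gradient falling on G carries an extra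
factor |z|, negligible on the support, so the quotient of the two integrals tends to
the quotient in one dimension. *)

(** * The iterated integral as a measure and its polar form *)

(** The integral is given only as an iteration of one-dimensional integrals, so additivity,
    monotonicity and Tonelli in R^N are recovered by exhibiting a measure behind it. The shell has
    logarithmic width one; hence averaging over s counts every point with z != 0 with total weight
    exactly one, and no measure on the sphere enters. The sign of W' decides which end of an orbit
    must be controlled. For m + beta > 0 the boundary term at z = 0 has the favourable sign; for m +
    beta < 0 it has the wrong one, which is why the support must then stay away from z = 0. With the
    logarithmic weight and beta < -1 the end z = 0 is harmless again, and compact support keeps u
    away from |z| = R. If |W'| = kappa w, Young's inequality with a free scale lambda yields the
    factor lambda^(p-1) kappa - (p-1) lambda^p, whose maximum, at lambda = kappa / p, is the
    constant (kappa / p)^p. *)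

Definition row_display : measure_display.
Proof. exact: (default_measure_display). Qed.

Section measurable_row.
Variables (R : realType) (N : nat).
Let coord (i : 'I_N) (v : 'rV[R]_N) : measurableTypeR R := v ord0 i.

Let row_set0 : g_sigma_preimage coord set0.
Proof. exact: sigma_algebra0. Qed.

Let row_setC A : g_sigma_preimage coord A -> g_sigma_preimage coord (~` A).
Proof. exact: sigma_algebraC. Qed.

Let row_bigcup (F : _^nat) : (forall i, g_sigma_preimage coord (F i)) ->
  g_sigma_preimage coord (\bigcup_i (F i)).
Proof. exact: sigma_algebra_bigcup. Qed.

(** Generated by the coordinates, so that measurability of a row-valued map can be tested on its
    entries. *)
HB.instance Definition _ := @isMeasurable.Build row_display
  'rV[R]_N (g_sigma_preimage coord) row_set0 row_setC row_bigcup.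

Lemma measurable_coord (i : 'I_N) :
  measurable_fun [set: 'rV[R]_N] (fun v : 'rV[R]_N => v ord0 i).
Proof.
move=> _ Y mY; rewrite setTI; apply: sub_sigma_algebra => /=.
rewrite -bigcup_seq/=; exists i => /=; first by rewrite mem_index_enum.
by exists Y => //; rewrite setTI.
Qed.

Lemma measurable_fun_row d (T : measurableType d) (f : T -> 'rV[R]_N) :
  (forall i, measurable_fun [set: T] (fun x => f x ord0 i)) ->
  measurable_fun [set: T] f.
Proof.
move=> mf _ A mA; rewrite setTI.
suff : g_sigma_preimage (fun i => coord i \o f) `<=` measurable.
  by apply; rewrite g_sigma_preimage_comp; exists A => //; rewrite setTI.
apply: smallest_sub; first exact: sigma_algebra_measurable.
case: N f mf A mA @coord row_set0 row_setC row_bigcup=> [|n] f mf A mA coord' _ _ _; first by rewrite big_ord0.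
rewrite -bigcup_mkord_ord; apply: bigcup_sub => i Ii.
by move=> B [C mC <-]; apply: mf.
Qed.
End measurable_row.

(** Gives a name to the row built inside the recursion of [lebN]. *)
Definition rcons0 (R : realType) (N : nat) (t : R) (v : 'rV[R]_N) : 'rV[R]_N.+1 :=
  \row_(i < N.+1) if unlift ord0 i is Some j then v ord0 j else t.

Lemma rcons0E (R : realType) (N : nat) (t : R) (v : 'rV[R]_N) :
  (rcons0 t v ord0 ord0 = t) * (forall j, rcons0 t v ord0 (lift ord0 j) = v ord0 j).
Proof. by split => [|j]; rewrite mxE ?unlift_none ?liftK. Qed.

Lemma measurable_rcons0 (R : realType) (N : nat) :
  measurable_fun [set: measurableTypeR R * 'rV[R]_N] (fun x => rcons0 x.1 x.2).
Proof.
apply: measurable_fun_row => i; case: (unliftP ord0 i) => [j ->|->].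
  under eq_fun do rewrite rcons0E.
  exact: (measurableT_comp (measurable_coord j)).
under eq_fun do rewrite rcons0E.

exact: measurable_fst.
Qed.

Lemma measurable_rcons0r (R : realType) (N : nat) (t : R) :
  measurable_fun [set: 'rV[R]_N] (rcons0 t).
Proof.
apply: measurable_fun_row => i; case: (unliftP ord0 i) => [j ->|->].
  under eq_fun do rewrite rcons0E.
  exact: measurable_coord.
under eq_fun do rewrite rcons0E.
exact: measurable_cst.
Qed.

Lemma lebNS (R : realType) (N : nat) (f : 'rV[R]_N.+1 -> \bar R) :
  lebN f = (\int[@lebesgue_measure R]_t lebN (fun v => f (rcons0 t v)))%E.
Proof. by []. Qed.

(** By induction: the measure for [N.+1] is the product of Lebesgue measure with the one for [N],
    pushed forward along [rcons0], and Tonelli unfolds its integral into the iteration.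
    Sigma-finiteness is part of the claim because the next product requires it. *)
Lemma lebN_measure (R : realType) (N : nat) :
  exists mu : {sigma_finite_measure set 'rV[R]_N -> \bar R},
    forall f : 'rV[R]_N -> \bar R, measurable_fun setT f -> (forall x, 0 <= f x)%E ->
      lebN f = (\int[mu]_x f x)%E.
Proof.
elim: N => [|N [mu IH]].
  exists (\d_(0 : 'rV[R]_0)) => f mf f0.
  by rewrite integral_dirac//= diracT mul1e.
pose phi (x : measurableTypeR R * 'rV[R]_N) := rcons0 x.1 x.2.
have mphi : measurable_fun setT phi := @measurable_rcons0 R N.
pose psi (v : 'rV[R]_N.+1) : measurableTypeR R * 'rV[R]_N :=
  (v ord0 ord0, \row_j v ord0 (lift ord0 j)).
have phiK : cancel phi psi.
  move=> [t v]; rewrite /psi /phi rcons0E; congr pair.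
  by apply/rowP => j; rewrite mxE rcons0E.
have mpsi : measurable_fun setT psi.
  apply/measurable_fun_pair; first exact: measurable_coord.
  apply: measurable_fun_row => i; under eq_fun do rewrite mxE.
  exact: measurable_coord.
pose lam : {measure set (measurableTypeR R * 'rV[R]_N)%type -> \bar R} :=
  (@lebesgue_measure R \x mu)%E.
pose nu : {measure set 'rV[R]_N.+1 -> \bar R} := 
  measure_function_pushforward__canonical__measure_function_Measure lam mphi.
(* The exhausting sets are the [psi]-preimages of rectangles: pulling them back along [phi] returns
   the rectangles, whose measure is a finite product. *)
have nuS : sigma_finite setT nu.
  have /sigma_finiteP[F [TF ndF Foo]] := sigma_finiteT (@lebesgue_measure R).
  have /sigma_finiteP[G [TG ndG Goo]] := sigma_finiteT mu.
  exists (fun i => psi @^-1` (F i `*` G i)) => [|i].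
    rewrite -preimage_bigcup; apply/esym; rewrite -subTset => v _ /=.
    have [] : setT (psi v).1 /\ setT (psi v).2 by [].
    rewrite {1}TF TG => -[i _ Fi] [j _ Gj]; exists (maxn i j) => //; split.
      by move: Fi; exact/subsetPset/ndF/leq_maxl.
    by move: Gj; exact/subsetPset/ndG/leq_maxr.
  have [mF Fi] := Foo i; have [mG Gi] := Goo i; split.
    by rewrite -[X in measurable X]setTI; apply: mpsi => //; exact: measurableX.
  rewrite /nu /= /pushforward -comp_preimage (_ : psi \o phi = id); last first.
    by apply/funext => x; exact: phiK.
  by rewrite /lam/= product_measure1E// lte_mul_pinfty// ge0_fin_numE.
pose nuM : {sigma_finite_measure set 'rV[R]_N.+1 -> \bar R} :=
  
  HB.pack (Measure.sort nu) (@Measure_isSigmaFinite.Build _ _ _ (Measure.sort nu) nuS).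
exists nuM => f mf f0.
rewrite /= /nu ge0_integral_pushforward//=.
rewrite preimage_setT fubini_tonelli1//; last exact: measurableT_comp.
apply: eq_integral => t _; rewrite IH//.
exact: (measurableT_comp mf (measurable_rcons0r t)).
Qed.

(** * Open sets and continuous functions on the row space *)

Section row_borel.
Variables (R : realType) (N : nat).

Lemma measurable_row_ball (c : 'rV[R]_N) (e : R) : measurable (ball c e).
Proof.
(* Balls of radius [e <= 0] are empty, whereas the intersection of the coordinate conditions is
   everything when [N = 0]. *)
have [e0|e0] := ltP 0 e; last first.
  suff -> : ball c e = set0 by [].
  by rewrite -subset0 => v -[]; rewrite ltNge e0.
suff -> : ball c e = \bigcap_(i in [set: 'I_N])
    ((fun v : 'rV[R]_N => v ord0 i) @^-1` ball (c ord0 i) e).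
  apply: fin_bigcap_measurable; first exact: finite_finset.
  move=> i _; rewrite -[X in measurable X]setTI.
  by apply: measurable_coord => //; exact: measurable_ball.
apply/seteqP; split => v; first by move=> [_ vi] i _ /=; exact: vi.
by move=> vi; split => // i j; rewrite !ord1; exact: vi.
Qed.

(** The countable basis of balls with rational centre and radius 1 / (k + 1) writes an open set as a
    countable union of measurable sets. *)
Lemma open_measurable_row (U : set 'rV[R]_N) : open U -> measurable U.
Proof.
move=> oU.
pose B (x : 'rV[rat]_N * nat) : set 'rV[R]_N :=
  ball (map_mx ratr x.1 : 'rV[R]_N) x.2.+1%:R^-1.
suff -> : U = \bigcup_(x in [set: 'rV[rat]_N * nat])
    (if `[< B x `<=` U >] then B x else set0).
  apply: countable_bigcupT_measurable => // x.
  by case: asboolP => // _; exact: measurable_row_ball.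
apply/seteqP; split => v; last first.
  by move=> [x _]; case: asboolP => // + Bv; exact.
move=> Uv; have /nbhs_ballP[e/= e0 eU] : nbhs v U by exact: open_nbhs_nbhs.
have e20 : 0 < e / 2 by rewrite divr_gt0.
(* A radius below [e / 2] and a centre within that radius of [v] put [v] in the ball and the ball
   inside [ball v e]. *)
have [k _ /(_ k (leqnn k))/= ke] := near_infty_natSinv_lt (PosNum e20).
set d : R := k.+1%:R^-1 in ke.
have d0 : 0 < d by rewrite invr_gt0.
have /choice[q qv] i : exists q : rat, `|v ord0 i - ratr q| < d.
  have /rat_in_itvoo[q] : v ord0 i - d < v ord0 i + d by rewrite ltrD2l gt0_cp.
  by rewrite in_itv/= => /andP[q1 q2]; exists q; rewrite ltr_distlC q1 q2.
have qE i : (map_mx ratr (\row_j q j) : 'rV[R]_N) ord0 i = ratr (q i).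
  by rewrite !mxE.
exists (\row_j q j, k) => //; rewrite asboolT; last first.
  move=> w [_ wq]; apply: eU; split => // i j; rewrite ord1 {i}.
  have := wq ord0 j; have := qv j; rewrite qE /ball/= -/d => h1 h2.
  have := ler_distD (ratr (q j)) (v ord0 j) (w ord0 j); lra.
by split => // i j; rewrite ord1 qE /ball/= distrC.
Qed.

Lemma continuous_measurable_row (f : 'rV[R]_N -> R) :
  continuous f -> measurable_fun [set: 'rV[R]_N] f.
Proof.
move=> /continuousP cf; apply: (measurability _ (RGenOpens.measurableE R)).
move=> _ [_ [a [b ->] <-]]; rewrite setTI; apply: open_measurable_row.
exact/cf/interval_open.
Qed.

End row_borel.

(** The pushforward of Lebesgue measure by the affine map, multiplied by c, gives every interval its
    length, hence it is Lebesgue measure. *)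
Lemma ge0_integral_affine (R : realType) (c a : R) (f : R -> \bar R) :
  0 < c -> measurable_fun [set: R] f -> (forall t, 0 <= f t)%E ->
  (\int[@lebesgue_measure R]_t f t =
   c%:E * \int[@lebesgue_measure R]_t f (c * t + a)%R)%E.
Proof.
move=> c0 mf f0.
pose phi : measurableTypeR R -> measurableTypeR R := fun t => c * t + a.
have mphi : measurable_fun [set: measurableTypeR R] phi.
  apply: continuous_measurable_fun => x.
  by apply: cvgD; [apply: cvgM; [exact: cvg_cst|exact: cvg_id]|exact: cvg_cst].
pose nu : {measure set (measurableTypeR R) -> \bar R} :=
  measure_function_pushforward__canonical__measure_function_Measure
    (@lebesgue_measure R) mphi.
pose c' : {nonneg R} := NngNum (ltW c0).
transitivity (\int[mscale c' nu]_t f t)%E.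
  apply: eq_measure_integral => A mA _; apply: lebesgue_measure_unique => //.
  move=> _ [[x y] _ <-].
  transitivity (c%:E * @lebesgue_measure R (phi @^-1` `]x, y]))%E; last by [].
  have -> : phi @^-1` `]x, y] = `](x - a) / c, (y - a) / c]%classic.
    apply/seteqP; split => t; rewrite /= !in_itv /= /phi ltr_pdivrMr// ler_pdivlMr//.
      by rewrite ltrBlDr lerBrDr (mulrC t).
    by rewrite ltrBlDr lerBrDr (mulrC t).
  rewrite !lebesgue_measure_itv /= !lte_fin ltr_pM2r ?invr_gt0// ltrD2r.
  case: ifPn => _; last by rewrite mule0.
  by rewrite -EFinB -EFinB -EFinM; congr EFin; field; rewrite gt_eqF.
by rewrite ge0_integral_mscale//= ge0_integral_pushforward//.
Qed.

(** * Integration rules for the iterated integral *)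

Section lebN_theory.
Local Open Scope ereal_scope.
Variables (R : realType) (N : nat).
Implicit Types f g : 'rV[R]_N -> \bar R.

Lemma lebN_ge0 f : (forall x, 0 <= f x) -> 0 <= lebN f.
Proof.
elim: N f => [|N' IH] f f0; first exact: f0.
by apply: integral_ge0 => t _; apply: IH => v; exact: f0.
Qed.

Lemma eq_lebN f g : f =1 g -> lebN f = lebN g.
Proof. by move=> /funext ->. Qed.

Lemma le_lebN f g : measurable_fun [set: 'rV[R]_N] f ->
  measurable_fun [set: 'rV[R]_N] g -> (forall x, 0 <= f x) ->
  (forall x, f x <= g x) -> lebN f <= lebN g.
Proof.
move=> mf mg f0 fg; have [mu muE] := @lebN_measure R N.
have g0 x : 0 <= g x := le_trans (f0 x) (fg x).
by rewrite !muE//; apply: ge0_le_integral.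
Qed.

Lemma lebND f g : measurable_fun [set: 'rV[R]_N] f ->
  measurable_fun [set: 'rV[R]_N] g -> (forall x, 0 <= f x) ->
  (forall x, 0 <= g x) -> lebN (fun x => f x + g x) = lebN f + lebN g.
Proof.
move=> mf mg f0 g0; have [mu muE] := @lebN_measure R N.
rewrite !muE//.
- exact: ge0_integralD.
- exact: emeasurable_funD.
- by move=> x; exact: adde_ge0.
Qed.

Lemma lebNZl f (c : R) : measurable_fun [set: 'rV[R]_N] f ->
  (forall x, 0 <= f x) -> (0 <= c)%R ->
  lebN (fun x => c%:E * f x) = c%:E * lebN f.
Proof.
move=> mf f0 c0; have [mu muE] := @lebN_measure R N.
rewrite !muE//.
- exact: ge0_integralZl_EFin.
- exact: measurable_funeM.
- by move=> x; rewrite mule_ge0.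
Qed.

Lemma measurable_lebN d (T : measurableType d) (f : T * 'rV[R]_N -> \bar R) :
  measurable_fun [set: T * 'rV[R]_N] f -> (forall x, 0 <= f x) ->
  measurable_fun [set: T] (fun t => lebN (fun v => f (t, v))).
Proof.
move=> mf f0; have [mu muE] := @lebN_measure R N.
rewrite (_ : (fun t => _) = fubini_F mu f).
  exact: measurable_fun_fubini_tonelli_F.
by apply/funext => t; rewrite muE//; exact: (measurableT_comp mf).
Qed.

Lemma lebN_integral_swap (f : measurableTypeR R * 'rV[R]_N -> \bar R) :
  measurable_fun [set: measurableTypeR R * 'rV[R]_N] f -> (forall x, 0 <= f x) ->
  \int[@lebesgue_measure R]_t lebN (fun v => f (t, v)) =
  lebN (fun v => \int[@lebesgue_measure R]_t f (t, v)).
Proof.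
move=> mf f0; have [mu muE] := @lebN_measure R N.
rewrite muE; last 2 first.
- exact: (measurable_fun_fubini_tonelli_G (m1 := @lebesgue_measure R)).
- by move=> v; apply: integral_ge0.
rewrite -fubini_tonelli//; apply: eq_integral => t _.
by rewrite muE//; exact: (measurableT_comp mf).
Qed.

End lebN_theory.

Lemma lebN_dilation (R : realType) (N : nat) (c : 'I_N -> R)
  (f : 'rV[R]_N -> \bar R) : (forall i, 0 < c i) ->
  measurable_fun [set: 'rV[R]_N] f -> (forall x, 0 <= f x)%E ->
  (lebN f = (\prod_i c i)%:E * lebN (fun v => f (\row_i (c i * v ord0 i))%R))%E.
Proof.
elim: N c f => [|N IH] c f c0 mf f0.
  by rewrite big_ord0 mul1e /=; congr f; apply/rowP => -[].
rewrite lebNS.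
have mfr : measurable_fun [set: measurableTypeR R * 'rV[R]_N]
  (fun x => f (rcons0 x.1 x.2)) := measurableT_comp mf (@measurable_rcons0 R N).
rewrite (ge0_integral_affine 0 (c0 ord0)); last 2 first.
- exact: (measurable_lebN (T := measurableTypeR R) mfr).
- by move=> t; apply: lebN_ge0.
rewrite lebNS big_ord_recl EFinM -muleA; congr (_ * _)%E.
have mg : measurable_fun [set: R] (fun t : R => lebN (fun v => f (\row_i (c i * (rcons0 t v) ord0 i)%R))).
  apply: (measurable_lebN (T := measurableTypeR R)
    (f := fun x => f (\row_i (c i * (rcons0 x.1 x.2) ord0 i)%R))) => //.
  apply: (measurableT_comp mf); apply: measurable_fun_row => i.
  under eq_fun do rewrite mxE.
  apply: measurable_funM => //.
  exact: (measurableT_comp (measurable_coord i) (@measurable_rcons0 R N)).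
rewrite -ge0_integralZl_EFin//; last 2 first.
- by move=> t _; apply: lebN_ge0.
- by apply: prodr_ge0 => i _; exact/ltW.
apply: eq_integral => t _.
rewrite (IH (c \o lift ord0))//; last 2 first.
- by move=> i; exact: c0.
- exact: (measurableT_comp mf (measurable_rcons0r _)).
congr (_ * _)%E; apply: eq_lebN => v; congr f; apply/rowP => i; rewrite [RHS]mxE addr0.
by case: (unliftP ord0 i) => [j ->|->]; rewrite !rcons0E// mxE.
Qed.

(** The first coordinate is the outermost variable, so the outer integrand is supported at the
    single point 0. *)
Lemma lebN_hyperplane (R : realType) (N : nat) (f : 'rV[R]_N.+1 -> \bar R) :
  lebN (fun v => if v ord0 ord0 == 0 then f v else 0%E) = 0%E.
Proof.
have lebN0 N' : lebN (fun _ : 'rV[R]_N' => 0%E : \bar R) = 0%E.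
  by elim: N' => // N' IH; rewrite lebNS IH integral0.
rewrite lebNS (_ : (fun t => _) = (fun t => if t == 0 then
    lebN (fun v => f (rcons0 0 v)) else 0%E)); last first.
  apply/funext => t; case: eqP => [->|/eqP t0].
    by apply: eq_lebN => v; rewrite rcons0E eqxx.
  by rewrite -[RHS](lebN0 N); apply: eq_lebN => v; rewrite rcons0E (negbTE t0).
rewrite (_ : (fun t => _) = (fun t => lebN (fun v => f (rcons0 0 v))) \_ [set 0]).
  by rewrite -integral_mkcond integral_set1.
apply/funext => t; rewrite patchE; case: ifPn => [/eqP ->|t0].
  by rewrite mem_set.
by rewrite memNset//= => /eqP; exact/negP.
Qed.

(** * Dilations of z and the partial norms *)

Definition dil (R : realType) (N m : nat) (s : R) (v : 'rV[R]_N) : 'rV[R]_N :=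
  \row_i ((if (i < m)%N then expR s else 1) * v ord0 i).

Lemma measurable_dil (R : realType) (N m : nat) :
  measurable_fun [set: measurableTypeR R * 'rV[R]_N] (fun x => dil m x.1 x.2).
Proof.
apply: measurable_fun_row => i; under eq_fun do rewrite mxE.
apply: measurable_funM; last exact: (measurableT_comp (measurable_coord i)).
case: (i < m)%N; last exact: measurable_cst.
exact: (measurableT_comp (@measurable_expR R)).
Qed.

Section normz_theory.
Variables (R : realType) (n k m : nat).
Implicit Types xi : 'rV[R]_(n + k).

Lemma xco_dil (s : R) xi (i : 'I_n) :
  xco (dil m s xi) i = (if (i < m)%N then expR s else 1) * xco xi i.
Proof. by rewrite /xco mxE. Qed.

Lemma yco_dil (s : R) xi (j : 'I_k) : (m <= n)%N ->
  yco (dil m s xi) j = yco xi j.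
Proof.
by move=> mn; rewrite /yco mxE /= ltnNge (leq_trans mn (leq_addr _ _))/= mul1r.
Qed.

Lemma normz_ge0 xi : 0 <= normz m xi. Proof. exact: sqrtr_ge0. Qed.

Lemma normz_dil (s : R) xi : normz m (dil m s xi) = expR s * normz m xi.
Proof.
rewrite /normz (eq_bigr (fun i => expR s ^+ 2 * xco xi i ^+ 2)); last first.
  by move=> i im; rewrite xco_dil im exprMn.
by rewrite -mulr_sumr sqrtrM ?sqr_ge0// sqrtr_sqr ger0_norm// expR_ge0.
Qed.

Lemma normrest_dil (s : R) xi : (m <= n)%N ->
  normrest m (dil m s xi) = normrest m xi.
Proof.
move=> mn; rewrite /normrest; congr (Num.sqrt (_ + _)); apply: eq_bigr => i.
  by move=> im; rewrite xco_dil ltnNge im/= mul1r.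
by move=> _; rewrite yco_dil.
Qed.

End normz_theory.

Section sumsq.
Variables (R : realType) (N : nat) (P : pred 'I_N).

(** [normz], [normrest] and [normx] are all square roots of such sums, so continuity and coordinate
    bounds are proved once for the three of them. *)
Definition sumsq (v : 'rV[R]_N) : R := \sum_(i | P i) v ord0 i ^+ 2.

Lemma sumsq_ge0 v : 0 <= sumsq v.
Proof. by apply: sumr_ge0 => i _; exact: sqr_ge0. Qed.

Lemma le_sqrt_sumsq i (v : 'rV[R]_N) : P i -> `|v ord0 i| <= Num.sqrt (sumsq v).
Proof.
move=> Pi; rewrite -sqrtr_sqr ler_wsqrtr// /sumsq (bigD1 i)//= lerDl.
by apply: sumr_ge0 => j _; exact: sqr_ge0.
Qed.

Lemma continuous_sumsq : continuous sumsq.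
Proof.
apply: continuous_big => [|i _ v]; first exact: add_continuous.
exact: (continuous_comp (@coord_continuous _ _ _ ord0 i v) (@exprn_continuous _ 2 _)).
Qed.

Lemma continuous_sqrt_sumsq : continuous (Num.sqrt \o sumsq).
Proof.
by move=> v; apply: continuous_comp; [exact: continuous_sumsq|exact: sqrt_continuous].
Qed.

End sumsq.

Section normz_sumsq.
Variables (R : realType) (n k m : nat).
Hypothesis mn : (m <= n)%N.
Implicit Types xi : 'rV[R]_(n + k).

Lemma normzE xi : normz m xi = Num.sqrt (sumsq (fun i => (i < m)%N) xi).
Proof.
rewrite /normz /sumsq big_split_ord /= [X in _ + X]big_pred0 ?addr0// => j.
by rewrite ltnNge (leq_trans mn (leq_addr _ _)).
Qed.

Lemma normrestE xi : normrest m xi = Num.sqrt (sumsq (fun i => (m <= i)%N) xi).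
Proof.
rewrite /normrest /sumsq big_split_ord /=; congr (Num.sqrt (_ + _)).
by apply: eq_bigl => j; rewrite (leq_trans mn (leq_addr _ _)).
Qed.

Lemma normxE xi : normx xi = Num.sqrt (sumsq (fun i => (i < n)%N) xi).
Proof.
rewrite /normx /sumsq big_split_ord /= [X in _ + X]big_pred0 ?addr0.
  by congr Num.sqrt; apply: eq_bigl => i; rewrite ltn_ord.
by move=> j; rewrite ltnNge leq_addr.
Qed.

Lemma continuous_normz : continuous (fun xi => normz m xi).
Proof. by under eq_fun do rewrite normzE; exact: continuous_sqrt_sumsq. Qed.

Lemma continuous_normrest : continuous (fun xi => normrest m xi).
Proof. by under eq_fun do rewrite normrestE; exact: continuous_sqrt_sumsq. Qed.

Lemma continuous_normx : continuous (fun xi => normx xi).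
Proof. by under eq_fun do rewrite normxE; exact: continuous_sqrt_sumsq. Qed.

Lemma measurable_normz : measurable_fun [set: 'rV[R]_(n + k)] (fun xi => normz m xi).
Proof. exact: continuous_measurable_row continuous_normz. Qed.

End normz_sumsq.

(** * Polar form of the integral along the dilations *)

Section polar.
Local Open Scope ereal_scope.
Variables (R : realType) (n k m : nat).
Hypotheses (m0 : (0 < m)%N) (mn : (m <= n)%N).

(** The interval [1, e) is chosen so that ln |z| runs over an interval of length one. *)
Definition shell : set 'rV[R]_(n + k) :=
  [set xi | (1 <= normz m xi < expR 1)%R].

Lemma measurable_shell : measurable shell.
Proof.
rewrite -[X in measurable X]setTI.
have := @measurable_normz R n k m mn measurableT _ (measurable_itv `[1%R, expR 1[).
by congr measurable; apply/seteqP; split => x /=; rewrite in_itv.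
Qed.

Let lam := @lebesgue_measure R.

Lemma dilK (s : R) : cancel (@dil R (n + k) m s) (dil m (- s)).
Proof.
move=> v; apply/rowP => i; rewrite !mxE; case: ifP => _; last by rewrite !mul1r.
by rewrite mulrA -expRD addNr expR0 mul1r.
Qed.

Lemma lebN_dil (s : R) (f : 'rV[R]_(n + k) -> \bar R) :
  measurable_fun [set: 'rV[R]_(n + k)] f -> (forall x, 0 <= f x) ->
  lebN f = lebN (fun v => f (dil m s v) * (expR (m%:R * s))%:E).
Proof.
move=> mf f0.
rewrite (@lebN_dilation _ _ (fun i => if (i < m)%N then expR s else 1%R))//; last first.
  by move=> i; case: ifP => _; rewrite ?expR_gt0.
rewrite (_ : (\prod_i _)%R = expR (m%:R * s)).
  rewrite -lebNZl ?expR_ge0//; first by apply: eq_lebN => v; rewrite muleC.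
  apply: (measurableT_comp mf).
  exact: (measurableT_comp (@measurable_dil R (n + k) m) (pair1_measurable s)).
rewrite -big_mkcond -(big_ord_widen _ (fun=> expR s)) ?prodr_const ?card_ord.
  by rewrite expRM_natl.
exact: leq_trans mn (leq_addr _ _).
Qed.

(** The dilate lies in the shell exactly for s in ]ln |z| - 1, ln |z|], an interval of length
    one. *)
Lemma integral_shell_dil (x : 'rV[R]_(n + k)) (a : \bar R) : 0 <= a ->
  normz m x != 0%R ->
  \int[lam]_s ((\1_shell (dil m (- s)%R x))%:E * a) = a.
Proof.
move=> a0 x0; have xp : (0 < normz m x)%R by rewrite lt_neqAle eq_sym x0 normz_ge0.
have E s : shell (dil m (- s)%R x) = `](ln (normz m x) - 1)%R, ln (normz m x)]%classic s.
  rewrite /shell /= normz_dil in_itv /=.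
  rewrite -{1 2}(lnK xp) -expRD -[X in (X <= _)%R]expR0 ler_expR ltr_expR.
  by apply/propext; split; lra.
have SE : (fun s => (\1_shell (dil m (- s)%R x))%:E) =
    (fun s => (\1_`](ln (normz m x) - 1)%R, ln (normz m x)]%classic s)%:E : \bar R).
  apply/funext => s; rewrite !indicE; congr ((nat_of_bool _)%:R%:E).
  by apply/idP/idP; rewrite !inE E.
have mS : measurable_fun [set: measurableTypeR R] (fun s => (\1_shell (dil m (- s)%R x))%:E : \bar R).
  by rewrite SE; apply/measurable_EFinP; exact: measurable_indic.
rewrite ge0_integralZr//.
rewrite SE integral_indic// setIT [X in X * _](_ : _ = 1) ?mul1e//.
rewrite [LHS]lebesgue_measure_itv/= lte_fin gtrBl ltr01.
by rewrite -EFinB; congr EFin; ring.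
Qed.

Lemma measurable_normz0 : measurable [set x : 'rV[R]_(n + k) | normz m x = 0%R].
Proof.
rewrite -[X in measurable X]setTI.
exact: (@measurable_normz R n k m mn measurableT _ (measurable_set1 0%R)).
Qed.

(** Since m >= 1, z = 0 forces the first coordinate to vanish, and the hyperplane where it does is
    null. *)
Lemma lebN_normz0 (f : 'rV[R]_(n + k) -> \bar R) :
  measurable_fun [set: 'rV[R]_(n + k)] f -> (forall x, 0 <= f x) ->
  lebN (fun x => (\1_[set x | normz m x = 0%R] x)%:E * f x) = 0.
Proof.
move=> mf f0; have mZ := measurable_normz0.
case: n mn f mf f0 mZ => [|n'] mn' f mf f0 mZ; first by case: m m0 mn'.
apply/eqP; rewrite eq_le lebN_ge0 ?andbT; last by move=> x; rewrite mule_ge0// lee_fin.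
rewrite -(lebN_hyperplane f); apply: le_lebN.
- by apply: emeasurable_funM => //; apply/measurable_EFinP; exact: measurable_indic.
- apply: measurable_fun_ifT => //.
  apply: measurable_fun_eqr; first exact: measurable_coord.
  exact: measurable_cst.
- by move=> x; rewrite mule_ge0// lee_fin.
move=> x; rewrite indicE; have [x0|x0] := eqVneq (normz m x) 0%R; last first.
  by rewrite memNset ?mul0e; [case: ifP => // _; exact: f0|exact/eqP].
rewrite mem_set// mul1e; suff -> : x ord0 ord0 = 0%R by rewrite eqxx.
apply/eqP; rewrite -normr_le0 -x0 normzE//.
exact: (@le_sqrt_sumsq _ _ (fun i => (i < m)%N)).
Qed.

Lemma measurable_polar (f : 'rV[R]_(n + k) -> \bar R) :
  measurable_fun [set: 'rV[R]_(n + k)] f ->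
  measurable_fun [set: measurableTypeR R * 'rV[R]_(n + k)]
    (fun x => (\1_shell x.2)%:E * (f (dil m x.1 x.2) * (expR (m%:R * x.1))%:E)).
Proof.
move=> mf; apply: emeasurable_funM.
  apply/measurable_EFinP.
  have h : measurable_fun setT (\1_shell : 'rV[R]_(n + k) -> R).
    exact: (measurable_indic measurable_shell).
  exact: (measurableT_comp h measurable_snd).
apply: emeasurable_funM; first exact: (measurableT_comp mf (@measurable_dil R (n + k) m)).
apply/measurable_EFinP; apply: (measurableT_comp (@measurable_expR R)).
exact: measurable_funM.
Qed.

(** Off z = 0, f is the integral over s of f times the indicator of [shell] at [dil m (- s) x].
    Interchanging the integrals and substituting [dil m s x] for x moves the indicator back to x and
    produces the Jacobian. *)
Lemma lebN_polar (f : 'rV[R]_(n + k) -> \bar R) :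
  measurable_fun [set: 'rV[R]_(n + k)] f -> (forall x, 0 <= f x) ->
  lebN f = lebN (fun x => \int[lam]_s
    ((\1_shell x)%:E * (f (dil m s x) * (expR (m%:R * s))%:E))).
Proof.
move=> mf f0.
rewrite -(lebN_integral_swap (measurable_polar mf)); last first.
  by move=> [s x] /=; rewrite !mule_ge0// lee_fin expR_ge0.
pose g (z : measurableTypeR R * 'rV[R]_(n + k)) := (\1_shell (dil m (- z.1)%R z.2))%:E * f z.2.
have mg : measurable_fun setT g.
  apply: emeasurable_funM; last exact: (measurableT_comp mf).
  apply/measurable_EFinP; apply: (measurableT_comp (measurable_indic measurable_shell)).
  apply: (measurableT_comp (@measurable_dil R (n + k) m)
    (g := fun z : measurableTypeR R * 'rV[R]_(n + k) => ((- z.1)%R : measurableTypeR R, z.2))).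
  by apply/measurable_fun_pair => //; exact: measurableT_comp.
have g0 z : 0 <= g z by rewrite mule_ge0// lee_fin.
transitivity (\int[lam]_t lebN (fun v => g (t, v))); last first.
  apply: eq_integral => s _; rewrite (lebN_dil s)//; last first.
    exact: (measurableT_comp mg (pair1_measurable _)).
  by apply: eq_lebN => x; rewrite /g/= dilK muleA.
rewrite lebN_integral_swap//.
(* On z = 0 no dilate meets the shell and the average over s is 0, not f; this null set is split
   off. *)
rewrite [in LHS](_ : f = fun x => (\1_[set x | normz m x = 0%R] x)%:E * f x + 
   (\1_(~` [set x | normz m x = 0%R]) x)%:E * f x); last first.
  apply/funext => x; rewrite !indicE in_setC.
  by case: (_ \in _); rewrite !mul0e ?mul1e ?adde0 ?add0e.
have mZ : measurable [set x : 'rV[R]_(n + k) | normz m x = 0%R].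
  rewrite -[X in measurable X]setTI.
  exact: (@measurable_normz R n k m mn measurableT _ (measurable_set1 0%R)).
rewrite lebND; last 4 first.
- by apply: emeasurable_funM => //; apply/measurable_EFinP; exact: measurable_indic.
- apply: emeasurable_funM => //; apply/measurable_EFinP; apply: measurable_indic.
  exact: measurableC.
- by move=> x; rewrite mule_ge0// lee_fin.
- by move=> x; rewrite mule_ge0// lee_fin.
rewrite lebN_normz0// add0e; apply: eq_lebN => x.
rewrite indicE in_setC; have [x0|x0] := eqVneq (normz m x) 0%R.
  rewrite mem_set//= mul0e; apply/esym/integral0_eq => s _.
  rewrite /g /= indicE memNset ?mul0e//= /shell /= normz_dil x0 mulr0 => /andP[].
  by rewrite ler10.
by rewrite memNset ?mul1e /g /= ?integral_shell_dil//; exact/eqP.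
Qed.
End polar.

(** * One-dimensional weighted Hardy inequalities *)

Section absr_powR.
Variable R : realType.
Implicit Types p x : R.

Lemma continuous_absr_powR p : 0 < p -> continuous (fun x => `|x| `^ p).
Proof.
move=> p0 x; have [->|x0] := eqVneq x 0.
  rewrite /continuous_at normr0 powR0 ?gt_eqF//; apply/cvgr0Pnorm_lt => e e0.
  have d0 : 0 < e `^ p^-1 by rewrite powR_gt0.
  near=> y.
  have yd : `|y| < e `^ p^-1 by near: y; exact: dnbhs0_lt || apply: (@cvgr0_norm_lt _ R _ (nbhs (0:R)) _ id).
  rewrite ger0_norm ?powR_ge0// -[ltRHS](powRr1 (ltW e0)).
  rewrite -(mulVf (lt0r_neq0 p0)) powRrM.
  by apply: gt0_ltr_powR; rewrite ?nnegrE ?powR_ge0.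
have px : 0 < `|x| by rewrite normr_gt0.
have cn : {for x, continuous (fun y : R => `|y|)} by exact: norm_continuous.
have cp : {for `|x|, continuous (fun y : R => y `^ p)}.
  apply: differentiable_continuous; apply/derivable1_diffP.
  by apply: derivable_powR; rewrite in_itv /= px.
exact: (continuous_comp cn cp).
Unshelve. all: end_near. Qed.

(** The derivative p |x|^(p-2) x, written with a sign so that the exponent stays positive for every
    p > 1. *)
Definition dabsp p x := p * (Num.sg x * `|x| `^ (p - 1)).

Lemma is_derive_absr_powR p x : 1 < p ->
  is_derive x 1 (fun x => `|x| `^ p) (dabsp p x).
Proof.
move=> p1; have p10 : 0 < p - 1 by rewrite subr_gt0.
have [x0|x0|->] := ltgtP x 0.
- have nx : 0 < - x by rewrite oppr_gt0.
  have H : is_derive x 1 ((@powR R ^~ p) \o (-%R : R -> R)) (dabsp p x).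
    apply: (is_derive_eq (is_derive1_comp (is_derive1_powR p nx) (is_deriveNid _ _))).
    by rewrite /dabsp ltr0_sg// ltr0_norm//; ring.
  apply: near_eq_is_derive H.
  by near=> y; rewrite /= ltr0_norm//; near: y; exact: lt_nbhsl.
- have H : is_derive x 1 (@powR R ^~ p) (dabsp p x).
    apply: (is_derive_eq (is_derive1_powR p x0)).
    by rewrite /dabsp gtr0_sg// gtr0_norm//= mul1r.
  apply: near_eq_is_derive H.
  by near=> y; rewrite /= gtr0_norm//; near: y; exact: lt_nbhsr.
- rewrite /dabsp sgr0 mul0r mulr0.
  (* At 0 the difference quotient has absolute value |h|^(p-1), which tends to 0 because p > 1. *)
  have h0 : (fun h : R => h^-1 *: (`|h *: (1 : R^o) + (0 : R^o)| `^ p - `|0 : R| `^ p : R^o)) @ 0^' --> (0 : R).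
    rewrite normr0 powR0 ?gt_eqF ?(lt_trans ltr01)//.
    have := @continuous_absr_powR (p - 1) p10 0.
    rewrite /continuous_at normr0 powR0 ?gt_eqF// => /cvgr0Pnorm_lt c0.
    apply/cvgr0Pnorm_lt => e e0; near=> h.
    have hn : h != 0 by near: h; exact: nbhs_dnbhs_neq.
    have : `|(`|h| `^ (p - 1))| < e by near: h; apply: nbhs_dnbhs; exact: c0.
    rewrite ger0_norm ?powR_ge0//; apply: le_lt_trans.
    rewrite addr0 subr0 /GRing.scale /= mulr1 normrM normfV.
    rewrite (ger0_norm (powR_ge0 _ _)) -(mulr_powRB1 (normr_ge0 h)) ?(lt_trans ltr01)//.
    by rewrite mulKf ?normr_eq0.
  by apply: DeriveDef; [exact: cvgP h0|exact: cvg_lim h0].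
Unshelve. all: end_near. Qed.

Lemma continuous_dabsp p : 1 < p -> continuous (dabsp p).
Proof.
move=> p1; have p10 : 0 < p - 1 by rewrite subr_gt0.
(* Separating positive and negative parts removes the jump of [Num.sg]: each summand is continuous
   because p - 1 > 0. *)
have -> : dabsp p = fun x => p * (`|Num.max x 0| `^ (p - 1) - `|Num.max (- x) 0| `^ (p - 1)).
  apply/funext => x; rewrite /dabsp; congr (_ * _).
  have [x0|x0|->] := ltgtP x 0.
  - have nx : 0 <= - x by rewrite oppr_ge0 ltW.
    rewrite ltr0_sg// (max_l nx) normr0 powR0 ?gt_eqF//.
    by rewrite normrN; ring.
  - have nx : - x <= 0 by rewrite oppr_le0 ltW.
    rewrite gtr0_sg// (max_r nx) normr0 powR0 ?gt_eqF//.
    by ring.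
  - by rewrite oppr0 ?maxxx subrr sgr0 mul0r.
have cmax (f : R -> R) : continuous f -> continuous (fun x => `|Num.max (f x) 0| `^ (p - 1)).
  move=> cf x.
  have cm : {for x, continuous (f \max (fun=> 0))}.
    by apply: continuous_max; [exact: cf|exact: cvg_cst].
  exact: (continuous_comp cm (@continuous_absr_powR _ p10 _)).
move=> x; apply: cvgM; first exact: cvg_cst.
by apply: cvgB; apply: cmax => // y; [exact: cvg_id|exact: (cvgN cvg_id)].
Qed.

Lemma young_powR p x y : 1 < p -> 0 <= x -> 0 <= y ->
  p * (x `^ (p - 1) * y) <= (p - 1) * x `^ p + y `^ p.
Proof.
move=> p1 x0 y0; have p10 : 0 < p - 1 by rewrite subr_gt0.
have p0 : 0 < p by exact: lt_trans p1.
have q0 : 0 < p / (p - 1) by rewrite divr_gt0.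
have pq : (p / (p - 1))^-1 + p^-1 = 1.
  by rewrite invf_div; field; rewrite !gt_eqF.
have := conjugate_powR (powR_ge0 x (p - 1)) y0 q0 p0 pq.
rewrite -powRrM (_ : (p - 1) * (p / (p - 1)) = p); last by field; rewrite gt_eqF.
move=> h; have := ler_wpM2l (ltW p0) h.
rewrite (_ : p * (_ + _) = (p - 1) * x `^ p + y `^ p)//.
by field; rewrite !gt_eqF.
Qed.

(** The scale [lam] is the parameter that is optimised in the Hardy inequality. *)
Lemma young_powR_scaled p lam x y : 1 < p -> 0 < lam -> 0 <= x -> 0 <= y ->
  lam `^ (p - 1) * (p * (x `^ (p - 1) * y)) <= (p - 1) * (lam `^ p * x `^ p) + y `^ p.
Proof.
move=> p1 l0 x0 y0.
have := @young_powR p (lam * x) y p1 (mulr_ge0 (ltW l0) x0) y0.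
rewrite !(powRM _ (ltW l0) x0) => h.
by rewrite (_ : _ * (p * _) = p * (lam `^ (p - 1) * x `^ (p - 1) * y))//; ring.
Qed.

End absr_powR.

Section hardy_segment.
Variable R : realType.
Let mu := @lebesgue_measure R.

Lemma continuous_integrable_itv (f : R -> R) (a b : R) :
  {in `[a, b], continuous f} ->
  {within `[a, b], continuous f} /\ mu.-integrable `[a, b] (EFin \o f).
Proof.
move=> cf; have cw : {within `[a, b], continuous f}.
  by apply: continuous_in_subspaceT => x; rewrite inE; exact: cf.
by split => //; apply: continuous_compact_integrable => //; exact: segment_compact.
Qed.

Lemma integral_derivative_itv (f F : R -> R) (a b : R) : a < b ->
  {in `[a, b], continuous f} -> {in `[a, b], forall x : R, is_derive x 1 F (f x)} ->
  (\int[mu]_(x in `[a, b]) (f x)%:E = (F b - F a)%:E)%E.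
Proof.
move=> ab cf dF; rewrite EFinB; apply: continuous_FTC2 => //.
- exact: (continuous_integrable_itv cf).1.
- have cF x : x \in `[a, b] -> {for x, continuous F}.
    move=> /dF h; apply: differentiable_continuous; apply/derivable1_diffP.
    exact: ex_derive.
  split.
  + by move=> x /subset_itv_oo_cc /dF h; exact: ex_derive.
  + by apply: cvg_at_right_filter; apply: cF; rewrite in_itv /= lexx ltW.
  + by apply: cvg_at_left_filter; apply: cF; rewrite in_itv /= lexx ltW.
- move=> x /subset_itv_oo_cc /dF h; rewrite derive1E; exact: derive_val.
Qed.

(* [W = w * th] is the primitive weight: multiplying it by [|g|^p] turns the
   left-hand side into a total derivative up to Young's inequality. *)
Lemma hardy_segment (p kappa sg s0 s1 : R) (g dg w th : R -> R) :
  1 < p -> 0 < kappa -> `|sg| = 1 -> s0 < s1 ->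
  {in `[s0, s1], forall s : R, is_derive s 1 g (dg s)} ->
  {in `[s0, s1], continuous dg} ->
  {in `[s0, s1], continuous w} -> {in `[s0, s1], continuous th} ->
  {in `[s0, s1], forall s, 0 <= w s} -> {in `[s0, s1], forall s, 0 <= th s} ->
  {in `[s0, s1], forall s : R,
    is_derive s 1 (fun s => w s * th s) (sg * kappa * w s)} ->
  sg * (`|g s1| `^ p * (w s1 * th s1) - `|g s0| `^ p * (w s0 * th s0)) <= 0 ->
  (((kappa / p) `^ p)%:E * \int[mu]_(s in `[s0, s1]) (`|g s| `^ p * w s)%:E <=
   \int[mu]_(s in `[s0, s1]) (`|dg s * th s| `^ p * w s)%:E)%E.
Proof.
move=> p1 k0 sg1 s01 dgE cdg cw cth w0 th0 dW bd.
have p0 : 0 < p := lt_trans ltr01 p1.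
(* This value maximises lam^(p-1) kappa - (p-1) lam^p; the maximum is lam^p = (kappa / p)^p. *)
set lam := kappa / p; have lam0 : 0 < lam by rewrite divr_gt0.
have sgsg : sg * sg = 1 by rewrite -expr2 -[LHS]ger0_norm ?sqr_ge0// normrX sg1 expr1n.
have cg x : x \in `[s0, s1] -> {for x, continuous g}.
  move=> /dgE h; apply: differentiable_continuous; apply/derivable1_diffP.
  exact: ex_derive.
pose D s := lam `^ (p - 1) * (sg * (dabsp p (g s) * dg s * (w s * th s)
              + `|g s| `^ p * (sg * kappa * w s))).
pose F s := lam `^ (p - 1) * (sg * (`|g s| `^ p * (w s * th s))).
have cgp : {in `[s0, s1], continuous (fun s => `|g s| `^ p)}.
  by move=> x xs; exact: (continuous_comp (cg x xs) (@continuous_absr_powR R p p0 (g x))).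
have cA : {in `[s0, s1], continuous (fun s => `|g s| `^ p * w s)}.
  by move=> x xs; apply: cvgM; [exact: cgp|exact: cw].
have cB : {in `[s0, s1], continuous (fun s => `|dg s * th s| `^ p * w s)}.
  move=> x xs; apply: cvgM; last exact: cw.
  have cdt : {for x, continuous (fun s => dg s * th s)}.
    by apply: cvgM; [exact: cdg|exact: cth].
  exact: (continuous_comp cdt (@continuous_absr_powR R p p0 _)).
have cD : {in `[s0, s1], continuous D}.
  move=> x xs; apply: cvgM; first exact: cvg_cst.
  apply: cvgM; first exact: cvg_cst.
  apply: cvgD; apply: cvgM.
  - apply: cvgM; last exact: cdg.
    exact: (continuous_comp (cg x xs) (@continuous_dabsp R p p1 (g x))).
  - by apply: cvgM; [exact: cw|exact: cth].
  - exact: cgp.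
  - by apply: cvgM; [exact: cvg_cst|exact: cw].
have dF : {in `[s0, s1], forall s : R, is_derive s 1 F (D s)}.
  move=> s ss; have h1 := is_derive1_comp (is_derive_absr_powR (g s) p1) (dgE s ss).
  have h2 := is_deriveM h1 (dW s ss).
  have h3 := is_deriveZ (lam `^ (p - 1) * sg) h2.
  have -> : F = (lam `^ (p - 1) * sg) \*: (((fun x => `|x| `^ p) \o g) * (fun s => w s * th s)).
    by apply/funext => t; rewrite /F /GRing.scale /= mulrA.
  apply: is_derive_eq h3 _.
  by rewrite /D /GRing.scale /= /GRing.scale /=; ring.
have iD := integral_derivative_itv s01 cD dF.
have [_ iA] := continuous_integrable_itv cA.
have [_ iB] := continuous_integrable_itv cB.
have [_ iDi] := continuous_integrable_itv cD.
rewrite -integralZl//.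
(* Pointwise, lam^p |g|^p w is at most the right-hand integrand plus D = F': the term p lam^p |g|^p
   w contained in D pays for the (p-1) lam^p |g|^p w lost in Young's inequality. The integral of D
   is the boundary term, which is <= 0. *)
have le1 : (\int[mu]_(s in `[s0, s1]) ((lam `^ p)%:E * (`|g s| `^ p * w s)%:E) <=
    \int[mu]_(s in `[s0, s1]) ((`|dg s * th s| `^ p * w s)%:E + (D s)%:E))%E.
  apply: le_integral => //; first exact: integrableZl.
    exact: integrableD.
  move=> s; rewrite inE => ss; rewrite -EFinM -EFinD lee_fin /D.
  have ws := w0 s ss; have ths := th0 s ss.
  have Y := young_powR_scaled p1 lam0 (normr_ge0 (g s)) (normr_ge0 (dg s * th s)).
  have L : lam `^ (p - 1) * kappa = p * lam `^ p.
    by rewrite -(mulr_powRB1 (ltW lam0) p0) /lam; field; rewrite gt_eqF.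
  set T := sg * (Num.sg (g s) * `|g s| `^ (p - 1) * (dg s * th s)).
  have Z : - (`|g s| `^ (p - 1) * `|dg s * th s|) <= T.
    rewrite lerNl; apply: (le_trans (ler_norm _)); rewrite normrN /T.
    rewrite normrM sg1 mul1r normrM; apply: ler_wpM2r => //.
    rewrite normrM (ger0_norm (powR_ge0 _ _)) ler_piMl ?powR_ge0//.
    by rewrite normr_sg; case: eqP.
  have Z' := ler_wpM2l (mulr_ge0 (powR_ge0 lam (p - 1)) (ltW p0)) Z.
  have key : 0 <= `|dg s * th s| `^ p + lam `^ (p - 1) * p * T
      + (p - 1) * (lam `^ p * `|g s| `^ p).
    move: Y Z'; set A := lam `^ (p - 1); set B := _ `^ (p - 1); set C := `|_ * _|.
    by move=> Y Z'; lra.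
  have := mulr_ge0 ws key; rewrite -subr_ge0 /T /dabsp; move: L.
  set A := lam `^ (p - 1); set B := lam `^ p; set C := _ `^ (p - 1).
  set G := `|g s| `^ p; set Y' := _ `^ p => L h.
  (* Multiples of sg sg - 1 and A kappa - p B, both zero, are inserted so that the identity holds by
     [ring]. *)
  rewrite [leRHS](_ : _ = w s * (Y' + A * p * (sg * (Num.sg (g s) * C * (dg s * th s)))
     + (p - 1) * (B * G)) + (sg * sg - 1) * (A * G * kappa * w s)
     + (A * kappa - p * B) * (G * w s)); last by ring.
  by rewrite sgsg L !subrr !mul0r !addr0.
apply: (le_trans le1).
rewrite integralD// iD geeDl// lee_fin /F -mulrBr -mulrBr.
by rewrite mulr_ge0_le0// powR_ge0.
Qed.

End hardy_segment.

(** * Passage from segments to half-lines *)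

Section hardy_ray.
Variable R : realType.
Let mu := @lebesgue_measure R.

(** The segments [s1 - j, s1] exhaust the half-line to which [A] is confined, and the limit only
    sees large j; hence the comparison is asked only for s0 below [s2]. *)
Lemma le_integral_half_line (A B : R -> \bar R) (s1 s2 : R) :
  measurable_fun [set: R] A -> measurable_fun [set: R] B ->
  (forall s, 0 <= A s)%E -> (forall s, 0 <= B s)%E ->
  (forall s, s1 < s -> A s = 0%E) ->
  (forall s0, (s0 < s2)%R ->
    \int[mu]_(s in `[s0, s1]) A s <= \int[mu]_(s in `[s0, s1]) B s)%E ->
  (\int[mu]_s A s <= \int[mu]_s B s)%E.
Proof.
move=> mA mB A0 B0 A1 AB.
pose I (j : nat) := `[s1 - j%:R, s1]%classic.
have -> : (\int[mu]_s A s = \int[mu]_(s in \bigcup_j I j) A s)%E.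
  rewrite [RHS]integral_mkcond; apply: eq_integral => s _; rewrite patchE.
  case: ifPn => //; rewrite notin_setE /= => h; apply: A1; rewrite ltNge.
  apply/negP => ss1; apply: h.
  have /archi_boundP : 0 <= s1 - s by rewrite subr_ge0.
  set j := Num.bound _ => hj; exists j => //; rewrite /I /= in_itv /= ss1 andbT.
  by rewrite lerBlDr -lerBlDl ltW.
have cA : (\int[mu]_(s in I j) A s @[j --> \oo] --> \int[mu]_(s in \bigcup_j I j) A s)%E.
  apply: ge0_nondecreasing_set_cvg_integral => //.
  - move=> i j ij; apply/subsetPset; apply: subset_itvr; rewrite bnd_simp.
    by rewrite lerB// ler_nat.
  - by move=> j; exact: measurable_itv.
  - by move=> j; exact: measurable_funTS.
apply: cvge_le cA; near=> j.
apply: (@le_trans _ _ (\int[mu]_(s in I j) B s)%E).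
  apply: AB; rewrite ltrBlDl -ltrBlDr.
  by near: j; exact: nbhs_infty_gtr.
by apply: ge0_subset_integral => //; exact: measurable_itv.
Unshelve. all: end_near. Qed.

(** The sign of the boundary term is asked only for s0 < s2, since for a weight that blows up at -oo
    it comes from the vanishing of g there. *)
Lemma hardy_half_line (p kappa sg s1 s2 : R) (g dg w th : R -> R) :
  1 < p -> 0 < kappa -> `|sg| = 1 ->
  (forall s : R, is_derive s 1 g (dg s)) -> continuous dg ->
  measurable_fun [set: R] w -> measurable_fun [set: R] th ->
  (forall s, 0 <= w s) ->
  (forall s, s <= s1 -> 0 <= th s) ->
  (forall s, s <= s1 -> {for s, continuous w}) ->
  (forall s, s <= s1 -> {for s, continuous th}) ->
  (forall s : R, s <= s1 ->
    is_derive s 1 (fun s => w s * th s) (sg * kappa * w s)) ->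
  (forall s, s1 < s -> g s = 0) ->
  (forall s0, s0 < s2 ->
    sg * (`|g s1| `^ p * (w s1 * th s1) - `|g s0| `^ p * (w s0 * th s0)) <= 0) ->
  (((kappa / p) `^ p)%:E * \int[mu]_s (`|g s| `^ p * w s)%:E <=
   \int[mu]_s (`|dg s * th s| `^ p * w s)%:E)%E.
Proof.
move=> p1 k0 sg1 dgE cdg mw mth w0 th0 cw cth dW g0 bd.
have p0 : 0 < p := lt_trans ltr01 p1.
have mgp : measurable_fun [set: R] (fun s => `|g s| `^ p).
  apply: (measurableT_comp (measurable_powR p)); apply: measurableT_comp => //.
  apply: continuous_measurable_fun => s; apply: differentiable_continuous.
  by apply/derivable1_diffP; apply: ex_derive.
have mA : measurable_fun [set: R] (fun s => (`|g s| `^ p * w s)%:E).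
  by apply/measurable_EFinP; exact: measurable_funM.
have mB : measurable_fun [set: R] (fun s => (`|dg s * th s| `^ p * w s)%:E).
  apply/measurable_EFinP; apply: measurable_funM => //.
  apply: (measurableT_comp (measurable_powR p)); apply: measurableT_comp => //.
  by apply: measurable_funM => //; exact: continuous_measurable_fun.
have A0 s : (0 <= (`|g s| `^ p * w s)%:E)%E by rewrite lee_fin mulr_ge0 ?powR_ge0.
rewrite -ge0_integralZl_EFin ?powR_ge0//.
(* Cutting at the smaller of [s2] and [s1] also guarantees s0 < s1. *)
apply: (@le_integral_half_line _ _ s1 (Num.min s2 s1)) => //.
- exact: measurable_funeM.
- by move=> s; rewrite mule_ge0// lee_fin powR_ge0.
- by move=> s; rewrite lee_fin mulr_ge0 ?powR_ge0.
- by move=> s s1s; rewrite g0// normr0 powR0 ?mul0r ?mule0// gt_eqF.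
move=> s0; rewrite lt_min => /andP[s02 s01].
rewrite ge0_integralZl_EFin ?powR_ge0//; last exact: measurable_funTS.
apply: (hardy_segment p1 k0 sg1 s01) => //; last exact: bd.
all: move=> s; rewrite ?in_itv => /andP[_ /= ss1] //.
- exact: cw.
- exact: cth.
- exact: th0.
- exact: dW.
Qed.

End hardy_ray.

Section hardy_rays.
Variable R : realType.
Let mu := @lebesgue_measure R.

(** Here th = 1 and W = w = e^(b s), with W' = b w. The boundary term at s1 vanishes. For b > 0 the
    left one enters with a minus sign; for b < 0 it has the wrong sign and is removed by the
    vanishing of g near -oo; for b = 0 the constant is 0. *)
Lemma hardy_exp (p b : R) (g dg : R -> R) (s1 : R) : 1 < p ->
  (forall s : R, is_derive s 1 g (dg s)) -> continuous dg ->
  (forall s, s1 <= s -> g s = 0) ->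
  (b < 0 -> exists s2, forall s, s <= s2 -> g s = 0) ->
  (((`|b| / p) `^ p)%:E * \int[mu]_s (`|g s| `^ p * expR (b * s))%:E <=
   \int[mu]_s (`|dg s| `^ p * expR (b * s))%:E)%E.
Proof.
move=> p1 dgE cdg g1 g2; have p0 : 0 < p := lt_trans ltr01 p1.
have cw : continuous (fun s => expR (b * s)).
  move=> s; apply: continuous_comp; last exact: continuous_expR.
  by apply: cvgM; [exact: cvg_cst|exact: cvg_id].
have main (s2 sg : R) : `|sg| = 1 -> b != 0 -> b = sg * `|b| ->
    (forall s0, s0 < s2 -> sg * (`|g s1| `^ p * (expR (b * s1) * 1)
                - `|g s0| `^ p * (expR (b * s0) * 1)) <= 0) ->
  (((`|b| / p) `^ p)%:E * \int[mu]_s (`|g s| `^ p * expR (b * s))%:E <=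
   \int[mu]_s (`|dg s| `^ p * expR (b * s))%:E)%E.
  move=> sg1 b0 bE bd.
  have := @hardy_half_line R p `|b| sg s1 s2 g dg (fun s => expR (b * s)) (fun=> 1) p1.
  have -> : (\int[mu]_s (`|dg s| `^ p * expR (b * s))%:E =
      \int[mu]_s (`|dg s * 1| `^ p * expR (b * s))%:E)%E.
    by apply: eq_integral => s _; rewrite mulr1.
  apply => //.
  - by rewrite normr_gt0.
  - exact: continuous_measurable_fun.
  - by move=> s _; exact: cw.
  - by move=> s _; exact: cvg_cst.
  - move=> s _; under eq_fun do rewrite mulr1.
    have h1 := is_deriveZ b (is_derive_id s (1:R)).
    have h2 := is_derive1_comp (is_derive_expR (b * s)) h1.
    by apply: is_derive_eq h2 _; rewrite -bE /GRing.scale /= mulr1 mulrC.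
  - by move=> s /ltW; exact: g1.
have [b0|b0|b0] := ltgtP b 0.
- have [s2 g2'] := g2 b0.
  apply: (main s2 (-1)).
  + by rewrite normrN1.
  + by rewrite lt_eqF.
  + by rewrite ltr0_norm// mulN1r opprK.
  + move=> s0 s02; rewrite (g1 s1)// (g2' s0 (ltW s02)) normr0 powR0 ?gt_eqF// !mul0r subrr mulr0.
- apply: (main 0 1).
  + by rewrite normr1.
  + by rewrite gt_eqF.
  + by rewrite gtr0_norm// mul1r.
  + move=> s0 _; rewrite (g1 s1)// normr0 powR0 ?gt_eqF// mul0r sub0r mul1r oppr_le0 !mulr_ge0 ?powR_ge0 ?expR_ge0.
- rewrite b0 normr0 mul0r powR0 ?gt_eqF// mul0e.
  by apply: integral_ge0 => s _; rewrite lee_fin mulr_ge0 ?powR_ge0 ?expR_ge0.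
Qed.

Lemma is_derive_zero_right (g : R -> R) (dg s1 s : R) :
  is_derive s 1 g dg -> (forall s, s1 <= s -> g s = 0) -> s1 < s -> dg = 0.
Proof.
move=> h g0 s1s.
have h0 : is_derive s 1 g 0.
  apply: (near_eq_is_derive _ (is_derive_cst (0 : R) s 1)).
  by near=> t; rewrite g0// ltW//; near: t; exact: lt_nbhsr.
by rewrite -(@derive_val _ _ _ _ _ _ _ h) (@derive_val _ _ _ _ _ _ _ h0).
Unshelve. all: end_near. Qed.

(** Here th = S - s and W = (S - s)^(beta + 1), so W' = -(beta + 1) w = |beta + 1| w: beta < -1
    fixes the sign. The support of g stops at s1 < S, before the weight becomes singular. *)
Lemma hardy_log (p beta S : R) (g dg : R -> R) (s1 : R) : 1 < p -> beta < -1 ->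
  (forall s : R, is_derive s 1 g (dg s)) -> continuous dg -> s1 < S ->
  (forall s, s1 <= s -> g s = 0) ->
  (((`|beta + 1| / p) `^ p)%:E * \int[mu]_s (`|g s| `^ p * (S - s) `^ beta)%:E <=
   \int[mu]_s (`|dg s| `^ p * (S - s) `^ (p + beta))%:E)%E.
Proof.
move=> p1 b1 dgE cdg s1S g1; have p0 : 0 < p := lt_trans ltr01 p1.
have b10 : beta + 1 < 0 by rewrite -(ltrBrDr) sub0r.
have mth : measurable_fun [set: R] (fun s => S - s).
  apply: continuous_measurable_fun => s.
  by apply: cvgB; [exact: cvg_cst|exact: cvg_id].
have := @hardy_half_line R p `|beta + 1| 1 s1 s1 g dg (fun s => (S - s) `^ beta) (fun s => S - s) p1.
have -> : (\int[mu]_s (`|dg s| `^ p * (S - s) `^ (p + beta))%:E =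
  \int[mu]_s (`|dg s * (S - s)| `^ p * (S - s) `^ beta)%:E)%E.
  (* Past [s1] both integrands vanish with the derivative; before it S - s > 0 and the powers
     combine. *)
  apply: eq_integral => s _; have [ss1|ss1] := leP s s1; last first.
    by rewrite (is_derive_zero_right (dgE s) g1 ss1) mul0r normr0 powR0 ?mul0r// gt_eqF.
  have Ss : 0 < S - s by rewrite subr_gt0 (le_lt_trans ss1).
  rewrite normrM powRM// (gtr0_norm Ss) -mulrA -powRD//.
  by rewrite (gt_eqF Ss) implybT.
have Sp s : s <= s1 -> 0 < S - s by move=> ss1; rewrite subr_gt0 (le_lt_trans ss1).
have dth (s : R) : is_derive s 1 (fun s : R => S - s) (-1).
  have := is_deriveB (is_derive_cst S s 1) (is_derive_id s (1:R)).
  by rewrite sub0r.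
have dw s : s <= s1 -> is_derive s 1 (fun s => (S - s) `^ beta)
    (- (beta * (S - s) `^ (beta - 1))).
  move=> /Sp Ss; have h := @is_derive1_comp R (@powR R ^~ beta) (fun s => S - s) s _ _
    (is_derive1_powR beta Ss) (dth s).
  by apply: is_derive_eq h _; rewrite mulrN1.
have cdw (s df : R) (f : R -> R) : is_derive s 1 f df -> {for s, continuous f}.
  move=> h; apply: differentiable_continuous; apply/derivable1_diffP.
  exact: ex_derive.
apply => //.
- by rewrite normr_gt0 lt_eqF.
- by rewrite normr1.
- exact: (measurableT_comp (measurable_powR beta)).
- by move=> s; rewrite powR_ge0.
- by move=> s /Sp /ltW.
- by move=> s /dw /cdw.
- by move=> s _; exact: cdw (dth s).
- move=> s ss1; apply: (is_derive_eq (is_deriveM (dw s ss1) (dth s))).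
  have Ss := Sp s ss1; rewrite /GRing.scale /= mul1r ltr0_norm//.
  have -> : (S - s) `^ beta = (S - s) * (S - s) `^ (beta - 1).
    rewrite -[X in X * _](powRr1 (ltW Ss)) -powRD ?(gt_eqF Ss) ?implybT//.
    by congr (_ `^ _); ring.
  by ring.
- by move=> s /ltW; exact: g1.
- move=> s0 s01; rewrite (g1 s1)// normr0 powR0 ?gt_eqF// mul0r sub0r mul1r.
  by rewrite oppr_le0 !mulr_ge0 ?powR_ge0// ltW// Sp// ltW.
Qed.

End hardy_rays.

(** * The inequalities along the dilation orbits *)

Section gradient.
Variables (R : realType) (N : nat).
Implicit Types u : 'rV[R]_N -> R.

Lemma is_derive_along u (c : R -> 'rV[R]_N) (dc : 'rV[R]_N) (s : R) :
  differentiable u (c s) ->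
  (forall i, is_derive s (1 : R) (fun t => c t ord0 i) (dc ord0 i)) ->
  is_derive s (1 : R) (u \o c) (\sum_i dc ord0 i * pderiv u i (c s)).
Proof.
move=> du dcE.
have cd : derivable c s 1.
  by apply/derivable_mxP => i j; rewrite (ord1 i); exact: ex_derive.
have cdiff : differentiable c s by apply/derivable1_diffP.
have dcv : 'd c s (1 : R) = dc.
  rewrite -deriveE// derive_mx//; apply/rowP => j; rewrite mxE.
  exact: derive_val.
apply: DeriveDef.
  by apply/derivable1_diffP; exact: differentiable_comp.
rewrite deriveE; last exact: differentiable_comp.
rewrite diff_comp//= dcv [in LHS](row_sum_delta dc) linear_sum /=.
apply: eq_bigr => i _; rewrite linearZ /= /GRing.scale /= -deriveE//.
Qed.

(** Expanding the sum of the squares of B a_i - S b_i gives B (A B - S^2) >= 0; when B = 0 every b_i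
    vanishes and so does S. *)
Lemma cauchy_schwarz_sum (I : finType) (P : pred I) (a b : I -> R) :
  `|\sum_(i | P i) a i * b i| <=
  Num.sqrt (\sum_(i | P i) a i ^+ 2) * Num.sqrt (\sum_(i | P i) b i ^+ 2).
Proof.
set A := \sum_(i | P i) a i ^+ 2; set B := \sum_(i | P i) b i ^+ 2.
have A0 : 0 <= A by apply: sumr_ge0 => i _; exact: sqr_ge0.
have B0 : 0 <= B by apply: sumr_ge0 => i _; exact: sqr_ge0.
set S := \sum_(i | P i) _.
have key : 0 <= B * (A * B - S ^+ 2).
  have : 0 <= \sum_(i | P i) (B * a i - S * b i) ^+ 2.
    by apply: sumr_ge0 => i _; exact: sqr_ge0.
  rewrite (eq_bigr (fun i => B ^+ 2 * a i ^+ 2 - (2 * B * S) * (a i * b i)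
      + S ^+ 2 * b i ^+ 2)); last by move=> i _; ring.
  rewrite big_split sumrB -!mulr_sumr -/A -/B -/S.
  have -> : B * (A * B - S ^+ 2) = (B ^+ 2 * A - 2 * B * S * S) + S ^+ 2 * B by ring.
  by [].
rewrite -sqrtrM// -sqrtr_sqr ler_wsqrtr//.
have [Bz|Bnz] := eqVneq B 0.
  suff -> : S = 0 by rewrite expr0n /= mulr_ge0.
  rewrite /S big1// => i Pi.
  have := @psumr_eq0P _ _ P (fun i => b i ^+ 2) (fun i _ => sqr_ge0 (b i)) Bz i Pi.
  by move=> /eqP; rewrite sqrf_eq0 => /eqP ->; rewrite mulr0.
by rewrite -subr_ge0 -(pmulr_rge0 _ (_ : 0 < B))// lt_neqAle eq_sym Bnz.
Qed.

(** A point outside Omega lies in the open complement of the closed support, so the derivatives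
    vanish there as well. This is what lets the restriction to Omega be dropped along an orbit. *)
Lemma C10_notin (Omega : set 'rV[R]_N) u xi : C10 Omega u -> ~ Omega xi ->
  \forall x \near xi, u x = 0.
Proof.
move=> [_ [_ [_ sub]]] nO.
have : open_nbhs xi (~` closure [set x | u x != 0]).
  split; first exact/closed_openC/closed_closure.
  by move=> /sub.
move=> /open_nbhs_nbhs; apply: filterS => x nx.
by apply/eqP/negPn/negP => ux; apply: nx; exact: subset_closure.
Qed.

Lemma pderiv_notin (Omega : set 'rV[R]_N) u xi i : C10 Omega u -> ~ Omega xi ->
  pderiv u i xi = 0.
Proof.
move=> Cu /(C10_notin Cu) h; rewrite /pderiv.
by rewrite (near_eq_derive (g := fun=> 0) _ h) derive_cst.
Qed.

End gradient.

Section ray.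
Variables (R : realType) (n k m : nat) (gamma : R).
Hypotheses (m0 : (0 < m)%N) (mn : (m <= n)%N).
Let T := 'rV[R]_(n + k).
Implicit Types (u : T -> R) (xi : T) (Omega : set T).

Let drow (s : R) xi : T := \row_i (if (i < m)%N then expR s * xi ord0 i else 0).

(** The quantity z . grad_z u at the orbit point, in coordinates. *)
Definition dray u xi (s : R) := \sum_i drow s xi ord0 i * pderiv u i (dil m s xi).

Lemma is_derive_ray u xi (s : R) : differentiable u (dil m s xi) ->
  is_derive s (1 : R) (fun s => u (dil m s xi)) (dray u xi s).
Proof.
move=> du; apply: (is_derive_along (c := fun s => dil m s xi)) => // i.
under eq_fun do rewrite mxE; rewrite mxE; case: ifP => _; last first.
  exact: is_derive_cst.
apply: (is_derive_eq (is_deriveM (is_derive_expR s) (is_derive_cst (xi ord0 i) s (1 : R)))).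
by rewrite /GRing.scale /= mulr0 add0r mulrC.
Qed.

Lemma continuous_dil xi : continuous (fun s => dil m s xi).
Proof.
move=> s; apply: differentiable_continuous; apply/derivable1_diffP/derivable_mxP => i j.
have [jm|jm] := boolP (j < m)%N; last first.
  rewrite (_ : (fun _ => _) = cst (xi ord0 j)); first exact: derivable_cst.
  by apply/funext => t; rewrite mxE (negbTE jm) mul1r.
rewrite (_ : (fun _ => _) = expR * cst (xi ord0 j)).
  by apply: derivableM; [exact: derivable_expR|exact: derivable_cst].
by apply/funext => t; rewrite mxE jm.
Qed.

Lemma continuous_dray u xi : (forall i, continuous (pderiv u i)) ->
  continuous (dray u xi).
Proof.
move=> cu; apply: continuous_big => [|i _ s]; first exact: add_continuous.
apply: cvgM; last first.
  exact: (continuous_comp (@continuous_dil xi s) (cu i _)).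
rewrite /drow; under eq_cvg do rewrite mxE; rewrite mxE.
case: ifP => _; last exact: cvg_cst.
by apply: cvgM; [exact: continuous_expR|exact: cvg_cst].
Qed.

Lemma gradz_le_gradG_norm u xi :
  Num.sqrt (\sum_(i < n + k | (i < m)%N) pderiv u i xi ^+ 2) <= gradG_norm gamma u xi.
Proof.
apply: ler_wsqrtr; rewrite big_split_ord /= [X in _ + X <= _]big_pred0 ?addr0.
  rewrite -[leLHS]addr0 lerD//; last first.
    by rewrite mulr_ge0 ?sqr_ge0//; apply: sumr_ge0 => i _; exact: sqr_ge0.
  rewrite [leRHS](bigID (fun i : 'I_n => (i < m)%N)) /= lerDl.
  by apply: sumr_ge0 => i _; exact: sqr_ge0.
by move=> j; rewrite ltnNge (leq_trans mn (leq_addr _ _)).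
Qed.

Lemma dray_le u xi (s : R) :
  `|dray u xi s| <= normz m (dil m s xi) * gradG_norm gamma u (dil m s xi).
Proof.
have -> : dray u xi s = \sum_(i < n + k | (i < m)%N) dil m s xi ord0 i * pderiv u i (dil m s xi).
  rewrite /dray [RHS]big_mkcond; apply: eq_bigr => i _; rewrite !mxE.
  by case: ifP => _ //; rewrite mul0r.
apply: (le_trans (cauchy_schwarz_sum _ _ _)); rewrite normzE//.
by apply: ler_wpM2l; [exact: sqrtr_ge0|exact: gradz_le_gradG_norm].
Qed.

Lemma dray_notin Omega u xi (s : R) : C10 Omega u -> ~ Omega (dil m s xi) ->
  dray u xi s = 0.
Proof.
by move=> Cu nO; rewrite /dray big1// => i _; rewrite (pderiv_notin i Cu nO) mulr0.
Qed.

Lemma C10_eq0 Omega u xi : C10 Omega u -> ~ Omega xi -> u xi = 0.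
Proof. by move=> Cu /(C10_notin Cu); exact: nbhs_singleton. Qed.

(** Boundedness of this set gives [ray_large], its closedness gives [normz_gap]. *)
Lemma compact_normz Omega u : C10 Omega u ->
  compact ((fun xi => normz m xi) @` closure [set x | u x != 0]).
Proof.
move=> [_ [_ [cK _]]]; apply: continuous_compact => //.
by apply: continuous_subspaceT; exact: continuous_normz.
Qed.

Lemma support_normz u xi :
  u xi != 0 -> ((fun xi => normz m xi) @` closure [set x | u x != 0]) (normz m xi).
Proof. by move=> ux; exists xi => //; exact: subset_closure. Qed.

Lemma ray_large Omega u : C10 Omega u ->
  exists s1, forall xi s, 1 <= normz m xi -> s1 <= s -> u (dil m s xi) = 0.
Proof.
move=> Cu; have [M [_ hM]] := compact_bounded (compact_normz Cu).
(* e^s > s >= M + 1 together with |z| >= 1 pushes e^s |z| beyond the bound of the support. *)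
exists (M + 1) => xi s xi1 Ms; apply/eqP/negPn/negP => /support_normz.
have M1 : M < M + 1 by rewrite ltrDl.
move=> /(hM _ M1) /=; rewrite normz_dil ger0_norm ?mulr_ge0 ?expR_ge0 ?normz_ge0// leNgt => /negP; apply.
apply: (le_lt_trans Ms); apply: (@lt_le_trans _ _ (expR s)).
  by apply: lt_le_trans (expR_ge1Dx s); rewrite ltrDr.
by rewrite ler_peMr ?expR_ge0.
Qed.

(** A compact set of values that misses a misses an interval around a. Used at a = 0, to leave the
    singular set, and at a = R, to stay inside the cylinder. *)
Lemma normz_gap Omega u (a : R) : C10 Omega u ->
  (forall xi, Omega xi -> normz m xi != a) ->
  exists2 e, 0 < e & forall xi, `|normz m xi - a| < e -> u xi = 0.
Proof.
move=> Cu Oa; have cK := compact_normz Cu.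
have /closed_openC oK := compact_closed (@Rhausdorff R) cK.
have : (~` ((fun xi => normz m xi) @` closure [set x | u x != 0])) a.
  by move=> [xi cxi xia]; have [_ [_ [_ sub]]] := Cu; have := Oa _ (sub _ cxi); rewrite xia eqxx.
move=> na; have /nbhs_ballP[e /= e0 he] := open_nbhs_nbhs (conj oK na).
exists e => // xi xie.
apply/eqP/negPn/negP => /support_normz; apply: he.
by rewrite /ball /= distrC.
Qed.

End ray.

(** * Measurability of the integrands and reduction to orbits *)

Section measurable_integrands.
Variables (R : realType) (n k m : nat) (gamma : R).
Hypotheses (m0 : (0 < m)%N) (mn : (m <= n)%N).
Let T := 'rV[R]_(n + k).
Implicit Types (u G : T -> R) (Omega : set T).

Lemma measurable_intOn Omega G : measurable Omega ->
  measurable_fun [set: T] G ->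
  measurable_fun [set: T] (fun xi => if `[< Omega xi >] then (G xi)%:E else 0%E).
Proof.
move=> mO mG; apply: measurable_fun_ifT => //; last exact/measurable_EFinP.
apply: (measurable_fun_bool true); rewrite setTI.
by rewrite (_ : _ @^-1` _ = Omega)//; apply/seteqP; split => x /=; [move/asboolP|move/asboolP].
Qed.

Lemma measurable_powR_comp G (a : R) : measurable_fun [set: T] G ->
  measurable_fun [set: T] (fun xi => G xi `^ a).
Proof. exact: (measurableT_comp (measurable_powR a)). Qed.

Lemma measurable_absr_powR_C10 Omega u (p : R) : C10 Omega u ->
  measurable_fun [set: T] (fun xi => `|u xi| `^ p).
Proof.
move=> [du _]; apply: measurable_powR_comp; apply: measurableT_comp => //.
by apply: continuous_measurable_row => x; exact: differentiable_continuous.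
Qed.

Lemma measurable_sqrt : measurable_fun [set: R] (@Num.sqrt R).
Proof. exact: continuous_measurable_fun (@sqrt_continuous R). Qed.

Lemma measurable_normx : measurable_fun [set: T] (fun xi : T => normx xi).
Proof. exact: (continuous_measurable_row (@continuous_normx R n k)). Qed.

Lemma measurable_gradG_norm Omega u : C10 Omega u ->
  measurable_fun [set: T] (gradG_norm gamma u).
Proof.
move=> [_ [cu _]]; apply: (measurableT_comp measurable_sqrt).
have mu i : measurable_fun [set: T] (fun xi => pderiv u i xi ^+ 2).
  by apply: measurable_funX; exact: (continuous_measurable_row (cu i)).
apply: measurable_funD; first by apply: measurable_sum => i; exact: mu.
apply: measurable_funM; last by apply: measurable_sum => i; exact: mu.
by apply: measurable_funX; apply: measurable_powR_comp; exact: measurable_normx.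
Qed.

Lemma measurable_gaugeG : measurable_fun [set: T] (fun xi : T => gaugeG gamma xi).
Proof.
apply: measurable_powR_comp; apply: measurable_funD.
  by apply: measurable_powR_comp; exact: measurable_normx.
apply: measurable_funM => //; apply: measurable_funX.
apply: (measurableT_comp measurable_sqrt); apply: measurable_sum => j.
by apply: measurable_funX; exact: measurable_coord.
Qed.

(** |z| <= |x|, and |x| is the gauge with the y-term dropped. *)
Lemma gaugeG_ge (xi : T) : 0 <= gamma -> normz m xi <= gaugeG gamma xi.
Proof.
move=> g0; have g1 : 0 < 1 + gamma by rewrite ltr_pwDl.
apply: (@le_trans _ _ (normx xi)).
  rewrite normzE// normxE; apply: ler_wsqrtr.
  rewrite /sumsq [leLHS]big_mkcond [leRHS]big_mkcond; apply: ler_sum => i _.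
  case: ifP => [im|_]; last by case: ifP => // _; exact: sqr_ge0.
  by rewrite (leq_trans im mn).
have x0 : 0 <= normx xi by exact: sqrtr_ge0.
rewrite -[leLHS](powRr1 x0) (_ : 1 = 2 * (1 + gamma) * (1 / (2 + 2 * gamma))); last first.
  by field; rewrite gt_eqF// -{1}(mulr1 2) -mulrDr mulr_gt0.
rewrite powRrM; apply: ge0_ler_powR.
- by rewrite divr_ge0// -{1}(mulr1 2) -mulrDr mulr_ge0// ltW.
- by rewrite nnegrE powR_ge0.
- by rewrite nnegrE addr_ge0 ?powR_ge0// mulr_ge0 ?sqr_ge0.
- by rewrite lerDl mulr_ge0 ?sqr_ge0.
Qed.

Lemma measurable_ray (f : T -> \bar R) (xi : T) : measurable_fun [set: T] f ->
  measurable_fun [set: R] (fun s => f (dil m s xi) * (expR (m%:R * s))%:E)%E.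
Proof.
move=> mf; apply: emeasurable_funM.
  apply: (measurableT_comp mf).
  exact: (measurableT_comp (@measurable_dil R (n + k) m) (pair2_measurable xi)).
apply/measurable_EFinP; apply: (measurableT_comp (@measurable_expR R)).
exact: measurable_funM.
Qed.

(** The reduction to orbits: in polar form the inner integrals are compared on the shell and vanish
    off it. Points with z = 0 are never inspected. *)
Lemma lebN_ray_le (f1 f2 : T -> \bar R) (c : R) :
  measurable_fun [set: T] f1 -> measurable_fun [set: T] f2 ->
  (forall x, 0 <= f1 x)%E -> (forall x, 0 <= f2 x)%E -> 0 <= c ->
  (forall xi : T, (1 <= normz m xi)%R ->
    c%:E * \int[@lebesgue_measure R]_s (f1 (dil m s xi) * (expR (m%:R * s))%:E) <=
    \int[@lebesgue_measure R]_s (f2 (dil m s xi) * (expR (m%:R * s))%:E))%E ->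
  (c%:E * lebN f1 <= lebN f2)%E.
Proof.
move=> mf1 mf2 f10 f20 c0 ray.
have mp f : measurable_fun [set: T] f -> (forall x, 0 <= f x)%E ->
    measurable_fun [set: T] (fun xi => \int[@lebesgue_measure R]_s
      ((\1_(@shell R n k m) xi)%:E * (f (dil m s xi) * (expR (m%:R * s))%:E)))%E.
  move=> mf f0.
  apply: (measurable_fun_fubini_tonelli_G (m1 := @lebesgue_measure R) (fun x =>
    ((\1_(@shell R n k m) x.2)%:E * (f (dil m x.1 x.2) * (expR (m%:R * x.1))%:E))%E)).
    exact: measurable_polar.
  by move=> x; rewrite !mule_ge0// lee_fin expR_ge0.
have p0 f : (forall x, 0 <= f x)%E -> forall xi, (0 <= \int[@lebesgue_measure R]_s
      ((\1_(@shell R n k m) xi)%:E * (f (dil m s xi) * (expR (m%:R * s))%:E)))%E.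
  by move=> f0 xi; apply: integral_ge0 => s _; rewrite !mule_ge0// lee_fin expR_ge0.
rewrite (lebN_polar m0 mn mf1 f10) (lebN_polar m0 mn mf2 f20).
rewrite -lebNZl//; [|exact: mp|exact: p0].
apply: le_lebN.
- by apply: measurable_funeM; exact: mp.
- exact: mp.
- by move=> xi; rewrite mule_ge0//; exact: p0.
move=> xi; rewrite indicE; have [xis|xis] := boolP (xi \in _); last first.
  by rewrite integral0_eq ?mule0 ?integral_ge0// => s _; rewrite ?mul0e.
under eq_integral do rewrite mul1e.
under [leRHS]eq_integral do rewrite mul1e.
by apply: ray; move: xis; rewrite inE => /andP[].
Qed.

End measurable_integrands.

(** * The inequality with a power weight *)

Section inequalities.
Variables (R : realType) (n k m : nat) (gamma : R).
Hypotheses (m0 : (0 < m)%N) (mn : (m <= n)%N).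
Let T := 'rV[R]_(n + k).
Implicit Types (u G : T -> R) (Omega : set T).

Lemma measurable_lhs_power Omega u (p beta : R) : C10 Omega u ->
  measurable_fun [set: T] (fun xi => `|u xi| `^ p * normz m xi `^ beta).
Proof.
move=> Cu; apply: measurable_funM; first exact: measurable_absr_powR_C10 Cu.
by apply: measurable_powR_comp; exact: measurable_normz.
Qed.

Lemma hardy_power (p beta : R) Omega u : 1 < p -> open Omega ->
  (m%:R + beta < 0 -> Omega `<=` [set xi | normz m xi != 0]) -> C10 Omega u ->
  (((`|m%:R + beta| / p) `^ p)%:E *
     intOn Omega (fun xi => (`|u xi| `^ p * normz m xi `^ beta)%R) <=
   intOn Omega (fun xi => (gradG_norm gamma u xi `^ p * normz m xi `^ (p + beta))%R))%E.
Proof.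
move=> p1 oO Oz Cu; have p0 : 0 < p := lt_trans ltr01 p1.
have mO := open_measurable_row oO.
have mf2 : measurable_fun [set: T] (fun xi => if `[< Omega xi >] then
    (gradG_norm gamma u xi `^ p * normz m xi `^ (p + beta))%:E else 0%E).
  apply: measurable_intOn => //; apply: measurable_funM.
    by apply: measurable_powR_comp; exact: measurable_gradG_norm Cu.
  by apply: measurable_powR_comp; exact: measurable_normz.
apply: (lebN_ray_le m0 mn); rewrite ?powR_ge0//.
- apply: measurable_intOn => //; exact: measurable_lhs_power Cu.
- by move=> x; case: ifP => // _; rewrite lee_fin mulr_ge0 ?powR_ge0.
- by move=> x; case: ifP => // _; rewrite lee_fin mulr_ge0 ?powR_ge0.
move=> xi xi1; have z0 : 0 < normz m xi := lt_le_trans ltr01 xi1.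
set z := normz m xi in z0 *; pose g s := u (dil m s xi); pose dg := dray m u xi.
have [du [cu _]] := Cu.
have dgE (s : R) : is_derive s (1 : R) g (dg s) by exact: is_derive_ray.
have cdg : continuous dg by exact: continuous_dray.
have [s1 hs1] := ray_large mn Cu.
have b2 : m%:R + beta < 0 -> exists s2, forall s, s <= s2 -> g s = 0.
  move=> /Oz Oz'; have [e e0 he] := normz_gap mn Cu Oz'.
  (* For s up to this value e^s |z| < e; the -1 makes the inequality strict. *)
  exists (ln (e / z) - 1) => s ss; rewrite /g; apply: he.
  rewrite subr0 ger0_norm ?normz_ge0// normz_dil -ltr_pdivlMr//.
  rewrite -[ltRHS]lnK ?posrE ?divr_gt0// ltr_expR (le_lt_trans ss)//.
  by rewrite gtrBl.
have H := hardy_exp p1 dgE cdg (fun s => hs1 xi s xi1) b2.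
have mA : measurable_fun [set: R] (fun s => (`|g s| `^ p * expR ((m%:R + beta) * s))%:E).
  apply/measurable_EFinP; apply: measurable_funM.
    apply: (measurableT_comp (measurable_powR p)); apply: measurableT_comp => //.
    apply: continuous_measurable_fun => s; apply: differentiable_continuous.
    by apply/derivable1_diffP; apply: ex_derive.
  by apply: (measurableT_comp (@measurable_expR R)); exact: measurable_funM.
have mB : measurable_fun [set: R] (fun s => (`|dg s| `^ p * expR ((m%:R + beta) * s))%:E).
  apply/measurable_EFinP; apply: measurable_funM.
    apply: (measurableT_comp (measurable_powR p)); apply: measurableT_comp => //.
    exact: continuous_measurable_fun.
  by apply: (measurableT_comp (@measurable_expR R)); exact: measurable_funM.
(* The Jacobian e^(m s) and the weight combine into e^((m + beta) s); the constant factor |z|^beta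
   is common to both sides. *)
have wE s : (expR s * z) `^ beta * expR (m%:R * s) = z `^ beta * expR ((m%:R + beta) * s).
  rewrite powRM ?expR_ge0 ?ltW// -expRM mulrAC -expRD mulrC.
  by congr (_ * expR _); ring.
have -> : (\int[@lebesgue_measure R]_s ((if `[< Omega (dil m s xi) >] then
   (`|u (dil m s xi)| `^ p * normz m (dil m s xi) `^ beta)%:E else 0) * (expR (m%:R * s))%:E) =
   (z `^ beta)%:E * \int[@lebesgue_measure R]_s (`|g s| `^ p * expR ((m%:R + beta) * s))%:E)%E.
  rewrite -ge0_integralZl_EFin ?powR_ge0//.
  apply: eq_integral => s _; case: asboolP => [_|nO].
    by rewrite -!EFinM normz_dil -mulrA wE mulrCA.
  by rewrite /g (C10_eq0 Cu nO) normr0 powR0 ?gt_eqF// !mul0r mule0 mul0e.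
rewrite muleCA.
apply: (le_trans (lee_wpmul2l _ H)); first by rewrite lee_fin powR_ge0.
rewrite -ge0_integralZl_EFin ?powR_ge0//.
apply: ge0_le_integral => //.
- by move=> s _; rewrite lee_fin !mulr_ge0 ?powR_ge0 ?expR_ge0.
- exact: measurable_funeM.
- exact: measurable_ray mf2.
move=> s _; case: asboolP => [Os|nO]; last first.
  by rewrite /dg (dray_notin Cu nO) normr0 powR0 ?gt_eqF// mul0r mule0 mul0e.
rewrite -!EFinM lee_fin normz_dil -/z.
rewrite mulrCA -wE !mulrA ler_wpM2r ?expR_ge0//.
have zp : 0 < expR s * z by rewrite mulr_gt0 ?expR_gt0.
(* The factor |z|^p of the right-hand weight is spent on [dray_le], which bounds |dg| by |z| times
   the gradient norm. *)
rewrite [(_ * z) `^ (p + beta)]powRD ?(gt_eqF zp) ?implybT// mulrA ler_wpM2r ?powR_ge0//.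
have := dray_le gamma mn u xi s; rewrite -/dg normz_dil -/z => h.
rewrite [leRHS]mulrC -(powRM _ (ltW zp) (sqrtr_ge0 _)).
apply: ge0_ler_powR => //; first exact: ltW.
by rewrite nnegrE mulr_ge0 ?sqrtr_ge0// ltW.
Qed.

End inequalities.

(** * The inequality with a logarithmic weight, and the gauge *)

Section inequalities_log.
Variables (R : realType) (n k m : nat) (gamma : R).
Hypotheses (m0 : (0 < m)%N) (mn : (m <= n)%N).
Let T := 'rV[R]_(n + k).
Implicit Types (u G : T -> R) (Omega : set T).

Lemma open_normz_lt (r : R) : open [set xi : T | normz m xi < r].
Proof.
have := @continuous_normz R n k m mn; move=> /continuousP /(_ _ (@open_lt R r)).
by congr open.
Qed.

Lemma measurable_ln_normz (r : R) : measurable_fun [set: T] (fun xi => ln (r / normz m xi)).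
Proof.
apply: (measurableT_comp (@measurable_ln R)); apply: measurable_funM => //.
have mi : measurable_fun [set: R] (fun x : R => x `^ (-1)) by exact: measurable_powR.
under eq_fun do rewrite -powR_inv1 ?sqrtr_ge0//.
exact: (measurableT_comp mi (measurable_normz mn)).
Qed.

(** Because p = m, the factor |z|^(-p) cancels the Jacobian e^(m s) and leaves (S - s)^beta with S =
    ln (r / |z|), the parameter at which the orbit reaches |z| = r. *)
Lemma hardy_log_ball (r beta : R) u : 1 < m%:R :> R -> 0 < r -> beta < -1 ->
  let p : R := m%:R in let Omega := [set xi : T | normz m xi < r] in
  C10 Omega u ->
  (((`|beta + 1| / p) `^ p)%:E *
     intOn Omega (fun xi => (`|u xi| `^ p / normz m xi `^ p * ln (r / normz m xi) `^ beta)%R) <=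
   intOn Omega (fun xi => (gradG_norm gamma u xi `^ p * ln (r / normz m xi) `^ (p + beta))%R))%E.
Proof.
move=> p1 r0 b1 p Omega Cu; have p0 : 0 < p := lt_trans ltr01 p1.
have mO : measurable Omega := open_measurable_row (@open_normz_lt r).
have mf2 : measurable_fun [set: T] (fun xi => if `[< Omega xi >] then
    (gradG_norm gamma u xi `^ p * ln (r / normz m xi) `^ (p + beta))%:E else 0%E).
  apply: measurable_intOn => //; apply: measurable_funM.
    by apply: measurable_powR_comp; exact: measurable_gradG_norm Cu.
  by apply: measurable_powR_comp; exact: measurable_ln_normz.
apply: (lebN_ray_le m0 mn); rewrite ?powR_ge0//.
- apply: measurable_intOn => //; apply: measurable_funM; last first.
    by apply: measurable_powR_comp; exact: measurable_ln_normz.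
  under eq_fun do rewrite -powRN; exact: measurable_lhs_power Cu.
- by move=> x; case: ifP => // _; rewrite lee_fin mulr_ge0 ?divr_ge0 ?powR_ge0.
- by move=> x; case: ifP => // _; rewrite lee_fin mulr_ge0 ?powR_ge0.
move=> xi xi1; have z0 : 0 < normz m xi := lt_le_trans ltr01 xi1.
set z := normz m xi in z0 *; pose g s := u (dil m s xi); pose dg := dray m u xi.
have [du [cu _]] := Cu.
have dgE (s : R) : is_derive s (1 : R) g (dg s) by exact: is_derive_ray.
have cdg : continuous dg by exact: continuous_dray.
pose S := ln (r / z).
have Or xi' : Omega xi' -> normz m xi' != r by move=> /lt_eqF ->.
have [e e0 he] := normz_gap mn Cu Or.
(* The margin is smaller than [e], so that u already vanishes at this radius, and smaller than [r],
   so that the radius is positive. *)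
pose s1 := ln ((r - Num.min e r / 2) / z).
have mer : Num.min e r / 2 < Num.min e r by rewrite ltr_pdivrMr// ltr_pMr ?ltr1n// lt_min e0.
have rp : 0 < r - Num.min e r / 2.
  by rewrite subr_gt0 (lt_le_trans mer)// ge_min lexx orbT.
have me0 : 0 < Num.min e r / 2 by rewrite divr_gt0// lt_min e0.
have s1S : s1 < S.
  by rewrite ltr_ln ?posrE ?divr_gt0// ltr_pM2r ?invr_gt0// gtrBl.
have eS s : s1 <= s -> r - Num.min e r / 2 <= expR s * z.
  by move=> s1s; rewrite -ler_pdivrMr// -[leLHS]lnK ?posrE ?divr_gt0// ler_expR.
have hs1 s : s1 <= s -> g s = 0.
  move=> /eS es; rewrite /g; have [zr|zr] := ltP (expR s * z) r; last first.
    by apply: (C10_eq0 Cu); rewrite /Omega /= normz_dil -/z => /(le_lt_trans zr); rewrite ltxx.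
  apply: he; rewrite normz_dil -/z ltr0_norm ?subr_lt0// opprB.
  rewrite ltrBlDr -ltrBlDl; apply: lt_le_trans es; rewrite ltrD2l ltrN2.
  by rewrite (lt_le_trans mer)// ge_min lexx.
have H := hardy_log p1 b1 dgE cdg s1S hs1.
have mth : measurable_fun [set: R] (fun s => S - s).
  apply: continuous_measurable_fun => s.
  by apply: cvgB; [exact: cvg_cst|exact: cvg_id].
have mA : measurable_fun [set: R] (fun s => (`|g s| `^ p * (S - s) `^ beta)%:E).
  apply/measurable_EFinP; apply: measurable_funM.
    apply: (measurableT_comp (measurable_powR p)); apply: measurableT_comp => //.
    apply: continuous_measurable_fun => s; apply: differentiable_continuous.
    by apply/derivable1_diffP; apply: ex_derive.
  exact: (measurableT_comp (measurable_powR beta)).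
have mB : measurable_fun [set: R] (fun s => (`|dg s| `^ p * (S - s) `^ (p + beta))%:E).
  apply/measurable_EFinP; apply: measurable_funM.
    apply: (measurableT_comp (measurable_powR p)); apply: measurableT_comp => //.
    exact: continuous_measurable_fun.
  exact: (measurableT_comp (measurable_powR (p + beta))).
have zE s : (expR s * z) `^ p = expR (p * s) * z `^ p.
  by rewrite powRM ?expR_ge0 ?ltW// -expRM (mulrC s).
have lnE s : ln (r / (expR s * z)) = S - s.
  by rewrite /S !ln_div ?posrE ?mulr_gt0 ?expR_gt0// lnM ?posrE ?expR_gt0// expRK; ring.
have zp0 : 0 < z `^ p by rewrite powR_gt0.
have -> : (\int[@lebesgue_measure R]_s ((if `[< Omega (dil m s xi) >] then
   (`|u (dil m s xi)| `^ p / normz m (dil m s xi) `^ p *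
      ln (r / normz m (dil m s xi)) `^ beta)%:E else 0) * (expR (m%:R * s))%:E) =
   ((z `^ p)^-1)%R%:E * \int[@lebesgue_measure R]_s (`|g s| `^ p * (S - s) `^ beta)%:E)%E.
  rewrite -ge0_integralZl_EFin ?invr_ge0 ?powR_ge0//; last first.
    by move=> s _; rewrite lee_fin mulr_ge0 ?powR_ge0.
  apply: eq_integral => s _; case: asboolP => [_|nO].
    rewrite -!EFinM normz_dil -/z lnE zE -/p; congr EFin; rewrite -/(g s).
    by field; rewrite (gt_eqF zp0) gt_eqF ?expR_gt0.
  by rewrite /g (C10_eq0 Cu nO) normr0 powR0 ?gt_eqF// !mul0r mule0 mul0e.
rewrite muleCA.
apply: (le_trans (lee_wpmul2l _ H)); first by rewrite lee_fin invr_ge0 powR_ge0.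
rewrite -ge0_integralZl_EFin ?invr_ge0 ?powR_ge0//; last first.
  by move=> s _; rewrite lee_fin mulr_ge0 ?powR_ge0.
apply: ge0_le_integral => //.
- by move=> s _; rewrite lee_fin !mulr_ge0 ?invr_ge0 ?powR_ge0.
- exact: measurable_funeM.
- exact: measurable_ray mf2.
move=> s _; case: asboolP => [Os|nO]; last first.
  by rewrite /dg (dray_notin Cu nO) normr0 powR0 ?gt_eqF// mul0r mule0 mul0e.
rewrite -!EFinM lee_fin normz_dil -/z lnE.
rewrite mulrA [leRHS]mulrAC ler_wpM2r ?powR_ge0//.
rewrite mulrC ler_pdivrMr// -mulrA -/p -zE.
have zp : 0 < expR s * z by rewrite mulr_gt0 ?expR_gt0.
have := dray_le gamma mn u xi s; rewrite -/dg normz_dil -/z => h.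
rewrite [leRHS]mulrC -(powRM _ (ltW zp) (sqrtr_ge0 _)).
apply: ge0_ler_powR => //.
by rewrite nnegrE mulr_ge0 ?sqrtr_ge0// ltW.
Qed.

(** The case beta = -p, in which the logarithm disappears on the right. *)
Lemma hardy_log_ball_sharp_exponent (r : R) u : 1 < m%:R :> R -> 0 < r ->
  let p : R := m%:R in let Omega := [set xi : T | normz m xi < r] in
  C10 Omega u ->
  ((((p - 1) / p) `^ p)%:E *
     intOn Omega (fun xi => (`|u xi| `^ p / (normz m xi * ln (r / normz m xi)) `^ p)%R) <=
   intOn Omega (fun xi => (gradG_norm gamma u xi `^ p)%R))%E.
Proof.
move=> p1 r0 p Omega Cu; have p0 : 0 < p := lt_trans ltr01 p1.
have b1 : - p < -1 by rewrite ltrN2.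
have := hardy_log_ball p1 r0 b1 Cu.
have -> : `|- p + 1| = p - 1.
  by rewrite ler0_norm ?opprD ?opprK// -lerBrDr sub0r ltW.
rewrite /intOn.
under [X in (_ * X <= _)%E -> _]eq_lebN => xi.
  rewrite (_ : (if _ then _ else _) = (if `[< Omega xi >] then
    (`|u xi| `^ p / (normz m xi * ln (r / normz m xi)) `^ p)%:E else 0%E)); last first.
    case: asboolP => // xr; congr EFin.
    (* At z = 0 both integrands are 0 by the convention 1 / 0 = 0. *)
    have [z0|z0] := eqVneq (normz m xi) 0.
      by rewrite z0 mul0r powR0 ?gt_eqF// invr0 !mulr0 mul0r.
    have zp : 0 < normz m xi by rewrite lt_neqAle eq_sym z0 normz_ge0.
    have lp : 0 < ln (r / normz m xi) by rewrite ln_gt0// ltr_pdivlMr// mul1r.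
    by rewrite powRM ?ltW// powRN invfM mulrA.
  over.
under [X in (_ <= X)%E -> _]eq_lebN => xi.
  rewrite subrr powRr0 mulr1.
  over.
by [].
Qed.

(** The pointwise inequality can fail at z = 0, where 1 / |z|^p is 0 by convention while the gauge
    may be positive. The comparison is therefore made along orbits, with constant 1. *)
Lemma le_intOn_gauge (p c : R) Omega u : 0 < p -> 0 <= c -> 0 <= gamma ->
  open Omega -> C10 Omega u ->
  (c%:E * intOn Omega (fun xi => (`|u xi| `^ p / gaugeG gamma xi `^ p)%R) <=
   c%:E * intOn Omega (fun xi => (`|u xi| `^ p / normz m xi `^ p)%R))%E.
Proof.
move=> p0 c0 g0 oO Cu; apply: lee_wpmul2l; first by rewrite lee_fin.
have mO := open_measurable_row oO.
have mf1 : measurable_fun [set: T] (fun xi => if `[< Omega xi >] then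
    (`|u xi| `^ p / gaugeG gamma xi `^ p)%:E else 0%E).
  apply: measurable_intOn => //; under eq_fun do rewrite -powRN.
  apply: measurable_funM; first exact: measurable_absr_powR_C10 Cu.
  by apply: measurable_powR_comp; exact: measurable_gaugeG.
have mf2 : measurable_fun [set: T] (fun xi => if `[< Omega xi >] then
    (`|u xi| `^ p / normz m xi `^ p)%:E else 0%E).
  apply: measurable_intOn => //; under eq_fun do rewrite -powRN.
  exact: measurable_lhs_power Cu.
have f10 (x : T) : (0 <= if `[< Omega x >] then (`|u x| `^ p / gaugeG gamma x `^ p)%:E else 0%E)%E.
  by case: ifP => // _; rewrite lee_fin divr_ge0 ?powR_ge0.
have f20 (x : T) : (0 <= if `[< Omega x >] then (`|u x| `^ p / normz m x `^ p)%:E else 0%E)%E.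
  by case: ifP => // _; rewrite lee_fin divr_ge0 ?powR_ge0.
have := @lebN_ray_le R n k m m0 mn _ _ 1 mf1 mf2 f10 f20 ler01.
rewrite mul1e; apply => xi xi1; rewrite mul1e; apply: ge0_le_integral => //.
- by move=> s _; rewrite mule_ge0// lee_fin expR_ge0.
- exact: measurable_ray mf1.
- exact: measurable_ray mf2.
move=> s _; rewrite lee_wpmul2r ?lee_fin ?expR_ge0//; case: ifP => // _.
rewrite lee_fin ler_wpM2l ?powR_ge0//.
have zp : 0 < normz m (dil m s xi).
  by rewrite normz_dil mulr_gt0 ?expR_gt0// (lt_le_trans ltr01).
have gz := gaugeG_ge mn (dil m s xi) g0.
have gp : 0 < gaugeG gamma (dil m s xi) := lt_le_trans zp gz.
rewrite lef_pV2 ?posrE; [|exact: (powR_gt0 p gp)|exact: (powR_gt0 p zp)].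
by apply: ge0_ler_powR; rewrite ?nnegrE ?(ltW p0) ?(ltW zp) ?(ltW gp).
Qed.

End inequalities_log.

(** * Nearly optimal functions of one variable *)

Section bump.
Variable R : realType.
Implicit Types t x : R.

(** A cut-off that is only C^1, but with an explicit derivative; [C10] asks for no more
    regularity. *)
Definition msq x := Num.max x 0 ^+ 2.
Definition dmsq x := 2 * Num.max x 0.

Lemma is_derive_sqr x : is_derive x (1 : R) (fun y : R => y ^+ 2) (2 * x).
Proof.
have -> : (fun y : R => y ^+ 2) = (@id R) * (@id R).
  by apply/funext => y; rewrite expr2.
apply: (is_derive_eq (is_deriveM (is_derive_id x (1 : R)) (is_derive_id x (1 : R)))).
by rewrite /GRing.scale /= mulr1 mulrDl mul1r.
Qed.

Lemma continuous_max0 : continuous (fun x : R => Num.max x 0).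
Proof. by move=> x; apply: continuous_max; [exact: cvg_id|exact: cvg_cst]. Qed.

Lemma is_derive_msq x : is_derive x (1 : R) msq (dmsq x).
Proof.
have [x0|x0|->] := ltgtP x 0.
- have H : is_derive x (1 : R) (cst (0 : R)) (dmsq x).
    by apply: (is_derive_eq (is_derive_cst _ _ _)); rewrite /dmsq max_r ?ltW// mulr0.
  apply: near_eq_is_derive H.
  by near=> y; rewrite /msq max_r ?expr0n// ltW//; near: y; exact: lt_nbhsl.
- have H : is_derive x (1 : R) (fun y : R => y ^+ 2) (dmsq x).
    by apply: (is_derive_eq (is_derive_sqr x)); rewrite /dmsq max_l ?ltW.
  apply: near_eq_is_derive H.
  by near=> y; rewrite /msq max_l// ltW//; near: y; exact: lt_nbhsr.
- have h0 : (fun h : R => h^-1 *: (msq (h *: (1 : R^o) + (0 : R^o)) - msq 0 : R^o)) @ 0^' --> (0 : R).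
    apply/cvgr0Pnorm_lt => e e0; near=> h.
    have hn : h != 0 by near: h; exact: nbhs_dnbhs_neq.
    have he : `|h| < e by near: h; exact: dnbhs0_lt.
    apply: le_lt_trans he; rewrite addr0 /GRing.scale /= mulr1 /msq maxxx expr0n subr0.
    rewrite normrM normfV normrX expr2 ler_pdivrMl ?normr_gt0//.
    have mh : `|Num.max h 0| <= `|h|.
      by have [h1|h1] := leP h 0; rewrite ?normr0.
    by apply: ler_pM.
  rewrite /dmsq maxxx mulr0.
  by apply: DeriveDef; [exact: cvgP h0|exact: cvg_lim h0].
Unshelve. all: end_near. Qed.

Lemma continuous_dmsq : continuous dmsq.
Proof. by move=> x; apply: cvgM; [exact: cvg_cst|exact: continuous_max0]. Qed.

Lemma msq_ge0 x : 0 <= msq x. Proof. exact: sqr_ge0. Qed.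

Lemma msq_eq0 x : x <= 0 -> msq x = 0.
Proof. by move=> x0; rewrite /msq max_r// expr0n. Qed.

Definition hump t := msq (1 - t ^+ 2).
Definition dhump t := dmsq (1 - t ^+ 2) * - (2 * t).

Lemma is_derive_hump t : is_derive t (1 : R) hump (dhump t).
Proof.
have h : is_derive t (1 : R) (fun t : R => 1 - t ^+ 2) (- (2 * t)).
  have := is_deriveB (is_derive_cst (1 : R) t (1 : R)) (is_derive_sqr t).
  by rewrite sub0r.
exact: (@is_derive1_comp R msq (fun t => 1 - t ^+ 2) t _ _ (is_derive_msq _) h).
Qed.

Lemma continuous_dhump : continuous dhump.
Proof.
move=> t; apply: cvgM.
  have c1 : {for t, continuous (fun t : R => 1 - t ^+ 2)}.
    by apply: cvgB; [exact: cvg_cst|exact: exprn_continuous].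
  exact: (continuous_comp c1 (@continuous_dmsq _)).
by apply: cvgN; apply: cvgM; [exact: cvg_cst|exact: cvg_id].
Qed.

Lemma hump_eq0 t : 1 <= `|t| -> hump t = 0.
Proof. by move=> t1; rewrite /hump msq_eq0// subr_le0 -(real_normK (num_real t)) exprn_ege1. Qed.

Lemma dhump_eq0 t : 1 <= `|t| -> dhump t = 0.
Proof.
move=> t1; rewrite /dhump /dmsq max_r ?mulr0 ?mul0r//.
by rewrite subr_le0 -(real_normK (num_real t)) exprn_ege1.
Qed.

Lemma hump_ge0 t : 0 <= hump t. Proof. exact: msq_ge0. Qed.

Lemma hump_le1 t : hump t <= 1.
Proof.
rewrite /hump /msq expr_le1 ?le_max ?lexx ?orbT// ge_max ler01 andbT.
by rewrite gerBl sqr_ge0.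
Qed.

Lemma hump_ge t : `|t| <= 2^-1 -> 2^-1 <= hump t.
Proof.
move=> t1; have t2 : t ^+ 2 <= 4^-1.
  rewrite -(real_normK (num_real t)) (_ : 4^-1 = 2^-1 ^+ 2 :> R); last by field.
  by rewrite ler_sqr ?nnegrE.
have h : 3 / 4 <= 1 - t ^+ 2 by lra.
rewrite /hump /msq max_l; last by lra.
apply: (@le_trans _ _ ((3 / 4) ^+ 2)); first by lra.
by rewrite ler_sqr ?nnegrE; lra.
Qed.

Lemma dhump_le t : `|dhump t| <= 4.
Proof.
have [t1|/ltW t1] := leP `|t| 1; last by rewrite dhump_eq0// normr0.
have m1 : 0 <= Num.max (1 - t ^+ 2) 0 <= 1.
  by rewrite le_max lexx orbT/= ge_max ler01 andbT gerBl sqr_ge0.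
rewrite /dhump /dmsq normrM normrN !normrM (ger0_norm (andP m1).1) (@ger0_norm R 2)//.
have := normr_ge0 t; move: (Num.max _ _) m1 => M /andP[M0 M1] t0.
have h : M * `|t| <= 1 by rewrite mulr_ile1.
by rewrite (_ : 2 * M * (2 * `|t|) = 4 * (M * `|t|)); [lra|ring].
Qed.

End bump.

(** Convexity of t^p at a / x and b / (1 - x), with weights x and 1 - x, gives l = x^(1-p), which
    tends to 1 as x does, and D = (1 - x)^(1-p). The coefficient near 1 preserves a main term, while
    the possibly huge D falls on an error term. *)
Lemma powRD_split (R : realType) (p C1 C : R) : 1 < p -> 0 < C1 -> C1 < C ->
  exists2 l : R, 0 < l & l * C1 < C /\ exists2 D : R, 0 < D &
    forall a b : R, 0 <= a -> 0 <= b -> (a + b) `^ p <= l * a `^ p + D * b `^ p.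
Proof.
move=> p1 C10 C1C; have p0 : 0 < p := lt_trans ltr01 p1.
have C0 : 0 < C := lt_trans C10 C1C.
have q0 : 0 < p - 1 by rewrite subr_gt0.
(* y lies strictly between C1 / C and 1, and x^(p-1) = y makes l = 1 / y < C / C1. *)
pose y := (C1 / C + 1) / 2; pose x := y `^ (p - 1)^-1.
have cc : C1 / C < 1 by rewrite ltr_pdivrMr// mul1r.
have cc0 : 0 < C1 / C by rewrite divr_gt0.
have y0 : 0 < y by rewrite /y; lra.
have y1 : y < 1 by rewrite /y; lra.
have x0 : 0 < x by rewrite powR_gt0.
have x1 : x < 1.
  have : x < 1 `^ (p - 1)^-1.
    by apply: gt0_ltr_powR; rewrite ?invr_gt0 ?nnegrE ?(ltW y0).
  by rewrite powR1.
have xp : x `^ (p - 1) = y by rewrite -powRrM mulVf ?gt_eqF// powRr1// ltW.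
have t0 : 0 < 1 - x by rewrite subr_gt0.
exists (x `^ (1 - p)); first by rewrite powR_gt0.
split.
  rewrite -opprB powRN xp mulrC ltr_pdivrMr// mulrC -ltr_pdivrMr// /y.
  by rewrite -(ltr_pM2r (_ : 0 < 2)) //; lra.
exists ((1 - x) `^ (1 - p)); first by rewrite powR_gt0.
move=> a b a0 b0.
have h1 : 0 <= a / x by rewrite divr_ge0// ltW.
have h2 : 0 <= b / (1 - x) by rewrite divr_ge0// ltW.
have cv : (x * (a / x) + (1 - x) * (b / (1 - x))) `^ p <=
    x * (a / x) `^ p + (1 - x) * (b / (1 - x)) `^ p.
  by apply: (@convex_powR R p (ltW p1) (Itv01 (ltW x0) (ltW x1)) (a / x) (b / (1 - x)));
    rewrite inE /= in_itv /= andbT.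
move: cv; rewrite mulrCA divff ?gt_eqF// mulr1 mulrCA divff ?gt_eqF// mulr1.
move=> /le_trans; apply; rewrite le_eqVlt; apply/orP; left; apply/eqP.
have E (z c : R) : 0 < z -> 0 <= c -> z * (c / z) `^ p = z `^ (1 - p) * c `^ p.
  move=> z0 c0; have zi : 0 <= z^-1 by rewrite invr_ge0 (ltW z0).
  rewrite (powRM _ c0 zi) powRD ?(gt_eqF z0) ?implybT// (powRr1 (ltW z0)).
  by rewrite -(powR_inv1 (ltW z0)) -powRrM mulN1r; ring.
by rewrite !E.
Qed.

(** * Long bumps and truncated extremals *)

Section profile.
Variable R : realType.
Let mu := @lebesgue_measure R.

Section scaled_bump.
Variables (c L : R).
Hypothesis L0 : 0 < L.
Definition sbump t : R := hump ((t - c) / L).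
Definition dsbump t : R := dhump ((t - c) / L) / L.

Lemma is_derive_sbump t : is_derive t (1 : R) sbump (dsbump t).
Proof.
have h : is_derive t (1 : R) (fun t => (t - c) / L) (L^-1).
  have h1 := is_deriveB (is_derive_id t (1 : R)) (is_derive_cst c t (1 : R)).
  have h2 := is_deriveM h1 (is_derive_cst L^-1 t (1 : R)).
  apply: (is_derive_eq h2).
  by rewrite /GRing.scale /= mulr0 add0r subr0 mulr1.
have H := @is_derive1_comp R (@hump R) (fun t => (t - c) / L) t _ _ (is_derive_hump _) h.
exact: H.
Qed.

Let cl : continuous (fun t : R => (t - c) / L).
Proof.
move=> t; apply: cvgM; last exact: cvg_cst.
by apply: cvgB; [exact: cvg_id|exact: cvg_cst].
Qed.

Lemma continuous_dsbump : continuous dsbump.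
Proof.
move=> t; apply: cvgM; last exact: cvg_cst.
have c1 : {for t, continuous (fun t : R => (t - c) / L)} by exact: cl.
exact: (continuous_comp c1 (@continuous_dhump R _)).
Qed.

Lemma continuous_sbump : continuous sbump.
Proof.
move=> t; apply: differentiable_continuous; apply/derivable1_diffP.
by apply: ex_derive; exact: is_derive_sbump.
Qed.

Let scaled t : `|(t - c) / L| = `|t - c| / L.
Proof. by rewrite normrM normfV (gtr0_norm L0). Qed.

Lemma sbump_eq0 t : L <= `|t - c| -> sbump t = 0.
Proof. by move=> h; rewrite /sbump hump_eq0// scaled ler_pdivlMr// mul1r. Qed.

Lemma dsbump_eq0 t : L <= `|t - c| -> dsbump t = 0.
Proof. by move=> h; rewrite /dsbump dhump_eq0 ?mul0r// scaled ler_pdivlMr// mul1r. Qed.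

Lemma sbump_ge0 t : 0 <= sbump t. Proof. exact: hump_ge0. Qed.

Lemma sbump_le1 t : sbump t <= 1. Proof. exact: hump_le1. Qed.

Lemma sbump_ge t : `|t - c| <= L / 2 -> 2^-1 <= sbump t.
Proof. by move=> h; apply: hump_ge; rewrite scaled ler_pdivrMr// mulrC. Qed.

Lemma dsbump_le t : `|dsbump t| <= 4 / L.
Proof.
by rewrite /dsbump normrM normfV (gtr0_norm L0) ler_pM2r ?invr_gt0// dhump_le.
Qed.

End scaled_bump.

(* The hypothesis on [w] and [x] says that the measure [w dt] is pushed forward
   by [x] to the Lebesgue measure; long bumps in the variable [x] then make the
   derivative term negligible. *)
Lemma profile (w x : R -> R) (p a C1 : R) :
  measurable_fun [set: R] w -> measurable_fun [set: R] x ->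
  (forall t, 0 <= w t) ->
  (forall a b, a < b -> (\int[mu]_t (\1_`[a, b] (x t) * w t)%:E = (b - a)%:E)%E) ->
  1 < p -> `|a| `^ p < C1 ->
  exists2 L0, 0 < L0 & forall L c, L0 <= L -> exists2 j, 0 < j &
    (\int[mu]_t (sbump c L (x t) `^ p * w t)%:E = j%:E)%E /\
    (\int[mu]_t (`|dsbump c L (x t) + a * sbump c L (x t)| `^ p * w t)%:E <=
      (C1 * j)%:E)%E.
Proof.
move=> mw mx w0 wx p1 aC; have p0 : 0 < p := lt_trans ltr01 p1.
(* A constant between |a|^p and C1 that is positive even when a = 0, as [powRD_split] requires. *)
pose C' := (`|a| `^ p + C1) / 2.
have a0 : 0 <= `|a| `^ p by exact: powR_ge0.
have C'0 : 0 < C' by rewrite /C'; lra.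
have C'C : C' < C1 by rewrite /C'; lra.
have aC' : `|a| `^ p <= C' by rewrite /C'; lra.
have [l l0 [lC [D D0 split]]] := powRD_split p1 C'0 C'C.
(* If (4 / L)^p <= d, the error D (4 / L)^p 2 L is at most (C1 - l C') 2^(-p) L, and 2^(-p) L is a
   lower bound for the main integral. *)
pose d := (C1 - l * C') * 2^-1 `^ p / (2 * D).
have h2 : 0 < (2^-1 : R) by rewrite invr_gt0.
have d0 : 0 < d by rewrite divr_gt0 ?mulr_gt0 ?powR_gt0// subr_gt0.
exists (4 / d `^ p^-1); first by rewrite divr_gt0 ?powR_gt0.
move=> L c L0L.
have L0 : 0 < L by apply: lt_le_trans L0L; rewrite divr_gt0 ?powR_gt0.
have L4 : 0 <= 4 / L by rewrite divr_ge0// ltW.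
have Ld : (4 / L) `^ p <= d.
  have E : d = (d `^ p^-1) `^ p by rewrite -powRrM mulVf ?gt_eqF// powRr1// ltW.
  rewrite [leRHS]E.
  apply: ge0_ler_powR; rewrite ?nnegrE ?powR_ge0 ?(ltW p0) ?L4//.
  by rewrite ler_pdivrMr// mulrC -ler_pdivrMr ?powR_gt0.
have mi (u v : R) : measurable_fun [set: R] (fun t => \1_`[u, v] (x t) * w t).
  apply: measurable_funM => //.
  have h : measurable_fun [set: R] (\1_`[u, v] : R -> R).
    exact: measurable_indic.
  exact: (measurableT_comp h mx).
have mb : measurable_fun [set: R] (fun t => sbump c L (x t) `^ p * w t).
  apply: measurable_funM => //; apply: (measurableT_comp (measurable_powR p)).
  exact: (measurableT_comp (continuous_measurable_fun (@continuous_sbump c L)) mx).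
have md : measurable_fun [set: R] (fun t => `|dsbump c L (x t) + a * sbump c L (x t)| `^ p * w t).
  apply: measurable_funM => //; apply: (measurableT_comp (measurable_powR p)).
  apply: measurableT_comp => //; apply: measurable_funD.
    exact: (measurableT_comp (continuous_measurable_fun (@continuous_dsbump c L)) mx).
  apply: measurable_funM => //.
  exact: (measurableT_comp (continuous_measurable_fun (@continuous_sbump c L)) mx).
have out t : ~~ (t \in `[c - L, c + L]) -> L <= `|t - c|.
  rewrite in_itv /= negb_and -!ltNge => /orP[h|h].
    by rewrite distrC ler_normr; apply/orP; left; lra.
  by rewrite ler_normr; apply/orP; left; lra.
have bI t : sbump c L t `^ p <= \1_`[c - L, c + L] t.
  rewrite indicE; have [ti|ti] := boolP (t \in `[c - L, c + L]); last first.
    by rewrite sbump_eq0 ?out// powR0 ?gt_eqF.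
  rewrite mem_set//=; have : sbump c L t `^ p <= 1 `^ p.
    by apply: ge0_ler_powR; rewrite ?nnegrE ?(ltW p0) ?sbump_ge0 ?sbump_le1.
  by rewrite powR1.
have bge t : 2^-1 `^ p * \1_`[c - L / 2, c + L / 2] t <= sbump c L t `^ p.
  rewrite indicE; have [ti|ti] := boolP (t \in `[c - L / 2, c + L / 2]); last first.
    by rewrite memNset ?mulr0 ?powR_ge0//; exact/negP.
  rewrite mem_set// mulr1; apply: ge0_ler_powR; rewrite ?nnegrE ?(ltW p0) ?sbump_ge0 ?(ltW h2)//.
  apply: sbump_ge => //; move: ti; rewrite in_itv /= => /andP[t1 t2].
  by rewrite ler_norml; apply/andP; split; lra.
have dI t : `|dsbump c L t| `^ p <= (4 / L) `^ p * \1_`[c - L, c + L] t.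
  rewrite indicE; have [ti|ti] := boolP (t \in `[c - L, c + L]); last first.
    by rewrite dsbump_eq0 ?out// normr0 powR0 ?gt_eqF// mulr_ge0 ?powR_ge0.
  rewrite mem_set// mulr1; apply: ge0_ler_powR; rewrite ?nnegrE ?(ltW p0) ?normr_ge0 ?dsbump_le ?L4//.
have pw t : `|dsbump c L t + a * sbump c L t| `^ p <=
    l * C' * sbump c L t `^ p + D * (4 / L) `^ p * \1_`[c - L, c + L] t.
  move: (sbump_ge0 c L t) (dI t); move: (sbump c L t) (dsbump c L t) => B Db B0 DbI.
  apply: (@le_trans _ _ ((`|a| * B + `|Db|) `^ p)).
    apply: ge0_ler_powR; rewrite ?nnegrE ?(ltW p0) ?addr_ge0 ?mulr_ge0//.
    by rewrite addrC (le_trans (ler_normD _ _))// normrM (ger0_norm B0).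
  apply: (le_trans (split _ _ _ _)); rewrite ?mulr_ge0// powRM//.
  apply: lerD; last by rewrite -mulrA ler_wpM2l// ltW.
  by rewrite mulrA ler_wpM2r ?powR_ge0// ler_wpM2l// ltW.
set J := (\int[mu]_t (sbump c L (x t) `^ p * w t)%:E)%E.
have J0 t : (0 <= (sbump c L (x t) `^ p * w t)%:E)%E by rewrite lee_fin mulr_ge0 ?powR_ge0.
have I0 (u v t : R) : (0 <= (\1_`[u, v] (x t) * w t)%:E)%E by rewrite lee_fin mulr_ge0.
have cL (e : R) : 0 < e -> c - e < c + e by move=> ?; lra.
have Jlt : (J <= (2 * L)%:E)%E.
  rewrite (_ : 2 * L = (c + L) - (c - L)); last by ring.
  rewrite -wx ?cL//; apply: ge0_le_integral => //.
  - (apply/measurable_EFinP; first [exact: mb|exact: mi|exact: md]).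
  - (apply/measurable_EFinP; first [exact: mb|exact: mi|exact: md]).
  - by move=> t _; rewrite lee_fin ler_wpM2r.
have Jgt : ((2^-1 `^ p * L)%:E <= J)%E.
  rewrite EFinM (_ : L%:E = ((c + L / 2) - (c - L / 2))%:E); last by congr EFin; field.
  rewrite -wx ?cL ?divr_gt0// -ge0_integralZl_EFin ?powR_ge0//; last (apply/measurable_EFinP; first [exact: mb|exact: mi|exact: md]).
  apply: ge0_le_integral => //.
  - by move=> t _; rewrite mule_ge0// lee_fin powR_ge0.
  - by apply: measurable_funeM; (apply/measurable_EFinP; first [exact: mb|exact: mi|exact: md]).
  - (apply/measurable_EFinP; first [exact: mb|exact: mi|exact: md]).
  - by move=> t _; rewrite -EFinM lee_fin mulrA ler_wpM2r.
have Jfin : J \is a fin_num.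
  by rewrite ge0_fin_numE ?integral_ge0// (le_lt_trans Jlt) ?ltry.
have jE : J = (fine J)%:E by rewrite fineK.
move: Jlt Jgt; rewrite jE !lee_fin => Jlt Jgt.
exists (fine J); first by apply: lt_le_trans Jgt; rewrite mulr_gt0 ?powR_gt0.
split => //.
apply: (@le_trans _ _ (\int[mu]_t ((l * C')%:E * (sbump c L (x t) `^ p * w t)%:E +
    (D * (4 / L) `^ p)%:E * (\1_`[c - L, c + L] (x t) * w t)%:E))%E).
  apply: ge0_le_integral => //.
  - by move=> t _; rewrite lee_fin mulr_ge0 ?powR_ge0.
  - (apply/measurable_EFinP; first [exact: mb|exact: mi|exact: md]).
  - apply: emeasurable_funD; apply: measurable_funeM; (apply/measurable_EFinP; first [exact: mb|exact: mi|exact: md]).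
  - move=> t _; move: (pw (x t)) (w0 t).
    move: (`|_ + _| `^ p) (sbump c L (x t) `^ p) (\1_`[c - L, c + L] (x t)) (w t).
    move=> A B I W h W0; rewrite -!EFinM -EFinD lee_fin.
    by rewrite [leRHS](_ : _ = (l * C' * B + D * (4 / L) `^ p * I) * W);
      [exact: ler_wpM2r|ring].
have lC0 : 0 <= l * C' by rewrite mulr_ge0 ?(ltW l0) ?(ltW C'0).
have DL0 : 0 <= D * (4 / L) `^ p by rewrite mulr_ge0 ?powR_ge0 ?(ltW D0).
rewrite ge0_integralD//; first last.
- by apply: measurable_funeM; (apply/measurable_EFinP; first [exact: mb|exact: mi|exact: md]).
- by move=> t _; rewrite mule_ge0.
- by apply: measurable_funeM; (apply/measurable_EFinP; first [exact: mb|exact: mi|exact: md]).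
- by move=> t _; rewrite mule_ge0.
rewrite !ge0_integralZl_EFin//; last 2 first.
- (apply/measurable_EFinP; first [exact: mb|exact: mi|exact: md]).
- (apply/measurable_EFinP; first [exact: mb|exact: mi|exact: md]).
rewrite -/J jE wx ?cL// -!EFinM -EFinD lee_fin.
have E : D * d * (c + L - (c - L)) = (C1 - l * C') * (2^-1 `^ p * L).
  by rewrite /d; field; rewrite gt_eqF.
have F1 : D * (4 / L) `^ p * (c + L - (c - L)) <= (C1 - l * C') * (2^-1 `^ p * L).
  rewrite -E ler_wpM2r//; first by rewrite subr_ge0 ltW// cL.
  by rewrite ler_wpM2l// ltW.
have F2 : (C1 - l * C') * (2^-1 `^ p * L) <= (C1 - l * C') * fine J.
  by rewrite ler_wpM2l// subr_ge0 ltW.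
lra.
Qed.

End profile.

Section comp_ln.
Variables (R : realType) (phi dphi : R -> R) (A : R).
Hypotheses (phiE : forall t : R, is_derive t (1 : R) phi (dphi t))
  (cdphi : continuous dphi)
  (phiA : forall t, t <= A -> phi t = 0) (dphiA : forall t, t <= A -> dphi t = 0)
  (phi0 : phi 0 = 0) (dphi0 : dphi 0 = 0).

Let lnA (y : R) : y < expR A -> y <= 0 \/ ln y <= A.
Proof.
move=> yA; have [y0|y0] := leP y 0; first by left.
by right; rewrite -[leRHS]expRK ler_ln ?posrE ?expR_gt0// ltW.
Qed.

(* The derivative is written with [ln q = 0] and [q^-1] for [q <= 0]; there it
   vanishes since [dphi 0 = 0]. *)
Lemma is_derive_comp_ln (q : R) :
  is_derive q (1 : R) (fun q => phi (ln q)) (dphi (ln q) / q).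
Proof.
have [q0|q0] := leP q 0; last first.
  exact: (is_derive1_comp (phiE (ln q)) (is_derive1_ln q0)).
have H : is_derive q (1 : R) (cst (0 : R)) (dphi (ln q) / q).
  by apply: (is_derive_eq (is_derive_cst _ _ _)); rewrite ln0// dphi0 mul0r.
apply: near_eq_is_derive H; near=> y.
have /lnA[y0|yA] : y < expR A.
  by near: y; apply: lt_nbhsl; exact: le_lt_trans (expR_gt0 A).
- by rewrite ln0.
- by rewrite phiA.
Unshelve. all: end_near. Qed.

Lemma continuous_deriv_comp_ln : continuous (fun q => dphi (ln q) / q).
Proof.
move=> q; have [q0|q0] := leP q 0; last first.
  apply: cvgM; last by apply: cvgV; [rewrite gt_eqF|exact: cvg_id].
  have cl : {for q, continuous (@ln R)} := continuous_ln q0.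
  have cd : {for ln q, continuous dphi} by exact: cdphi.
  exact: (continuous_comp cl cd).
rewrite /continuous_at ln0// dphi0 mul0r.
apply/cvgr0Pnorm_lt => e e0; near=> y.
have /lnA[y0|yA] : y < expR A.
  by near: y; apply: lt_nbhsl; exact: le_lt_trans (expR_gt0 A).
- by rewrite ln0// dphi0 mul0r normr0.
- by rewrite dphiA// mul0r normr0.
Unshelve. all: end_near. Qed.

End comp_ln.

Section near_optimal.
Variable R : realType.
Let mu := @lebesgue_measure R.

(* The variable is [t = ln |z|]. The support of [f] can be pushed to [t <= T] for
   every [T], i.e. towards the singular set, where lower order terms vanish. *)
Definition near_optimal (p C1 : R) (v0 v1 : R -> R) : Prop :=
  forall T : R, exists f df : R -> R, exists A B j : R,
  [/\ A < B, B < 0 & B <= T] /\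
  [/\ forall t : R, is_derive t (1 : R) f (df t), continuous df,
      forall t, t <= A -> f t = 0 /\ df t = 0 &
      forall t, B <= t -> f t = 0 /\ df t = 0] /\
  [/\ 0 < j, (\int[mu]_t (`|f t| `^ p * v0 t)%:E = j%:E)%E &
      (\int[mu]_t (`|df t| `^ p * v1 t)%:E <= (C1 * j)%:E)%E].

Definition ebump (a c L t : R) : R := expR (a * t) * sbump c L t.
(** Derivative of [ebump], with the exponential factored out to expose the integrand of
    [profile]. *)
Definition debump (a c L t : R) : R := expR (a * t) * (dsbump c L t + a * sbump c L t).

Lemma is_derive_expZ (a t : R) : is_derive t (1 : R) (fun t => expR (a * t)) (a * expR (a * t)).
Proof.
have h1 := is_deriveZ a (is_derive_id t (1 : R)).
have h2 := is_derive1_comp (is_derive_expR (a * t)) h1.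
by apply: (is_derive_eq h2); rewrite /GRing.scale /= mulr1 mulrC.
Qed.

Lemma is_derive_ebump (a c L t : R) : 0 < L ->
  is_derive t (1 : R) (ebump a c L) (debump a c L t).
Proof.
move=> L0; have H := is_deriveM (is_derive_expZ a t) (is_derive_sbump c L t).
by apply: (is_derive_eq H); rewrite /debump /GRing.scale /=; ring.
Qed.

Lemma continuous_debump (a c L : R) : continuous (debump a c L).
Proof.
move=> t.
have ce : {for t, continuous (fun t : R => expR (a * t))}.
  have H := is_derive_expZ a t.
  by apply: differentiable_continuous; apply/derivable1_diffP; apply: ex_derive.
apply: cvgM; first exact: ce.
apply: cvgD; first exact: continuous_dsbump.
by apply: cvgM; [exact: cvg_cst|exact: continuous_sbump].
Qed.

Lemma ebump_eq0 (a c L t : R) : 0 < L -> L <= `|t - c| ->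
  ebump a c L t = 0 /\ debump a c L t = 0.
Proof.
move=> L0 h; rewrite /ebump /debump sbump_eq0// dsbump_eq0//.
by rewrite !mulr0 addr0 mulr0.
Qed.

(** With a = -b / p the factor |e^(a t)|^p cancels the weight e^(b t), leaving exactly the integrals
    of [profile] for Lebesgue measure; |a|^p is the constant to be approached. *)
Lemma near_optimal_exp (p b C1 : R) : 1 < p -> (`|b| / p) `^ p < C1 ->
  near_optimal p C1 (fun t => expR (b * t)) (fun t => expR (b * t)).
Proof.
move=> p1 bC T; have p0 : 0 < p := lt_trans ltr01 p1.
have push (u v : R) : u < v -> (\int[mu]_t (\1_`[u, v] t * 1)%:E = (v - u)%:E)%E.
  move=> uv; under eq_integral do rewrite mulr1.
  by rewrite integral_indic// setIT [LHS]lebesgue_measure_itv/= lte_fin uv.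
have aC : `|- (b / p)| `^ p < C1 by rewrite normrN normrM normfV (gtr0_norm p0).
have [L0 L00 prof] := @profile R (fun=> 1) id p (- (b / p)) C1 (measurable_cst _)
  (@measurable_id _ _ _) (fun=> ler01) push p1 aC.
(* This centre puts the right end -|T| - 1 of the support below T and below 0. *)
have [j j0 [Ej Dj]] := prof L0 (- L0 - `|T| - 1) (lexx _).
set c := - L0 - `|T| - 1 in Ej Dj.
have e1 t : (expR (- (b / p) * t)) `^ p * expR (b * t) = 1.
  rewrite -expRM -expRD (_ : _ + _ = 0) ?expR0//.
  by field; rewrite gt_eqF.
exists (ebump (- (b / p)) c L0), (debump (- (b / p)) c L0), (c - L0), (c + L0), j.
split; [split|split; [split|split]] => //.
- by lra.
- by rewrite /c; have := normr_ge0 T; lra.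
- by rewrite /c; have := ler_norm (- T); rewrite normrN; lra.
- by move=> t; exact: is_derive_ebump.
- exact: continuous_debump.
- by move=> t tA; apply: ebump_eq0 => //; rewrite distrC ler_normr; apply/orP; left; lra.
- by move=> t tA; apply: ebump_eq0 => //; rewrite ler_normr; apply/orP; left; lra.
- rewrite -Ej; apply: eq_integral => t _; congr EFin.
  rewrite mulr1 /ebump normrM (ger0_norm (expR_ge0 _)) (ger0_norm (sbump_ge0 _ _ _)).
  by rewrite powRM ?expR_ge0 ?sbump_ge0// mulrAC e1 mul1r.
- apply: le_trans Dj; rewrite le_eqVlt; apply/orP; left; apply/eqP.
  apply: eq_integral => t _; congr EFin.
  rewrite mulr1 /debump normrM (ger0_norm (expR_ge0 _)).
  by rewrite powRM ?expR_ge0// mulrAC e1 mul1r.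
Qed.

End near_optimal.

Section near_optimal_log.
Variable R : realType.
Let mu := @lebesgue_measure R.

(** The substitution x = ln (S - t), as [profile] needs it. The weight is cut off at t >= S because
    [ln] takes its default value 0 there, which may lie in [u, v]. *)
Lemma integral_push_ln (S u v : R) : u < v ->
  (\int[mu]_t (\1_`[u, v] (ln (S - t)) * (if (t < S)%R then (S - t)^-1 else 0))%:E
   = (v - u)%:E)%E.
Proof.
move=> uv; pose a := S - expR v; pose b := S - expR u.
have ab : a < b by rewrite ltrD2l ltrN2 ltr_expR.
have bS : b < S by rewrite gtrBl expR_gt0.
have E t : \1_`[u, v] (ln (S - t)) * (if t < S then (S - t)^-1 else 0) =
    (S - t)^-1 * \1_`[a, b] t.
  have [tS|St] := ltP t S; last first.
    rewrite mulr0 [\1__ t]indicE memNset ?mulr0//= in_itv /= => /andP[_ tb].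
    by have := lt_le_trans bS St; rewrite ltNge tb.
  rewrite mulrC !indicE; congr (_ * (nat_of_bool _)%:R).
  have st : 0 < S - t by rewrite subr_gt0.
  have l1 : (u <= ln (S - t)) = (expR u <= S - t) by rewrite -ler_expR lnK.
  have l2 : (ln (S - t) <= v) = (S - t <= expR v) by rewrite -ler_expR lnK.
  apply/idP/idP; rewrite !inE /= !in_itv /= l1 l2 /a /b => /andP[h1 h2];
    by apply/andP; split; lra.
under eq_integral do rewrite E.
transitivity (\int[mu]_(t in `[a, b]) ((S - t)^-1)%:E)%E.
  rewrite [RHS]integral_mkcond; apply: eq_integral => t _.
  rewrite patchE indicE; case: ifP => _; first by rewrite mulr1.
  by rewrite mulr0.
have pos t : t \in `[a, b] -> 0 < S - t.
  by rewrite in_itv /= subr_gt0 => /andP[_ tb]; exact: le_lt_trans bS.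
rewrite (@integral_derivative_itv R (fun t => (S - t)^-1) (fun t => - ln (S - t)))//.
- have Sa : S - a = expR v by rewrite /a; ring.
  have Sb : S - b = expR u by rewrite /b; ring.
  by rewrite Sa Sb !expRK; congr EFin; ring.
- move=> t /pos st; apply: cvgV; first by rewrite gt_eqF.
  by apply: cvgB; [exact: cvg_cst|exact: cvg_id].
- move=> t /pos st.
  have h1 : is_derive t (1 : R) (fun t : R => S - t) (-1).
    have := is_deriveB (is_derive_cst S t (1 : R)) (is_derive_id t (1 : R)).
    by rewrite sub0r.
  have h2 := @is_derive1_comp R (@ln R) (fun t => S - t) t _ _ (is_derive1_ln st) h1.
  have h3 := is_deriveN h2.
  by apply: (is_derive_eq h3); rewrite mulrN1 opprK.
Qed.

(** In the variable x = ln (S - t) the extremal (S - t)^al is e^(al x), and al = -(beta + 1) / p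
    turns its p-th power times (S - t)^beta into 1 / (S - t), that is Lebesgue measure in x. Going
    to t = -oo means moving the bump to x = +oo. *)
Lemma near_optimal_log (p beta S C1 : R) : 1 < p -> beta < -1 ->
  (`|beta + 1| / p) `^ p < C1 ->
  near_optimal p C1 (fun t => (S - t) `^ beta) (fun t => (S - t) `^ (p + beta)).
Proof.
move=> p1 b1 bC T; have p0 : 0 < p := lt_trans ltr01 p1.
pose al := - (beta + 1) / p.
have aC : `|al| `^ p < C1 by rewrite /al normrM normfV normrN (gtr0_norm p0).
pose w t : R := if t < S then (S - t)^-1 else 0.
have mS : measurable_fun [set: R] (fun t : R => S - t).
  apply: continuous_measurable_fun => s.
  by apply: cvgB; [exact: cvg_cst|exact: cvg_id].
have mw : measurable_fun [set: R] w.
  have -> : w = fun t => if t < S then (S - t) `^ (-1) else 0.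
    apply/funext => t; rewrite /w; case: ifPn => // tS.
    by rewrite powR_inv1// subr_ge0 ltW.
  apply: measurable_fun_ifT => //.
    by apply: measurable_fun_ltr => //; exact: measurable_cst.
  exact: (measurableT_comp (measurable_powR (-1))).
have mx : measurable_fun [set: R] (fun t => ln (S - t)).
  exact: (measurableT_comp (@measurable_ln R)).
have w0 t : 0 <= w t.
  by rewrite /w; case: ifPn => // tS; rewrite invr_ge0 subr_ge0 ltW.
have [L L0 prof] := @profile R w (fun t => ln (S - t)) p al C1 mw mx w0
  (fun u v uv => integral_push_ln S uv) p1 aC.
(* Taking c - L = |S| + |T| + 1 forces t <= T and t < 0 on the support, and makes the bump vanish at
   x = 0, the default value of [ln] for t >= S. *)
pose c := L + (`|S| + `|T| + 1).
have [j j0 [Ej Dj]] := prof L c (lexx _).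
have c0 : L <= `|0 - c|.
  rewrite sub0r normrN ler_normr; apply/orP; left.
  by rewrite /c; have := normr_ge0 S; have := normr_ge0 T; lra.
have z0 : ebump al c L 0 = 0 /\ debump al c L 0 = 0 by exact: ebump_eq0.
have outl t : t <= c - L -> ebump al c L t = 0 /\ debump al c L t = 0.
  by move=> h; apply: ebump_eq0 => //; rewrite distrC ler_normr; apply/orP; left; lra.
have outr t : c + L <= t -> ebump al c L t = 0 /\ debump al c L t = 0.
  by move=> h; apply: ebump_eq0 => //; rewrite ler_normr; apply/orP; left; lra.
pose f t := ebump al c L (ln (S - t)).
pose df t := - (debump al c L (ln (S - t)) / (S - t)).
have dS (t : R) : is_derive t (1 : R) (fun t : R => S - t) (-1).
  have := is_deriveB (is_derive_cst S t (1 : R)) (is_derive_id t (1 : R)).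
  by rewrite sub0r.
have Bd : S - expR (c - L) <= T /\ S - expR (c - L) < 0.
  have := expR_ge1Dx (c - L); rewrite /c; have := ler_norm S.
  have := ler_norm (- T); rewrite normrN; have := normr_ge0 T; have := normr_ge0 S.
  by split; lra.
have AB : S - expR (c + L) < S - expR (c - L).
  by rewrite ltrD2l ltrN2 ltr_expR; lra.
exists f, df, (S - expR (c + L)), (S - expR (c - L)), j.
split; first by split=> //; [exact: Bd.2|exact: Bd.1].
split; first split.
- move=> t.
  have h := @is_derive_comp_ln R _ _ (c - L) (fun t => is_derive_ebump al c t L0)
    (fun t h => (outl t h).1) z0.1 z0.2 (S - t).
  have h2 := @is_derive1_comp R (fun q => ebump al c L (ln q)) (fun t => S - t) t _ _ h (dS t).
  by apply: (is_derive_eq h2); rewrite mulrN1.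
- move=> t; apply: cvgN.
  have h := @continuous_deriv_comp_ln R _ (c - L) (@continuous_debump R al c L)
    (fun t h => (outl t h).2) z0.2.
  have hc : {for t, continuous (fun t : R => S - t)}.
    by apply: cvgB; [exact: cvg_cst|exact: cvg_id].
  have hq : {for S - t, continuous (fun q => debump al c L (ln q) / q)} by exact: h.
  exact: (continuous_comp hc hq).
- move=> t tA; suff [h1 h2] : ebump al c L (ln (S - t)) = 0 /\ debump al c L (ln (S - t)) = 0.
    by rewrite /f /df h1 h2 mul0r oppr0.
  apply: outr; have h : expR (c + L) <= S - t by lra.
  by rewrite -ler_expR lnK// posrE (lt_le_trans _ h)// expR_gt0.
- move=> t tB; suff [h1 h2] : ebump al c L (ln (S - t)) = 0 /\ debump al c L (ln (S - t)) = 0.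
    by rewrite /f /df h1 h2 mul0r oppr0.
  have [St|tS] := leP S t; first by rewrite ln0// subr_le0.
  apply: outl; have h : S - t <= expR (c - L) by lra.
  by rewrite -ler_expR lnK// posrE subr_gt0.
have key t (X : R) : t < S -> 0 <= X ->
    (expR (al * ln (S - t)) * X) `^ p * (S - t) `^ beta = X `^ p * (S - t)^-1.
  move=> tS X0; have st : 0 < S - t by rewrite subr_gt0.
  rewrite powRM ?expR_ge0// mulrAC mulrC; congr (_ * _).
  rewrite -expRM [(S - t) `^ beta]/powR gt_eqF// -expRD.
  rewrite -[in RHS](lnK st) -expRN; congr expR.
  by rewrite /al; field; rewrite gt_eqF.
split => //.
- rewrite -Ej; apply: eq_integral => t _; congr EFin.
  rewrite /w /f; case: ifPn => tS.
    rewrite /ebump normrM (ger0_norm (expR_ge0 _)) (ger0_norm (sbump_ge0 _ _ _)).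
    by rewrite key// sbump_ge0.
  by rewrite ln0 ?subr_le0 1?leNgt// z0.1 normr0 powR0 ?gt_eqF// mul0r mulr0.
- apply: le_trans Dj; rewrite le_eqVlt; apply/orP; left; apply/eqP.
  apply: eq_integral => t _; congr EFin.
  rewrite /w /df normrN; case: ifPn => tS; last first.
    by rewrite ln0 ?subr_le0 1?leNgt// z0.2 mul0r normr0 powR0 ?gt_eqF// mul0r mulr0.
  have st : 0 < S - t by rewrite subr_gt0.
  rewrite normrM normfV (gtr0_norm st) powRD ?(gt_eqF st) ?implybT//.
  rewrite mulrA -powRM; [|by rewrite divr_ge0// ltW|exact: ltW].
  rewrite divfK ?gt_eqF//.
  by rewrite /debump normrM (ger0_norm (expR_ge0 _)) key.
Qed.

End near_optimal_log.

(** * Radial test functions and sharpness *)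

(** Balls for the matrix norm are cubes, so the volume is a product of side lengths. *)
Lemma lebN_ball (R : realType) (N : nat) (c : 'rV[R]_N) (e : R) : 0 < e ->
  lebN (fun v => (\1_(ball c e) v)%:E) = ((2 * e) ^+ N)%:E.
Proof.
move=> e0; elim: N c => [|N IH] c.
  by rewrite expr0 /= indicE mem_set//; split => // i [].
pose c' : 'rV[R]_N := \row_j c ord0 (lift ord0 j).
have E t v : (\1_(ball c e) (rcons0 t v) : R) = \1_(ball (c ord0 ord0) e) t * \1_(ball c' e) v.
  rewrite !indicE -natrM mulnb; congr (nat_of_bool _)%:R; apply/idP/andP.
    rewrite !inE => -[_ h]; split; first by have := h ord0 ord0; rewrite rcons0E.
    by split => // i j; have := h ord0 (lift ord0 j); rewrite rcons0E !ord1 mxE.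
  rewrite !inE => -[h1 [_ h2]]; split => // i j; rewrite ord1.
  case: (unliftP ord0 j) => [j' ->|->]; rewrite rcons0E//.
  by have := h2 ord0 j'; rewrite mxE.
rewrite lebNS (_ : (fun t => _) = (fun t => ((2 * e) ^+ N)%:E * (\1_(ball (c ord0 ord0) e) t)%:E)%E); last first.
  apply/funext => t; rewrite -(IH c') muleC -lebNZl//.
  - by apply: eq_lebN => v; rewrite E EFinM.
  - by apply/measurable_EFinP; apply: measurable_indic; exact: measurable_row_ball.
have mb : measurable_fun [set: R] (fun t : R => (\1_(ball (c ord0 ord0) e) t : R)%:E).
    by apply/measurable_EFinP; apply: measurable_indic; exact: measurable_ball.
have e2 : 0 <= (2 * e) ^+ N by rewrite exprn_ge0// mulr_ge0// ltW.
rewrite ge0_integralZl_EFin//.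
rewrite integral_indic//; last exact: measurable_ball.
rewrite setIT [X in (_ * X)%E](_ : _ = (2 * e)%:E); last first.
  by rewrite [LHS]lebesgue_measure_ball ?ltW// mulr_natl.
by rewrite -EFinM exprSr.
Qed.

Section radial.
Variables (R : realType) (n k m : nat).
Hypotheses (m0 : (0 < m)%N) (mn : (m <= n)%N).
Let T := 'rV[R]_(n + k).
Let lam := @lebesgue_measure R.

(* The mass of [H] on a fundamental domain of the dilations of [z]; it replaces the
   integral over the unit sphere of the [z]-space times the remaining variables. *)
Definition angular (H : T -> R) : \bar R :=
  lebN (fun xi => (\1_(@shell R n k m) xi * (expR (- (m%:R * ln (normz m xi))) * H xi))%:E).

Let measurable_angular (H : T -> R) : measurable_fun [set: T] H ->
  measurable_fun [set: T] (fun xi =>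
    (\1_(@shell R n k m) xi * (expR (- (m%:R * ln (normz m xi))) * H xi))%:E).
Proof.
move=> mH; apply/measurable_EFinP; apply: measurable_funM.
  exact: (measurable_indic (@measurable_shell R n k m mn)).
apply: measurable_funM => //; apply: (measurableT_comp (@measurable_expR R)).
apply: measurableT_comp => //; apply: measurable_funM => //.
exact: (measurableT_comp (@measurable_ln R) (measurable_normz mn)).
Qed.

(** In polar form the inner integral has s + ln |z| in place of t; translating s gives the
    one-dimensional integral j and leaves the factor e^(-m ln |z|) collected in [angular]. *)
Lemma lebN_radial (phi : R -> R) (H : T -> R) (j : R) :
  measurable_fun [set: R] phi -> (forall t, 0 <= phi t) ->
  measurable_fun [set: T] H -> (forall x, 0 <= H x) ->
  (forall s x, H (dil m s x) = H x) ->
  (\int[lam]_t (phi t * expR (m%:R * t))%:E = j%:E)%E ->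
  lebN (fun xi => (phi (ln (normz m xi)) * H xi)%:E) = (j%:E * angular H)%E.
Proof.
move=> mphi phi0 mH H0 Hd Ej.
have j0 : 0 <= j.
  rewrite -lee_fin -Ej; apply: integral_ge0 => t _.
  by rewrite lee_fin mulr_ge0 ?expR_ge0.
rewrite (lebN_polar m0 mn); last 2 first.
- apply/measurable_EFinP; apply: measurable_funM => //.
  apply: (measurableT_comp mphi).
  exact: (measurableT_comp (@measurable_ln R) (measurable_normz mn)).
- by move=> x; rewrite lee_fin mulr_ge0.
have mpe : measurable_fun [set: R] (fun t => phi t * expR (m%:R * t)).
  apply: measurable_funM => //; apply: (measurableT_comp (@measurable_expR R)).
  exact: measurable_funM.
rewrite /angular -lebNZl//; [|exact: measurable_angular|]; last first.
  by move=> x; rewrite lee_fin !mulr_ge0 ?expR_ge0.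
apply: eq_lebN => x; rewrite indicE; have [xs|xs] := boolP (x \in _); last first.
  by rewrite mul0r mule0 integral0_eq// => s _; rewrite mul0e.
rewrite mul1r; move: xs; rewrite inE => /andP[x1 _].
have z0 : 0 < normz m x := lt_le_trans ltr01 x1.
set z := normz m x in z0 *.
have := @ge0_integral_affine R 1 (ln z) (fun t => (phi t * expR (m%:R * t))%:E) ltr01.
rewrite Ej mul1e => ->; last 2 first.
- exact/measurable_EFinP.
- by move=> t; rewrite lee_fin mulr_ge0 ?expR_ge0.
have c0 : 0 <= expR (- (m%:R * ln z)) * H x by rewrite mulr_ge0 ?expR_ge0.
rewrite muleC -ge0_integralZl_EFin//; last 2 first.
- by move=> t _; rewrite lee_fin mulr_ge0 ?expR_ge0.
- apply/measurable_EFinP.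
  apply: (measurableT_comp mpe); apply: continuous_measurable_fun => t.
  by apply: cvgD; [apply: cvgM; [exact: cvg_cst|exact: cvg_id]|exact: cvg_cst].
apply: eq_integral => s _; rewrite mul1e -!EFinM; congr EFin.
rewrite Hd normz_dil -/z lnM ?posrE ?expR_gt0// expRK mul1r mulrDr expRD expRN.
by field; rewrite gt_eqF ?expR_gt0.
Qed.

Lemma measurable_normrest : measurable_fun [set: T] (fun xi : T => normrest m xi).
Proof. exact: (continuous_measurable_row (@continuous_normrest R n k m mn)). Qed.

Let sup_norm_lt (x : T) (r : R) : 0 < r -> normz m x < r -> normrest m x < r ->
  ball (0 : T) r x.
Proof.
move=> r0 xz xr; split => // i j; rewrite (ord1 i) /ball /= mxE sub0r normrN.
have [jm|jm] := ltnP j m.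
  apply: le_lt_trans xz; rewrite normzE//.
  exact: (@le_sqrt_sumsq _ _ (fun i => (i < m)%N)).
apply: le_lt_trans xr; rewrite normrestE//.
exact: (@le_sqrt_sumsq _ _ (fun i => (m <= i)%N)).
Qed.

(** On the shell e^(-m ln |z|) <= 1, and the integrand is supported in a cube. *)
Lemma angular_lty (H : T -> R) (r : R) : measurable_fun [set: T] H ->
  (forall x, 0 <= H x <= 1) -> (forall x, r < normrest m x -> H x = 0) ->
  (angular H < +oo)%E.
Proof.
move=> mH H01 Hr.
pose r1 := Num.max (expR 1) (`|r| + 1).
have r10 : 0 < r1 by rewrite lt_max expR_gt0.
apply: (@le_lt_trans _ _ (lebN (fun v : T => (\1_(ball (0 : T) r1) v)%:E))); last first.
  by rewrite lebN_ball// ltry.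
apply: le_lebN; first exact: measurable_angular.
- by apply/measurable_EFinP; apply: measurable_indic; exact: measurable_row_ball.
- by move=> x; have /andP[h _] := H01 x; rewrite lee_fin !mulr_ge0 ?expR_ge0.
move=> x; have /andP[h0 h1] := H01 x; rewrite lee_fin !indicE.
have [xs|xs] := boolP (x \in _); last by rewrite mul0r.
move: xs; rewrite inE => /andP[x1 x2].
have [xr|xr] := ltP r (normrest m x); first by rewrite Hr// !mulr0.
rewrite mem_set; last first.
  apply: sup_norm_lt => //; first by rewrite lt_max x2.
  rewrite lt_max; apply/orP; right; apply: (le_lt_trans xr).
  by apply: (le_lt_trans (ler_norm r)); rewrite ltrDl.
rewrite mul1r mulr_ile1 ?expR_ge0// expR_le1 oppr_le0 mulr_ge0// ln_ge0//.
Qed.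

Lemma angular_gt0 (H : T -> R) (r d : R) : 0 < r -> 0 < d ->
  measurable_fun [set: T] H -> (forall x, 0 <= H x) ->
  (forall x, normrest m x < r -> d <= H x) -> (0 < angular H)%E.
Proof.
move=> r0 d0 mH H0 Hd.
pose U := [set x : T | 1 < normz m x] `&` [set x : T | normz m x < expR 1] `&`
  [set x : T | normrest m x < r].
have oU : open U.
  have cz := @continuous_normz R n k m mn; have cr := @continuous_normrest R n k m mn.
  apply: openI; first apply: openI.
  - by move: cz => /continuousP /(_ _ (@open_gt R 1)).
  - by move: cz => /continuousP /(_ _ (@open_lt R (expR 1))).
  - by move: cr => /continuousP /(_ _ (@open_lt R r)).
have nk : (0 < n + k)%N by rewrite (leq_trans m0)// (leq_trans mn)// leq_addr.
(* The point has |z| = 2, strictly between 1 and e, and vanishing remaining coordinates. *)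
pose i0 := Ordinal nk; pose x0 : T := \row_i (if i == i0 then 2 else 0).
have Ux0 : U x0.
  have zx0 : normz m x0 = 2.
    rewrite normzE// /sumsq (bigD1 i0)//= big1 ?addr0.
      by rewrite mxE eqxx sqrtr_sqr ger0_norm.
    by move=> i /andP[_ ii0]; rewrite mxE (negbTE ii0) expr0n.
  have rx0 : normrest m x0 = 0.
    rewrite normrestE// /sumsq big1 ?sqrtr0// => i mi; rewrite mxE.
    case: eqP => [ii0|]; last by rewrite expr0n.
    by move: mi; rewrite ii0 /= leqNgt m0.
  split; last by rewrite /= rx0.
  split; rewrite /= zx0 ?ltr1n//.
  by have := @expR_gt1Dx R 1 (oner_neq0 _).
have /nbhs_ballP[e /= e0 he] := open_nbhs_nbhs (conj oU Ux0).
(* e^(-m) bounds e^(-m ln |z|) from below on the shell. *)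
pose dd := expR (- m%:R) * d.
have dd0 : 0 < dd by rewrite mulr_gt0 ?expR_gt0.
apply: (@lt_le_trans _ _ (dd%:E * lebN (fun v : T => (\1_(ball x0 e) v)%:E))%E).
  by rewrite lebN_ball// -EFinM lte_fin mulr_gt0// exprn_gt0// mulr_gt0.
have mb : measurable_fun [set: T] (fun v : T => (\1_(ball x0 e) v : R)%:E).
  by apply/measurable_EFinP; apply: measurable_indic; exact: measurable_row_ball.
rewrite -lebNZl//; last exact: ltW.
apply: le_lebN.
- exact: measurable_funeM.
- exact: measurable_angular.
- by move=> x; rewrite mule_ge0// lee_fin ltW.
move=> x; rewrite -EFinM lee_fin [\1_(ball _ _) x]indicE.
have [xb|xb] := boolP (x \in _); last by rewrite mulr0 !mulr_ge0 ?expR_ge0.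
move: xb; rewrite inE => /he [[/= x1 x2] xr].
rewrite mulr1 indicE mem_set ?mul1r; last by rewrite /shell /= (ltW x1).
apply: ler_pM; rewrite ?expR_ge0 ?(ltW d0) ?Hd// ler_expR lerN2.
rewrite -[leRHS]mulr1 ler_wpM2l// -[leRHS]expRK ler_ln ?posrE ?expR_gt0 ?ltW//.
by rewrite (lt_trans ltr01).
Qed.

End radial.

Lemma is_derive_line (R : realType) (N : nat) (u : 'rV[R]_N -> R) (a v : 'rV[R]_N) (df : R) :
  is_derive (0 : R) (1 : R) (fun h : R => u (h *: v + a)) df -> is_derive a v u df.
Proof.
move=> [du <-]; have dv := (derivable1P u a v).2 du.
apply: (DeriveDef dv).
rewrite /derive; set g1 := fun h => _; set g2 := fun h => _.
suff -> : g1 = g2 by [].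
apply/funext => h; rewrite /g1 /g2 /=.
by rewrite addr0 scale0r add0r [_%:A]mulr1.
Qed.

(** * Gradients of separated test functions *)

Section test_function.
Variables (R : realType) (N : nat) (P : pred 'I_N).
Variables (F dF G dG : R -> R).
Hypotheses (FE : forall q : R, is_derive q (1 : R) F (dF q)) (cdF : continuous dF)
  (GE : forall q : R, is_derive q (1 : R) G (dG q)) (cdG : continuous dG).
Let T := 'rV[R]_N.
Let PC := fun i => ~~ P i.

(** Sums of squares in place of norms avoid the failure of differentiability at z = 0 and at rest =
    0. *)
Definition sepfun (x : T) : R := F (sumsq P x) * G (sumsq PC x).

Lemma sumsq_line (Q : pred 'I_N) (x : T) (i : 'I_N) (h : R) :
  sumsq Q (h *: delta_mx ord0 i + x) =
  sumsq Q x + (if Q i then h ^+ 2 + 2 * h * x ord0 i else 0).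
Proof.
rewrite /sumsq; case: ifPn => Qi.
  rewrite (bigD1 i)//= [in RHS](bigD1 i)//= !mxE !eqxx /= mulr1.
  rewrite (eq_bigr (fun j => x ord0 j ^+ 2)); first by ring.
  by move=> j /andP[_ ji]; rewrite !mxE (negbTE ji) andbF mulr0 add0r.
rewrite addr0; apply: eq_bigr => j Qj; rewrite !mxE.
have [ji|ji] := eqVneq j i; first by move: Qi; rewrite -ji Qj.
by rewrite andbF mulr0 add0r.
Qed.

Let is_derive_sumsq_line (Q : pred 'I_N) (x : T) (i : 'I_N) :
  is_derive (0 : R) (1 : R) (fun h : R => sumsq Q (h *: delta_mx ord0 i + x))
    (if Q i then 2 * x ord0 i else 0).
Proof.
under eq_fun do rewrite sumsq_line; case: ifP => _; last first.
  exact: is_derive_cst.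
have h1 := is_deriveD (is_derive_sqr (0 : R)) (is_deriveZ (2 * x ord0 i) (is_derive_id (0 : R) (1 : R))).
have h2 := is_deriveD (is_derive_cst (sumsq Q x) (0 : R) (1 : R)) h1.
have E : (fun h : R => sumsq Q x + (h ^+ 2 + 2 * h * x ord0 i)) =
   cst (sumsq Q x) + ((fun y : R => y ^+ 2) + (2 * x ord0 i) \*: id).
  apply/funext => h; transitivity (sumsq Q x + (h ^+ 2 + (2 * x ord0 i) * h)) => //.
  by ring.
rewrite E; apply: (is_derive_eq h2).
by rewrite /GRing.scale /= mulr0 !add0r mulr1.
Qed.

Lemma pderiv_sepfun (i : 'I_N) (x : T) :
  pderiv sepfun i x = 2 * x ord0 i *
    (if P i then dF (sumsq P x) * G (sumsq PC x) else F (sumsq P x) * dG (sumsq PC x)).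
Proof.
suff h : is_derive x (delta_mx ord0 i : T) sepfun (2 * x ord0 i *
    (if P i then dF (sumsq P x) * G (sumsq PC x) else F (sumsq P x) * dG (sumsq PC x))).
  exact: derive_val.
apply: is_derive_line.
have s0 Q : sumsq Q (0 *: delta_mx ord0 i + x) = sumsq Q x by rewrite scale0r add0r.
have hF : is_derive (0 : R) (1 : R) (fun h : R => F (sumsq P (h *: delta_mx ord0 i + x)))
    (dF (sumsq P x) * (if P i then 2 * x ord0 i else 0)).
  apply: (@is_derive1_comp R F (fun h => sumsq P (h *: delta_mx ord0 i + x)) 0).
    by rewrite s0.
  exact: is_derive_sumsq_line.
have hG : is_derive (0 : R) (1 : R) (fun h : R => G (sumsq PC (h *: delta_mx ord0 i + x)))
    (dG (sumsq PC x) * (if PC i then 2 * x ord0 i else 0)).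
  apply: (@is_derive1_comp R G (fun h => sumsq PC (h *: delta_mx ord0 i + x)) 0).
    by rewrite s0.
  exact: is_derive_sumsq_line.
apply: (is_derive_eq (is_deriveM hF hG)).
rewrite /GRing.scale /= !s0 /PC; case: (P i) => /=; ring.
Qed.

Let contF : continuous F.
Proof.
move=> q; apply: differentiable_continuous; apply/derivable1_diffP.
by have := FE q => h; apply: ex_derive.
Qed.

Let contG : continuous G.
Proof.
move=> q; apply: differentiable_continuous; apply/derivable1_diffP.
by have := GE q => h; apply: ex_derive.
Qed.

Lemma continuous_pderiv_sepfun (i : 'I_N) : continuous (pderiv sepfun i).
Proof.
rewrite (_ : pderiv sepfun i = fun x => 2 * x ord0 i *
    (if P i then dF (sumsq P x) * G (sumsq PC x) else F (sumsq P x) * dG (sumsq PC x))); last first.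
  by apply/funext => x; exact: pderiv_sepfun.
have comp (f : R -> R) (Q : pred 'I_N) : continuous f -> continuous (fun x : T => f (sumsq Q x)).
  move=> cf x; have c1 : {for x, continuous (@sumsq R N Q)} by exact: continuous_sumsq.
  exact: (continuous_comp c1 (cf _)).
have cM (f g : T -> R) : continuous f -> continuous g -> continuous (fun x => f x * g x).
  by move=> cf cg x; exact: (continuousM (cf x) (cg x)).
apply: (cM (fun x => 2 * x ord0 i)).
  by apply: (cM (fun=> 2)); [exact: cst_continuous|exact: coord_continuous].
by case: (P i); apply: (cM (fun x => _ (sumsq P x))); apply: comp;
  [exact: cdF|exact: contG|exact: contF|exact: cdG].
Qed.

Lemma differentiable_sumsq (Q : pred 'I_N) (x : T) : differentiable (@sumsq R N Q) x.
Proof.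
have -> : (@sumsq R N Q) = \sum_(i < N | Q i) (fun x : T => x ord0 i ^+ 2).
  by apply/funext => y; rewrite fct_sumE.
apply: (big_ind (fun f : T -> R => differentiable f x)) => //.
  by move=> f g; exact: differentiableD.
move=> i _.
rewrite (_ : (fun x : T => x ord0 i ^+ 2) = (fun x : T => x ord0 i) * (fun x : T => x ord0 i)).
  by apply: differentiableM; exact: differentiable_coord.
by apply/funext => y; rewrite expr2.
Qed.

Lemma differentiable_sepfun (x : T) : differentiable sepfun x.
Proof.
have dc (f df : R -> R) (Q : pred 'I_N) : (forall q : R, is_derive q (1 : R) f (df q)) ->
    differentiable (fun x : T => f (sumsq Q x)) x.
  move=> fE; apply: (differentiable_comp (g := f)).
    exact: differentiable_sumsq.
  by apply/derivable1_diffP; have := fE (sumsq Q x) => h; exact: ex_derive.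
by apply: differentiableM; [exact: (dc _ _ _ FE)|exact: (dc _ _ _ GE)].
Qed.

Lemma sum_pderiv_sepfun_in (x : T) : \sum_(i | P i) pderiv sepfun i x ^+ 2 =
  (2 * dF (sumsq P x) * G (sumsq PC x)) ^+ 2 * sumsq P x.
Proof.
rewrite [in RHS]/sumsq mulr_sumr; apply: eq_bigr => i Pi.
by rewrite pderiv_sepfun Pi; ring.
Qed.

Lemma sum_pderiv_sepfun_out (x : T) : \sum_(i | PC i) pderiv sepfun i x ^+ 2 =
  (2 * F (sumsq P x) * dG (sumsq PC x)) ^+ 2 * sumsq PC x.
Proof.
rewrite [in RHS]/sumsq mulr_sumr; apply: eq_bigr => i Pi.
by rewrite pderiv_sepfun (negbTE Pi); ring.
Qed.

End test_function.

Section radial_test.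
Variables (R : realType) (n k m : nat) (gamma : R).
Hypotheses (m0 : (0 < m)%N) (mn : (m <= n)%N) (gamma0 : 0 <= gamma).
Let T := 'rV[R]_(n + k).
Variables (f df : R -> R) (A B rho : R).
Hypotheses (fE : forall t : R, is_derive t (1 : R) f (df t)) (cdf : continuous df)
  (fA : forall t, t <= A -> f t = 0 /\ df t = 0)
  (fB : forall t, B <= t -> f t = 0 /\ df t = 0) (B0 : B < 0) (rho0 : 0 < rho).

Let P := fun i : 'I_(n + k) => (i < m)%N.
(** Half the logarithm, since the argument will be |z|^2. *)
Let F (q : R) : R := f (ln q / 2).
Let dF (q : R) : R := df (ln q / 2) / 2 / q.
Let G (q : R) : R := msq (1 - q / rho ^+ 2).
Let dG (q : R) : R := dmsq (1 - q / rho ^+ 2) * - (rho ^+ 2)^-1.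

Let phiE (t : R) : is_derive t (1 : R) (fun t : R => f (t / 2)) (df (t / 2) / 2).
Proof.
have h : is_derive t (1 : R) (fun t : R => t / 2) (2^-1 : R).
  have h2 := is_deriveM (is_derive_id t (1 : R)) (is_derive_cst (2^-1 : R) t (1 : R)).
  by apply: (is_derive_eq h2); rewrite /GRing.scale /= mulr0 add0r mulr1.
exact: (@is_derive1_comp R f (fun t => t / 2) t _ _ (fE _) h).
Qed.

Let cdphi : continuous (fun t : R => df (t / 2) / 2).
Proof.
move=> t; apply: cvgM; last exact: cvg_cst.
have h : {for t, continuous (fun t : R => t / 2)}.
  by apply: cvgM; [exact: cvg_id|exact: cvg_cst].
have h' : {for t / 2, continuous df} by exact: cdf.
exact: (continuous_comp h h').
Qed.

Let phiA (t : R) : t <= 2 * A -> f (t / 2) = 0.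
Proof. by move=> h; rewrite (fA _).1//; lra. Qed.

Let dphiA (t : R) : t <= 2 * A -> df (t / 2) / 2 = 0.
Proof. by move=> h; rewrite (fA _).2 ?mul0r//; lra. Qed.

Let f0 : f 0 = 0. Proof. by rewrite (fB _).1// ltW. Qed.
Let df0 : df 0 = 0. Proof. by rewrite (fB _).2// ltW. Qed.

Let FE (q : R) : is_derive q (1 : R) F (dF q).
Proof. by apply: (is_derive_comp_ln phiE phiA); rewrite mul0r ?f0 ?df0 ?mul0r. Qed.

Let cdF : continuous dF.
Proof. by apply: (continuous_deriv_comp_ln cdphi dphiA); rewrite mul0r df0 mul0r. Qed.

Let GE (q : R) : is_derive q (1 : R) G (dG q).
Proof.
have h : is_derive q (1 : R) (fun q : R => 1 - q / rho ^+ 2) (- (rho ^+ 2)^-1).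
  have h2 := is_deriveM (is_derive_id q (1 : R)) (is_derive_cst ((rho ^+ 2)^-1 : R) q (1 : R)).
  have h3 := is_deriveB (is_derive_cst (1 : R) q (1 : R)) h2.
  by apply: (is_derive_eq h3); rewrite /GRing.scale /= mulr0 !add0r mulr1.
exact: (@is_derive1_comp R (@msq R) (fun q => 1 - q / rho ^+ 2) q _ _ (is_derive_msq _) h).
Qed.

Let cdG : continuous dG.
Proof.
move=> q; apply: cvgM; last exact: cvg_cst.
have h : {for q, continuous (fun q : R => 1 - q / rho ^+ 2)}.
  apply: cvgB; first exact: cvg_cst.
  by apply: cvgM; [exact: cvg_id|exact: cvg_cst].
have h' : {for 1 - q / rho ^+ 2, continuous (@dmsq R)} by exact: continuous_dmsq.
exact: (continuous_comp h h').
Qed.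

Definition rtest : T -> R := sepfun P F G.
Definition Gfun (x : T) : R := msq (1 - normrest m x ^+ 2 / rho ^+ 2).

Let sumsqP (x : T) : sumsq P x = normz m x ^+ 2.
Proof. by rewrite normzE// sqr_sqrtr// sumsq_ge0. Qed.

Let sumsqPC (x : T) : sumsq (fun i => ~~ P i) x = normrest m x ^+ 2.
Proof.
rewrite normrestE// sqr_sqrtr ?sumsq_ge0//; apply: eq_bigl => i.
by rewrite /P -leqNgt.
Qed.

Let lnsq (x : T) : ln (normz m x ^+ 2) / 2 = ln (normz m x).
Proof.
have [->|z0] := eqVneq (normz m x) 0; first by rewrite expr0n /= !ln0// mul0r.
rewrite lnXn; last by rewrite lt_neqAle eq_sym z0 normz_ge0.
by rewrite mulr2n; field.
Qed.

Lemma rtestE (x : T) : rtest x = f (ln (normz m x)) * Gfun x.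
Proof. by rewrite /rtest /sepfun sumsqP sumsqPC /F lnsq. Qed.

Lemma Gfun_eq0 (x : T) : rho <= normrest m x -> Gfun x = 0.
Proof.
move=> h; rewrite /Gfun msq_eq0// subr_le0 ler_pdivlMr ?exprn_gt0// mul1r.
by rewrite ler_sqr ?nnegrE ?sqrtr_ge0 ?(ltW rho0).
Qed.

Lemma Gfun_ge0 (x : T) : 0 <= Gfun x. Proof. exact: msq_ge0. Qed.

Lemma Gfun_le1 (x : T) : Gfun x <= 1.
Proof.
rewrite /Gfun /msq expr_le1 ?le_max ?lexx ?orbT// ge_max ler01 andbT.
by rewrite gerBl divr_ge0 ?sqr_ge0.
Qed.

Lemma Gfun_ge (x : T) : normrest m x < rho / 2 -> 2^-1 <= Gfun x.
Proof.
move=> h; have nr0 : 0 <= normrest m x by exact: sqrtr_ge0.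
set y := normrest m x ^+ 2 / rho ^+ 2.
have y4 : y <= 4^-1.
  rewrite /y ler_pdivrMr ?exprn_gt0// (_ : 4^-1 * rho ^+ 2 = (rho / 2) ^+ 2); last by field.
  by rewrite ler_sqr ?nnegrE ?divr_ge0 ?(ltW rho0)// ltW.
have h34 : 3 / 4 <= 1 - y by lra.
rewrite /Gfun -/y /msq max_l; last by lra.
apply: (@le_trans _ _ ((3 / 4) ^+ 2)); first by lra.
by rewrite ler_sqr ?nnegrE; lra.
Qed.

Lemma Gfun_dil (s : R) (x : T) : Gfun (dil m s x) = Gfun x.
Proof. by rewrite /Gfun normrest_dil. Qed.

Lemma measurable_Gfun : measurable_fun [set: T] Gfun.
Proof.
have cm : continuous (@msq R).
  move=> x; apply: differentiable_continuous; apply/derivable1_diffP.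
  by have := is_derive_msq x => h; apply: ex_derive.
apply: (measurableT_comp (continuous_measurable_fun cm)).
apply: measurable_funB => //; apply: measurable_funM => //.
by apply: measurable_funX; exact: measurable_normrest.
Qed.

Lemma rtest_neq0 (x : T) : rtest x != 0 ->
  [/\ expR A <= normz m x, normz m x <= expR B & normrest m x <= rho].
Proof.
rewrite rtestE mulf_eq0 negb_or => /andP[fx Gx].
have zp : 0 < normz m x.
  rewrite lt_neqAle normz_ge0 andbT eq_sym; apply/eqP => z0.
  by move: fx; rewrite z0 ln0// f0 eqxx.
split.
- rewrite leNgt; apply/negP => h; move: fx; rewrite (fA _).1 ?eqxx//.
  by rewrite -ler_expR lnK ?posrE// ltW.
- rewrite leNgt; apply/negP => h; move: fx; rewrite (fB _).1 ?eqxx//.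
  by rewrite -ler_expR lnK ?posrE// ltW.
- by rewrite leNgt; apply/negP => h; move: Gx; rewrite Gfun_eq0 ?eqxx// ltW.
Qed.

Lemma C10_rtest (Omega : set T) :
  (forall x : T, 0 < normz m x -> normz m x <= expR B -> normrest m x <= rho -> Omega x) ->
  C10 Omega rtest.
Proof.
move=> sub.
pose K := [set x : T | expR A <= normz m x] `&` [set x : T | normz m x <= expR B] `&`
  [set x : T | normrest m x <= rho].
have cK : closed K.
  have cz := @continuous_normz R n k m mn; have cr := @continuous_normrest R n k m mn.
  apply: closedI; first apply: closedI.
  - by move: cz => /continuous_closedP /(_ _ (@closed_ge R (expR A))).
  - by move: cz => /continuous_closedP /(_ _ (@closed_le R (expR B))).
  - by move: cr => /continuous_closedP /(_ _ (@closed_le R rho)).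
have supK : closure [set x | rtest x != 0] `<=` K.
  rewrite (closure_id K).1//; apply: closureS => x /= /rtest_neq0[h1 h2 h3].
  by split.
split; first by move=> x; exact: (differentiable_sepfun _ FE GE).
split; first by move=> i; exact: (continuous_pderiv_sepfun FE cdF GE cdG).
split; last first.
  move=> x /supK [[/= h1 h2] h3]; apply: sub => //.
  exact: lt_le_trans (expR_gt0 _) h1.
apply: (subclosed_compact _ _ supK); first exact: closed_closure.
apply: bounded_closed_compact => //.
exists (expR B + rho); split; first by rewrite num_real.
move=> M hM x [[/= h1 h2] h3].
rewrite /Num.Def.normr /= mx_normrE; apply: bigmax_le => /=.
  by rewrite ltW// (lt_trans _ hM)// addr_gt0// expR_gt0.
move=> [i j] _ /=; rewrite (ord1 i).
have [jm|jm] := ltnP j m.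
  apply: (@le_trans _ _ (normz m x)).
    by rewrite normzE//; exact: (@le_sqrt_sumsq _ _ (fun i => (i < m)%N)).
  by rewrite (le_trans h2)// ltW// (le_lt_trans _ hM)// lerDl ltW.
apply: (@le_trans _ _ (normrest m x)).
  by rewrite normrestE//; exact: (@le_sqrt_sumsq _ _ (fun i => (m <= i)%N)).
by rewrite (le_trans h3)// ltW// (le_lt_trans _ hM)// lerDr expR_ge0.
Qed.

Let sqrt_add (a b : R) : 0 <= a -> 0 <= b ->
  Num.sqrt (a ^+ 2 + b ^+ 2) <= a + b.
Proof.
move=> a0 b0; rewrite -[leRHS]ger0_norm ?addr_ge0// -sqrtr_sqr ler_wsqrtr//.
by rewrite sqrrD -addrA lerD2l lerDr mulrn_wge0// mulr_ge0.
Qed.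

(** The z-gradient has length |f'(ln |z|)| / |z| times the cut-off. In the remaining directions only
    the cut-off is differentiated, with slope at most 4 / rho, and the factor |x|^gamma of the
    y-derivatives is at most (1 + rho)^gamma on the support. The indicator keeps the second factor
    of that part invariant under dilations. *)
Lemma gradG_norm_rtest (x : T) : 0 < normz m x ->
  gradG_norm gamma rtest x <= `|df (ln (normz m x))| / normz m x * Gfun x +
    (1 + rho) `^ gamma * (4 / rho) *
      (`|f (ln (normz m x))| * \1_[set x | normrest m x <= rho] x).
Proof.
move=> zp; set z := normz m x in zp *; set M := (1 + rho) `^ gamma.
have rho1 : 1 <= 1 + rho by rewrite lerDl ltW.
have M0 : 0 <= M by exact: powR_ge0.
(* M >= 1 covers the x-derivatives outside z, which carry no factor |x|^gamma. *)
have M1 : 1 <= M by rewrite -(powRr0 (1 + rho)) /M ler_powR.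
have RHS0 : 0 <= M * (4 / rho) * (`|f (ln z)| * \1_[set x | normrest m x <= rho] x).
  by apply: mulr_ge0; [apply: mulr_ge0 => //; apply: divr_ge0 => //; exact: ltW|exact: mulr_ge0].
have LHS0 : 0 <= `|df (ln z)| / z * Gfun x.
  by apply: mulr_ge0; [apply: divr_ge0 => //; exact: ltW|exact: Gfun_ge0].
have zero : (forall i, pderiv rtest i x = 0) -> gradG_norm gamma rtest x = 0.
  move=> h; rewrite /gradG_norm !big1 ?mulr0 ?addr0 ?sqrtr0// => i _;
  by rewrite h expr0n.
have [xr|xr] := ltP rho (normrest m x).
  rewrite zero; first exact: addr_ge0. move=> i; rewrite (pderiv_sepfun _ FE GE) sumsqPC.
  have yl : 1 - normrest m x ^+ 2 / rho ^+ 2 <= 0.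
    rewrite subr_le0 ler_pdivlMr ?exprn_gt0// mul1r.
    by rewrite ler_sqr ?nnegrE ?sqrtr_ge0 ?(ltW rho0)// ltW.
  by rewrite /G /dG msq_eq0// /dmsq max_r// !(mulr0, mul0r) if_same ?mulr0.
have [z1|z1] := ltP 1 z.
  rewrite zero; first exact: addr_ge0. move=> i; rewrite (pderiv_sepfun _ FE GE) sumsqP /F /dF lnsq.
  have [-> ->] : f (ln z) = 0 /\ df (ln z) = 0.
    by apply: fB; rewrite (le_trans (ltW B0))// ln_ge0// (ltW z1).
  by rewrite !mul0r if_same mulr0.
have nxM : normx x <= 1 + rho.
  apply: (@le_trans _ _ (z + normrest m x)); last exact: lerD.
  apply: le_trans (sqrt_add (normz_ge0 _ _) (sqrtr_ge0 _)).
  rewrite normxE /z -sumsqP -sumsqPC; apply: ler_wsqrtr.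
  rewrite /sumsq [leRHS](_ : _ = \sum_(i < n + k) x ord0 i ^+ 2); last by rewrite [RHS](bigID P).
  by rewrite [leRHS](bigID (fun i : 'I_(n + k) => (i < n)%N))/= lerDl sumr_ge0// => i _; exact: sqr_ge0.
have nxg : (normx x `^ gamma) ^+ 2 <= M ^+ 2.
  rewrite ler_sqr ?nnegrE ?powR_ge0//; apply: ge0_ler_powR => //; rewrite nnegrE ?sqrtr_ge0//.
  exact: le_trans rho1.
have M2 : 1 <= M ^+ 2 by rewrite exprn_ege1.
have Sin : \sum_(i | P i) pderiv rtest i x ^+ 2 = \sum_(i < n | (i < m)%N) pderiv rtest (lshift k i) x ^+ 2.
  rewrite big_split_ord /= [X in _ + X]big_pred0 ?addr0// => j.
  by rewrite /P /= ltnNge (leq_trans mn (leq_addr _ _)).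
have Sout : \sum_(i | ~~ P i) pderiv rtest i x ^+ 2 =
    \sum_(i < n | ~~ (i < m)%N) pderiv rtest (lshift k i) x ^+ 2 +
    \sum_(j < k) pderiv rtest (rshift n j) x ^+ 2.
  rewrite big_split_ord /=; congr (_ + _); apply: eq_bigl => j.
  by rewrite /P /= -leqNgt (leq_trans mn (leq_addr _ _)).
have sq0 (I : finType) (Q : pred I) (h : I -> R) : 0 <= \sum_(i | Q i) h i ^+ 2.
  by apply: sumr_ge0 => i _; exact: sqr_ge0.
have grad2 : \sum_(i < n) pderiv rtest (lshift k i) x ^+ 2 +
    (normx x `^ gamma) ^+ 2 * \sum_(j < k) pderiv rtest (rshift n j) x ^+ 2 <=
    \sum_(i | P i) pderiv rtest i x ^+ 2 + M ^+ 2 * \sum_(i | ~~ P i) pderiv rtest i x ^+ 2.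
  rewrite Sin Sout (bigID (fun i : 'I_n => (i < m)%N)) /= -addrA lerD2l mulrDr.
  by apply: lerD; [rewrite ler_peMl|rewrite ler_wpM2r].
apply: (le_trans (ler_wsqrtr grad2)).
rewrite (sum_pderiv_sepfun_in _ FE GE) (sum_pderiv_sepfun_out _ FE GE) sumsqP sumsqPC.
apply: le_trans (sqrt_add LHS0 RHS0); apply: ler_wsqrtr.
rewrite indicE mem_set// mulr1; apply: lerD.
  rewrite /F /dF lnsq -/z -[G _]/(Gfun x) !exprMn (real_normK (num_real _)).
  by rewrite le_eqVlt; apply/orP; left; apply/eqP; field; rewrite gt_eqF.
rewrite /F lnsq -/z.
set nr := normrest m x in xr *; have nr0 : 0 <= nr by exact: sqrtr_ge0.
have dGle : 2 * (`|dG (nr ^+ 2)| * nr) <= 4 / rho.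
  rewrite /dG /dmsq normrM normrN (ger0_norm (_ : 0 <= (rho ^+ 2)^-1)); last first.
    by rewrite invr_ge0 exprn_ge0// ltW.
  set y := Num.max _ _; have y0 : 0 <= y by rewrite /y le_max lexx orbT.
  have y1 : y <= 1.
    by rewrite /y ge_max ler01 andbT gerBl divr_ge0 ?sqr_ge0.
  rewrite ger0_norm; last by rewrite mulr_ge0.
  rewrite (_ : 2 * _ = 4 / rho * (y * (nr / rho))); last by field; rewrite gt_eqF.
  rewrite ler_piMr ?divr_ge0 ?(ltW rho0)//.
  by rewrite mulr_ile1 ?divr_ge0 ?(ltW rho0)// ler_pdivrMr// mul1r.
rewrite (_ : (2 * f (ln z) * dG (nr ^+ 2)) ^+ 2 = (`|f (ln z)| * (2 * `|dG (nr ^+ 2)|)) ^+ 2); last first.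
  by move: (f _) (dG _) => a b; rewrite !exprMn !(real_normK (num_real _)) [in RHS]mulrCA mulrA.
rewrite -!exprMn ler_sqr ?nnegrE; last 2 first.
- by rewrite !mulr_ge0.
- by apply: mulr_ge0 => //; apply: mulr_ge0 => //; apply: divr_ge0 => //; exact: ltW.
rewrite -mulrA; apply: ler_wpM2l => //.
by rewrite -mulrA [leRHS]mulrC; apply: ler_wpM2l => //; rewrite -mulrA.
Qed.

End radial_test.

(** * Sharpness for weights depending on |z| *)

Section radial_sharp.
Variables (R : realType) (n k m : nat) (gamma : R).
Hypotheses (m0 : (0 < m)%N) (mn : (m <= n)%N) (gamma0 : 0 <= gamma).
Let T := 'rV[R]_(n + k).
Local Notation lam := (@lebesgue_measure R).

Lemma le_lebN_normz (f1 f2 : T -> \bar R) :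
  measurable_fun [set: T] f1 -> measurable_fun [set: T] f2 ->
  (forall x, 0 <= f1 x)%E -> (forall x, 0 <= f2 x)%E ->
  (forall x, (0 < normz m x)%R -> (f1 x <= f2 x)%E) -> (lebN f1 <= lebN f2)%E.
Proof.
move=> mf1 mf2 f10 f20 f12; rewrite -[leLHS]mul1e.
apply: (lebN_ray_le m0 mn) => // x x1; rewrite mul1e; apply: ge0_le_integral => //.
- by move=> s _; rewrite mule_ge0// lee_fin expR_ge0.
- exact: measurable_ray.
- exact: measurable_ray.
- move=> s _; rewrite lee_wpmul2r ?lee_fin ?expR_ge0// f12// normz_dil mulr_gt0 ?expR_gt0//.
  exact: lt_le_trans x1.
Qed.

(** A common frame for both sharpness claims. [w0] and [w1] are the weights in the variable t = ln
    |z|; [v0] and [v1] include the Jacobian e^(m t), and [v1] also the factor |z|^(-p) that the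
    chain rule produces from f(ln |z|). *)
Variables (p C0 C r0 : R) (Omega : set T) (w0 w1 v0 v1 : R -> R) (W0 W1 : T -> R).
Hypotheses (p1 : 1 < p) (C00 : 0 <= C0) (C0C : C0 < C) (mO : measurable Omega).
Hypotheses (mw0 : measurable_fun [set: R] w0) (mw1 : measurable_fun [set: R] w1)
  (w00 : forall t, 0 <= w0 t) (w10 : forall t, 0 <= w1 t).
Hypotheses (mW0 : measurable_fun [set: T] W0) (mW1 : measurable_fun [set: T] W1)
  (W00 : forall x, 0 <= W0 x) (W10 : forall x, 0 <= W1 x).
Hypotheses (W0E : forall x, 0 < normz m x -> W0 x = w0 (ln (normz m x)))
  (W1E : forall x, 0 < normz m x -> W1 x = w1 (ln (normz m x))).
Hypotheses (v0E : forall t, v0 t = w0 t * expR (m%:R * t))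
  (v1E : forall t, v1 t = w1 t * expR (- (p * t)) * expR (m%:R * t)).
Hypotheses (r00 : 0 < r0)
  (subO : forall x : T, 0 < normz m x < r0 -> normrest m x < r0 -> Omega x).
Hypothesis opt : forall C1, C0 < C1 -> near_optimal p C1 v0 v1.
Hypothesis w10small : forall eps : R, 0 < eps ->
  exists t0 : R, forall t, t <= t0 -> w1 t <= eps * w0 t.

Let p0 : 0 < p. Proof. exact: lt_trans ltr01 p1. Qed.
Let pN0 : p != 0. Proof. by rewrite gt_eqF. Qed.
Let rho := r0 / 2.
Let rho0 : 0 < rho. Proof. by rewrite divr_gt0. Qed.

Let Hg (x : T) : R := Gfun m rho x `^ p.
Let H1 (x : T) : R := \1_[set x : T | normrest m x <= rho] x.

Let mHg : measurable_fun [set: T] Hg.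
Proof. by apply: measurable_powR_comp; exact: measurable_Gfun. Qed.

Let mH1 : measurable_fun [set: T] H1.
Proof.
apply: measurable_indic.
have := @measurable_normrest R n k m mn measurableT _ (measurable_itv `]-oo, rho]).
rewrite setTI (_ : _ @^-1` _ = [set x : T | normrest m x <= rho])//.
Qed.

Let Hg0 x : 0 <= Hg x. Proof. exact: powR_ge0. Qed.
Let H10 x : 0 <= H1 x. Proof. by rewrite /H1 indicE. Qed.
Let Hgd s x : Hg (dil m s x) = Hg x. Proof. by rewrite /Hg Gfun_dil. Qed.
Let H1d s x : H1 (dil m s x) = H1 x.
Proof.
rewrite /H1 !indicE (_ : (dil m s x \in _) = (x \in [set x : T | normrest m x <= rho]))//.
by apply/idP/idP; rewrite !inE /= normrest_dil.
Qed.

Let kgE : exists2 kg : R, 0 < kg & angular m Hg = kg%:E.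
Proof.
have lty : (angular m Hg < +oo)%E.
  apply: (angular_lty mn (r := rho)) => // [x|x xr].
    rewrite Hg0/= (_ : 1 = 1 `^ p); last by rewrite powR1.
    apply: ge0_ler_powR; rewrite ?nnegrE ?(ltW p0)//.
      exact: Gfun_ge0.
    exact: Gfun_le1.
  by rewrite /Hg Gfun_eq0 ?(powR0 pN0)// ltW.
have gt0 : (0 < angular m Hg)%E.
  apply: (@angular_gt0 _ _ _ _ m0 mn _ (rho / 2) (2^-1 `^ p)) => //.
  - exact: divr_gt0.
  move=> x xr; apply: ge0_ler_powR; rewrite ?nnegrE ?(ltW p0)//.
    exact: Gfun_ge0.
  exact: Gfun_ge.
exists (fine (angular m Hg)); first by rewrite fine_gt0// gt0.
by rewrite fineK// ge0_fin_numE// ltW.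
Qed.

Let k1E : exists2 k1 : R, 0 <= k1 & angular m H1 = k1%:E.
Proof.
have lty : (angular m H1 < +oo)%E.
  apply: (angular_lty mn (r := rho)) => // [x|x xr].
    by rewrite H10/= /H1 indicE lern1 leq_b1.
  by rewrite /H1 indicE memNset//= => h; move: xr; rewrite ltNge h.
have ge0 : (0 <= angular m H1)%E.
  by apply: lebN_ge0 => x; rewrite lee_fin !mulr_ge0 ?expR_ge0.
exists (fine (angular m H1)); first exact: fine_ge0.
by rewrite fineK// ge0_fin_numE.
Qed.

(** By [gradG_norm_rtest] and [powRD_split] the gradient integral is at most l j1 kg + CD j2 k1,
    against at least j kg for the other one. Here j1 <= C1 j by near-optimality and j2 <= eps j
    because w1 <= eps w0 on the support; l C1 < C leaves room for the second term. *)
Lemma radial_sharp : exists u, C10 Omega u /\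
  (intOn Omega (fun xi => gradG_norm gamma u xi `^ p * W1 xi)%R <
   C%:E * intOn Omega (fun xi => `|u xi| `^ p * W0 xi)%R)%E.
Proof.
pose C1 := (C0 + C) / 2.
have C0C1 : C0 < C1 by rewrite /C1; move: C0C; lra.
have C1C : C1 < C by rewrite /C1; move: C0C; lra.
have C10' : 0 < C1 by exact: le_lt_trans C0C1.
have [l l0 [lC [D D0 split_]]] := powRD_split p1 C10' C1C.
have [kg kg0 kgE'] := kgE; have [k1 k10 k1E'] := k1E.
pose CD := D * ((1 + rho) `^ gamma * (4 / rho)) `^ p.
have CD0 : 0 <= CD by rewrite mulr_ge0 ?powR_ge0// ltW.
(* Chosen so that CD eps k1 < (C - l C1) kg; the + 1 keeps the denominator positive when CD k1 =
   0. *)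
pose eps := (C - l * C1) * kg / (CD * k1 + 1).
have den0 : 0 < CD * k1 + 1 by rewrite ltr_wpDl// mulr_ge0.
have num0 : 0 < (C - l * C1) * kg by rewrite mulr_gt0// subr_gt0.
have eps0 : 0 < eps by rewrite divr_gt0.
have [t0 small] := w10small eps0.
(* A support below [t0] makes w1 <= eps w0 on it; a support below ln (r0 / 2) keeps the test
   function inside Omega. *)
have [f [df [A [B [j [[AB B0 BT] [[fE cdf fA fB] [j0 jE dj]]]]]]]] :=
  opt C0C1 (Num.min t0 (ln (r0 / 2))).
have Bt0 : B <= t0 by rewrite (le_trans BT)// ge_min lexx.
have Br : expR B < r0.
  apply: (@le_lt_trans _ _ (r0 / 2)); last by move: r00; lra.
  by rewrite -[leRHS]lnK ?posrE ?divr_gt0// ler_expR (le_trans BT)// ge_min lexx orbT.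
have geo (x : T) : 0 < normz m x -> normz m x <= expR B -> normrest m x <= rho -> Omega x.
  move=> h1 h2 h3; apply: subO; first by apply/andP; split => //; exact: le_lt_trans h2 Br.
  by apply: (le_lt_trans h3); rewrite /rho; move: r00; lra.
pose u := @rtest R n k m f rho.
have Cu : C10 Omega u := C10_rtest mn fE cdf fA fB B0 rho0 geo.
exists u; split => //.
have mf : measurable_fun [set: R] f.
  apply: continuous_measurable_fun => t; apply: differentiable_continuous.
  by apply/derivable1_diffP; have h := fE t; exact: ex_derive.
have mdf : measurable_fun [set: R] df := continuous_measurable_fun cdf.
have mabs (g : R -> R) : measurable_fun [set: R] g ->
    measurable_fun [set: R] (fun t => `|g t| `^ p).
  move=> mg; apply: (measurableT_comp (measurable_powR p)).
  exact: measurableT_comp.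
pose phi0 t := `|f t| `^ p * w0 t.
pose phi1 t := `|df t| `^ p * (w1 t * expR (- (p * t))).
pose phi2 t := `|f t| `^ p * w1 t.
have mexp (c : R) : measurable_fun [set: R] (fun t => expR (c * t)).
  by apply: (measurableT_comp (@measurable_expR R)); exact: measurable_funM.
have mphi0 : measurable_fun [set: R] phi0 by exact: (measurable_funM (mabs _ mf)).
have mphi1 : measurable_fun [set: R] phi1.
  apply: (measurable_funM (mabs _ mdf)); apply: measurable_funM => //; under eq_fun do rewrite -mulNr; exact: mexp.
have mphi2 : measurable_fun [set: R] phi2 by exact: (measurable_funM (mabs _ mf)).
have phi00 t : 0 <= phi0 t by rewrite mulr_ge0 ?powR_ge0.
have phi10 t : 0 <= phi1 t by rewrite !mulr_ge0 ?powR_ge0 ?expR_ge0.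
have phi20 t : 0 <= phi2 t by rewrite mulr_ge0 ?powR_ge0.
have E0 : (\int[lam]_t (phi0 t * expR (m%:R * t))%:E = j%:E)%E.
  by rewrite -jE; apply: eq_integral => t _; rewrite v0E mulrA.
have fin (phi : R -> R) (c : R) : (forall t, 0 <= phi t) ->
    (\int[lam]_t (phi t * expR (m%:R * t))%:E <= c%:E)%E ->
    exists2 b, 0 <= b <= c & (\int[lam]_t (phi t * expR (m%:R * t))%:E = b%:E)%E.
  move=> ph le.
  have ge0 : (0 <= \int[lam]_t (phi t * expR (m%:R * t))%:E)%E.
    by apply: integral_ge0 => t _; rewrite lee_fin mulr_ge0 ?expR_ge0.
  have fi : (\int[lam]_t (phi t * expR (m%:R * t))%:E \is a fin_num)%E.
    by rewrite ge0_fin_numE// (le_lt_trans le)// ltry.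
  exists (fine (\int[lam]_t (phi t * expR (m%:R * t))%:E)%E); last by rewrite fineK.
  by rewrite fine_ge0//= -lee_fin fineK.
have [j1 /andP[j10 j1C] E1] : exists2 b, 0 <= b <= C1 * j &
    (\int[lam]_t (phi1 t * expR (m%:R * t))%:E = b%:E)%E.
  apply: fin => //; apply: le_trans dj; rewrite le_eqVlt; apply/orP; left; apply/eqP.
  by apply: eq_integral => t _; rewrite v1E mulrA.
have [j2 /andP[j20 j2C] E2] : exists2 b, 0 <= b <= eps * j &
    (\int[lam]_t (phi2 t * expR (m%:R * t))%:E = b%:E)%E.
  apply: fin => //; rewrite EFinM -E0 -ge0_integralZl//.
  - apply: ge0_le_integral => //.
    + by move=> t _; rewrite lee_fin mulr_ge0 ?expR_ge0.
    + by apply/measurable_EFinP; exact: (measurable_funM mphi2 (mexp _)).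
    + by apply: measurable_funeM; apply/measurable_EFinP; exact: (measurable_funM mphi0 (mexp _)).
    move=> t _; rewrite lee_fin mulrA ler_wpM2r ?expR_ge0// /phi2 /phi0.
    have [tB|Bt] := leP B t; first by rewrite (fB _ tB).1 normr0 powR0// !mul0r mulr0.
    rewrite mulrCA; apply: ler_wpM2l; first exact: powR_ge0.
    by apply: small; exact: le_trans (ltW Bt) Bt0.
  - by apply/measurable_EFinP; exact: (measurable_funM mphi0 (mexp _)).
  - by move=> t _; rewrite lee_fin mulr_ge0 ?expR_ge0.
  - by rewrite lee_fin ltW.
have mln : measurable_fun [set: T] (fun x : T => ln (normz m x)).
  exact: (measurableT_comp (@measurable_ln R) (measurable_normz mn)).
have mprod (phi : R -> R) (H : T -> R) : measurable_fun [set: R] phi ->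
    measurable_fun [set: T] H ->
    measurable_fun [set: T] (fun x => (phi (ln (normz m x)) * H x)%:E).
  move=> mphi mH; apply/measurable_EFinP; apply: measurable_funM => //.
  exact: (measurableT_comp mphi).
have lower : (j%:E * kg%:E <= intOn Omega (fun xi => `|u xi| `^ p * W0 xi)%R)%E.
  rewrite -kgE' -(lebN_radial m0 mn mphi0 phi00 mHg Hg0 Hgd E0).
  apply: le_lebN_normz.
  - exact: mprod.
  - by apply: measurable_intOn => //; apply: measurable_funM => //; exact: (measurable_absr_powR_C10 _ Cu).
  - by move=> x; rewrite lee_fin mulr_ge0.
  - by move=> x; case: ifP => // _; rewrite lee_fin mulr_ge0 ?powR_ge0.
  move=> x zx.
  have ux : phi0 (ln (normz m x)) * Hg x = `|u x| `^ p * W0 x.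
    rewrite W0E// /u rtestE// normrM powRM// (ger0_norm (Gfun_ge0 _ _ _)).
    by rewrite /phi0 -/(Hg x) mulrAC.
  case: asboolP => [_|nO]; first by rewrite ux.
  have [u0|/(rtest_neq0 mn fA fB B0 rho0) [h1 h2 h3]] := eqVneq (u x) 0; last by case: nO; exact: geo.
  by rewrite ux u0 normr0 powR0// mul0r.
have upper : (intOn Omega (fun xi => gradG_norm gamma u xi `^ p * W1 xi)%R <=
    l%:E * (j1%:E * kg%:E) + CD%:E * (j2%:E * k1%:E))%E.
  have m1 := mprod _ _ mphi1 mHg; have m2 := mprod _ _ mphi2 mH1.
  rewrite -kgE' -k1E' -(lebN_radial m0 mn mphi1 phi10 mHg Hg0 Hgd E1).
  rewrite -(lebN_radial m0 mn mphi2 phi20 mH1 H10 H1d E2).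
  rewrite -lebNZl ?(ltW l0)//; last by move=> x; rewrite lee_fin mulr_ge0.
  rewrite -lebNZl//; last by move=> x; rewrite lee_fin mulr_ge0.
  rewrite -lebND; last 4 first.
  - exact: measurable_funeM.
  - exact: measurable_funeM.
  - by move=> x; rewrite -EFinM lee_fin !mulr_ge0// ltW.
  - by move=> x; rewrite -EFinM lee_fin; apply: mulr_ge0 => //; exact: mulr_ge0.
  apply: le_lebN_normz.
  - by apply: measurable_intOn => //; apply: measurable_funM => //; apply: measurable_powR_comp; exact: (measurable_gradG_norm _ Cu).
  - by apply: emeasurable_funD; exact: measurable_funeM.
  - by move=> x; case: ifP => // _; rewrite lee_fin mulr_ge0 ?powR_ge0.
  - move=> x; rewrite -!EFinM -EFinD lee_fin; apply: addr_ge0; apply: mulr_ge0 => //.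
    + exact: ltW.
    + exact: mulr_ge0.
    + exact: mulr_ge0.
  move=> x zx.
  apply: (@le_trans _ _ (gradG_norm gamma u x `^ p * W1 x)%:E).
    by case: ifP => // _; rewrite lee_fin mulr_ge0 ?powR_ge0.
  rewrite -!EFinM -EFinD lee_fin W1E//.
  have gr := gradG_norm_rtest mn gamma0 fE fA fB B0 rho0 zx.
  set z := normz m x in zx gr *.
  have a0 : 0 <= `|df (ln z)| / z * Gfun m rho x.
    by apply: mulr_ge0; [apply: divr_ge0 => //; exact: ltW|exact: Gfun_ge0].
  have b0 : 0 <= (1 + rho) `^ gamma * (4 / rho) * (`|f (ln z)| * H1 x).
    by rewrite !mulr_ge0 ?powR_ge0 ?invr_ge0// ltW.
  have := le_trans (ge0_ler_powR (ltW p0) (sqrtr_ge0 _) (addr_ge0 a0 b0) gr) (split_ _ _ a0 b0).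
  move=> /(ler_wpM2r (w10 (ln z)))/le_trans; apply.
  rewrite mulrDl; apply: lerD.
    rewrite -!mulrA; apply: ler_wpM2l; first exact: ltW.
    rewrite mulrA powRM ?Gfun_ge0 ?divr_ge0 ?(ltW zx)// -/(Hg x).
    rewrite powRM ?invr_ge0 ?(ltW zx)// -powR_inv1 ?(ltW zx)// -powRrM mulN1r.
    rewrite {2}/powR gt_eqF// mulNr /phi1.
    by rewrite le_eqVlt; apply/orP; left; apply/eqP; ring.
  rewrite powRM ?mulr_ge0 ?powR_ge0 ?invr_ge0 ?(ltW rho0)//.
  rewrite [(_ * H1 x) `^ p]powRM// (_ : H1 x `^ p = H1 x); last first.
    by rewrite /H1 indicE; case: (_ \in _); rewrite ?powR1 ?powR0.
  rewrite /CD /phi2; rewrite le_eqVlt; apply/orP; left; apply/eqP; ring.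
apply: (le_lt_trans upper); apply: (@lt_le_trans _ _ (C%:E * (j%:E * kg%:E))%E); last first.
  apply: lee_wpmul2l => //; rewrite lee_fin ltW//; exact: le_lt_trans C0C.
rewrite -!EFinM -EFinD lte_fin.
apply: (@le_lt_trans _ _ (l * (C1 * j * kg) + CD * (eps * j * k1))).
  apply: lerD; first by rewrite ler_wpM2l ?(ltW l0)// ler_wpM2r// ltW.
  by rewrite ler_wpM2l// ler_wpM2r.
rewrite -ltrBrDl (_ : CD * _ = (C - l * C1) * kg * j * (CD * k1 / (CD * k1 + 1))); last first.
  by rewrite /eps; field; rewrite gt_eqF.
rewrite [ltRHS](_ : _ = (C - l * C1) * kg * j); last by ring.
rewrite gtr_pMr; last exact: mulr_gt0.
by rewrite ltr_pdivrMr// mul1r ltrDl.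
Qed.

End radial_sharp.

(** * Sharpness of the two constants *)

Lemma powR_posE (R : realType) (z a : R) : 0 < z -> z `^ a = expR (a * ln z).
Proof. by move=> z0; rewrite /powR gt_eqF. Qed.

(** After taking p-th roots the claim is s <= d e^s with d = c^(1/p); it follows from e^s >= (s /
    2)^2 once s >= 4 / d. *)
Lemma exp_dominates_powR (R : realType) (p c : R) : 0 < p -> 0 < c ->
  exists2 s0 : R, 0 < s0 & forall s, s0 <= s -> s `^ p <= c * expR (p * s).
Proof.
move=> p0 c0; pose d := c `^ p^-1; have d0 : 0 < d by exact: powR_gt0.
exists (4 / d); first exact: divr_gt0.
move=> s hs; have s0 : 0 < s by apply: lt_le_trans hs; exact: divr_gt0.
have -> : c = d `^ p by rewrite /d -powRrM mulVf ?gt_eqF// powRr1// ltW.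
rewrite (mulrC p) expRM -powRM ?expR_ge0 ?(ltW d0)//.
apply: ge0_ler_powR; rewrite ?nnegrE ?(ltW p0) ?(ltW s0) ?mulr_ge0 ?expR_ge0 ?(ltW d0)//.
have h4 : 4 <= s * d by rewrite -ler_pdivrMr.
have e2 : s / 2 <= expR (s / 2).
  by apply: le_trans (expR_ge1Dx _); rewrite lerDr.
have -> : expR s = expR (s / 2) * expR (s / 2) by rewrite -expRD -splitr.
apply: (@le_trans _ _ (d * (s / 2 * (s / 2)))).
  rewrite (_ : d * _ = s * (s * d / 4)); last by field.
  by rewrite ler_peMr ?(ltW s0)// ler_pdivlMr// mul1r.
by rewrite ler_wpM2l ?(ltW d0)// ler_pM// divr_ge0// ltW.
Qed.

Section sharpness.
Variables (R : realType) (n k m : nat) (gamma : R).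
Hypotheses (m0 : (0 < m)%N) (mn : (m <= n)%N) (gamma0 : 0 <= gamma).
Let T := 'rV[R]_(n + k).

Lemma hardy_power_sharp (p beta C : R) (Omega : set T) : 1 < p -> open Omega ->
  (exists r : R, 0 < r /\
     [set xi : T | 0 < normz m xi < r /\ normrest m xi < r] `<=` Omega) ->
  (`|m%:R + beta| / p) `^ p < C ->
  exists u, C10 Omega u /\
   (intOn Omega (fun xi => (gradG_norm gamma u xi `^ p * normz m xi `^ (p + beta))%R)
    < C%:E * intOn Omega (fun xi => (`|u xi| `^ p * normz m xi `^ beta)%R))%E.
Proof.
move=> p1 oO [r [r0 sub]] bC; have p0 : 0 < p := lt_trans ltr01 p1.
have mexp (c : R) : measurable_fun [set: R] (fun t => expR (c * t)).
  by apply: (measurableT_comp (@measurable_expR R)); exact: measurable_funM.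
apply: (radial_sharp m0 mn gamma0 (w0 := fun t => expR (beta * t))
  (w1 := fun t => expR ((p + beta) * t)) (r0 := r)
  (v0 := fun t => expR ((m%:R + beta) * t))
  (v1 := fun t => expR ((m%:R + beta) * t)) p1 (powR_ge0 _ _) bC).
- exact: open_measurable_row.
- exact: mexp.
- exact: mexp.
- by move=> t; exact: expR_ge0.
- by move=> t; exact: expR_ge0.
- by apply: measurable_powR_comp; exact: measurable_normz.
- by apply: measurable_powR_comp; exact: measurable_normz.
- by move=> x; exact: powR_ge0.
- by move=> x; exact: powR_ge0.
- by move=> x; exact: powR_posE.
- by move=> x; exact: powR_posE.
- by move=> t; rewrite -expRD; congr expR; ring.
- by move=> t; rewrite -!expRD; congr expR; ring.
- exact: r0.
- by move=> x h1 h2; apply: sub.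
- by move=> C1 h; exact: near_optimal_exp.
(* w1 = e^(p t) w0, so t <= ln eps / p suffices. *)
move=> eps eps0; exists (ln eps / p) => t; rewrite ler_pdivlMr// => h.
rewrite mulrDl expRD ler_wpM2r ?expR_ge0// -[leRHS]lnK ?posrE// ler_expR.
by rewrite mulrC.
Qed.

Lemma hardy_log_ball_sharp (r beta C : R) : 1 < m%:R :> R -> 0 < r -> beta < -1 ->
  let p : R := m%:R in let Omega := [set xi : T | normz m xi < r] in
  (`|beta + 1| / p) `^ p < C ->
  exists u, C10 Omega u /\
   (intOn Omega (fun xi => (gradG_norm gamma u xi `^ p * ln (r / normz m xi) `^ (p + beta))%R)
    < C%:E * intOn Omega (fun xi => (`|u xi| `^ p / normz m xi `^ p
        * ln (r / normz m xi) `^ beta)%R))%E.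
Proof.
move=> p1 r0 b1 p Omega bC; have p0 : 0 < p := lt_trans ltr01 p1.
have lnE (x : T) : 0 < normz m x -> ln (r / normz m x) = ln r - ln (normz m x).
  by move=> h; rewrite lnM ?posrE ?invr_gt0// lnV ?posrE.
have mlin (a : R) : measurable_fun [set: R] (fun t => (ln r - t) `^ a).
  by apply: (measurableT_comp (measurable_powR a)); exact: measurable_funB.
have mln (a : R) : measurable_fun [set: T] (fun x => ln (r / normz m x) `^ a).
  by apply: measurable_powR_comp; exact: measurable_ln_normz.
suff [u [Cu hu]] : exists u, C10 Omega u /\
   (intOn Omega (fun xi => (gradG_norm gamma u xi `^ p * ln (r / normz m xi) `^ (p + beta))%R)
    < C%:E * intOn Omega (fun xi => (`|u xi| `^ p * ((normz m xi `^ p)^-1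
        * ln (r / normz m xi) `^ beta))%R))%E.
  exists u; split => //; apply: (lt_le_trans hu); rewrite le_eqVlt; apply/orP; left.
  by apply/eqP; congr (_ * intOn _ _)%E; apply/funext => x; rewrite mulrA.
apply: (radial_sharp m0 mn gamma0
  (w0 := fun t => expR (- (p * t)) * (ln r - t) `^ beta)
  (w1 := fun t => (ln r - t) `^ (p + beta)) (r0 := r)
  (v0 := fun t => (ln r - t) `^ beta) (v1 := fun t => (ln r - t) `^ (p + beta))
  p1 (powR_ge0 _ _) bC).
- by apply: open_measurable_row; exact: open_normz_lt.
- apply: measurable_funM => //; apply: (measurableT_comp (@measurable_expR R)).
  by apply: measurableT_comp => //; exact: measurable_funM.
- exact: mlin.
- by move=> t; rewrite mulr_ge0 ?expR_ge0 ?powR_ge0.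
- by move=> t; exact: powR_ge0.
- under eq_fun do rewrite -powRN; apply: measurable_funM => //.
  by apply: measurable_powR_comp; exact: measurable_normz.
- exact: mln.
- by move=> x; rewrite mulr_ge0 ?invr_ge0 ?powR_ge0.
- by move=> x; exact: powR_ge0.
- by move=> x x0; rewrite -powRN powR_posE// lnE// mulNr.
- by move=> x x0; rewrite lnE.
- by move=> t; rewrite mulrAC -expRD addNr expR0 mul1r.
- by move=> t; rewrite -mulrA -expRD addNr expR0 mulr1.
- exact: r0.
- by move=> x /andP[_ h] _.
- by move=> C1 h; exact: near_optimal_log.
move=> eps eps0.
(* With s = ln r - t the requirement w1 <= eps w0 reads s^p <= eps e^(-p ln r) e^(p s). *)
have [s0 s00 hs] : exists2 s0 : R, 0 < s0 & forall s, s0 <= s ->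
    s `^ p <= eps * expR (- (p * ln r)) * expR (p * s).
  by apply: exp_dominates_powR => //; rewrite mulr_gt0 ?expR_gt0.
exists (ln r - s0) => t ht; have st : s0 <= ln r - t by lra.
have tp : 0 < ln r - t by exact: lt_le_trans st.
rewrite powRD ?(gt_eqF tp) ?implybT// mulrA ler_wpM2r ?powR_ge0//.
apply: le_trans (hs _ st) _; rewrite -mulrA -expRD.
by rewrite (_ : _ + _ = - (p * t)) //; ring.
Qed.

End sharpness.

Theorem mainTheorem10 (R : realType) (n k m : nat) (gamma : R) :
  (1 <= m)%N -> (m <= n)%N -> 0 <= gamma ->
  (* Part (1) *)
  (forall (p beta : R) (Omega : set 'rV[R]_(n + k)),
    1 < p -> open Omega ->
    (m%:R + beta < 0 -> Omega `<=` [set xi | normz m xi != 0]) ->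
    (forall u, C10 Omega u ->
      ((((`|m%:R + beta| / p) `^ p)%R)%:E *
        intOn Omega (fun xi => (`|u xi| `^ p * normz m xi `^ beta)%R)
      <= intOn Omega (fun xi => (gradG_norm gamma u xi `^ p * normz m xi `^ (p + beta))%R))%E)
    /\
    ((m%:R - p < 0 -> Omega `<=` [set xi | normz m xi != 0]) ->
     forall u, C10 Omega u ->
      ((((`|m%:R - p| / p) `^ p)%R)%:E *
        intOn Omega (fun xi => (`|u xi| `^ p / gaugeG gamma xi `^ p)%R)
      <= (((`|m%:R - p| / p) `^ p)%R)%:E *
        intOn Omega (fun xi => (`|u xi| `^ p / normz m xi `^ p)%R))%E
      /\ ((((`|m%:R - p| / p) `^ p)%R)%:E *
        intOn Omega (fun xi => (`|u xi| `^ p / normz m xi `^ p)%R)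
      <= intOn Omega (fun xi => (gradG_norm gamma u xi `^ p)%R))%E)
    /\
    ((exists r : R, 0 < r /\
        [set xi | 0 < normz m xi < r /\ normrest m xi < r] `<=` Omega) ->
     forall C : R, (`|m%:R + beta| / p) `^ p < C ->
     exists u, C10 Omega u /\
      (intOn Omega (fun xi => (gradG_norm gamma u xi `^ p * normz m xi `^ (p + beta))%R)
       < C%:E * intOn Omega (fun xi => (`|u xi| `^ p * normz m xi `^ beta)%R))%E))
  /\
  (* Part (2) *)
  (forall (Rr beta : R), 1 < m%:R :> R -> 0 < Rr -> beta < -1 ->
    let p : R := m%:R in
    let Omega := [set xi : 'rV[R]_(n + k) | normz m xi < Rr] in
    (forall u, C10 Omega u ->
      ((((`|beta + 1| / p) `^ p)%R)%:E *
        intOn Omega (fun xi => (`|u xi| `^ p / normz m xi `^ p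
                                 * ln (Rr / normz m xi) `^ beta)%R)
      <= intOn Omega (fun xi => (gradG_norm gamma u xi `^ p
                                 * ln (Rr / normz m xi) `^ (p + beta))%R))%E)
    /\
    (forall u, C10 Omega u ->
      (((((p - 1) / p) `^ p)%R)%:E *
        intOn Omega (fun xi => (`|u xi| `^ p / (normz m xi * ln (Rr / normz m xi)) `^ p)%R)
      <= intOn Omega (fun xi => (gradG_norm gamma u xi `^ p)%R))%E)
    /\
    (forall C : R, (`|beta + 1| / p) `^ p < C ->
     exists u, C10 Omega u /\
      (intOn Omega (fun xi => (gradG_norm gamma u xi `^ p
                                 * ln (Rr / normz m xi) `^ (p + beta))%R)
       < C%:E * intOn Omega (fun xi => (`|u xi| `^ p / normz m xi `^ p
                                 * ln (Rr / normz m xi) `^ beta)%R))%E)).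
Proof.
move=> m0 mn gamma0; split; last first.
  move=> Rr beta m1 Rr0 b1 p Omega; split; first by move=> u; exact: hardy_log_ball.
  split; first by move=> u; exact: hardy_log_ball_sharp_exponent.
  by move=> C; exact: hardy_log_ball_sharp.
move=> p beta Omega p1 oO Oz; have p0 : 0 < p := lt_trans ltr01 p1.
split; first by move=> u; exact: hardy_power.
split; last by move=> sub C; exact: hardy_power_sharp.
move=> Oz' u Cu; split.
  by apply: le_intOn_gauge => //; exact: powR_ge0.
(* The unweighted inequality is the case beta = -p, where the right-hand weight is |z|^0 = 1. *)
have := hardy_power gamma m0 mn p1 oO Oz' Cu.
rewrite (_ : (fun xi => `|u xi| `^ p * normz m xi `^ (- p)) =
  (fun xi => `|u xi| `^ p / normz m xi `^ p)); last first.
  by apply/funext => xi; rewrite powRN.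
rewrite (_ : (fun xi => gradG_norm gamma u xi `^ p * normz m xi `^ (p + - p)) =
  (fun xi => gradG_norm gamma u xi `^ p))//.
by apply/funext => xi; rewrite subrr powRr0 mulr1.
Qed.
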